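(* Let $d\ge 1$ be an integer and let $\alpha,\beta>0$. There exists a constant $c>0$ depending only on $d,\alpha$ and $\beta$ such that the following holds. Suppose that $G$ is an entire function on $\mathbb{C}^d$, not identically zero, such that $\sup_{|z|\le r}|G(z)|\le |G(0)|\,e^{\alpha r^\beta}$ for all $r>0$. Then $$ \|G'/G\|_{L^1(B_r)}\le c\, r^{2d+\beta-1}\quad\text{for all } r>0. $$
   Context: $B_r=\{z\in\mathbb{C}^d:|z|<r\}$, and $\mathbb{C}^d$ is identified with $\mathbb{R}^{2d}$ (equipped with Lebesgue measure). $G'=(\partial G/\partial z_1,\dots,\partial G/\partial z_d)^T$ is the vector of complex partial derivatives, and for vector-valued $F$, $\|F\|_{L^1(B_r)}=\int_{B_r}|F|$ with $|F|$ the Euclidean length. The quotient $G'/G$ is defined off the zero set of $G$, i.e., almost everywhere. *)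

(* Defs.v *)
From HB Require Import structures.
From mathcomp Require Import all_boot all_order all_algebra.
From mathcomp Require Import all_classical all_reals all_analysis.
From mathcomp Require Import complex.

Set Implicit Arguments.
Unset Strict Implicit.
Unset Printing Implicit Defensive.

Import Order.TTheory GRing.Theory Num.Theory.
Import numFieldNormedType.Exports.

Local Open Scope classical_set_scope.
Local Open Scope ring_scope.

Definition tuple_cons (T : Type) (n : nat) (p : T * n.-tuple T) :
  n.+1.-tuple T := [tuple of p.1 :: p.2].

Section lebesgue_tuple_succ.
Context {R : realType} (n : nat).
Variable mu :
  {sigma_finite_measure set (n.-tuple (measurableTypeR R)) -> \bar R}.

Let T : measurableType _ := measurableTypeR R.

Lemma measurable_tuple_cons :
  measurable_fun [set: T * n.-tuple T] (@tuple_cons T n).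
Proof. exact: measurable_cons. Qed.

Definition lebesgue_tupleS : set (n.+1.-tuple T) -> \bar R :=
  pushforward (lebesgue_measure \x mu)%E (@tuple_cons T n).

HB.instance Definition _ := Measure.copy lebesgue_tupleS
  (measure_function_pushforward__canonical__measure_function_Measure
     (lebesgue_measure \x mu)%E measurable_tuple_cons).

Let sigma_finite_lebesgue_tupleS : sigma_finite setT lebesgue_tupleS.
Proof.
have /sigma_finiteP[F [FT ndF Foo]] := sigma_finiteT (@lebesgue_measure R).
have /sigma_finiteP[G [GT ndG Goo]] := sigma_finiteT mu.
pose g (t : n.+1.-tuple T) : T * n.-tuple T := (thead t, [tuple of behead t]).
have mg : measurable_fun setT g.
  apply/measurable_fun_pairP; split; last exact: measurable_behead.
  exact: measurable_tnth.
have gK p : g (tuple_cons p) = p.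
  by case: p => a t; congr pair; exact/val_inj.
exists (fun k => g @^-1` (F k `*` G k)) => [|k].
  apply/esym; rewrite -subTset => t _.
  have : (\bigcup_k F k) (thead t) by rewrite -FT.
  have : (\bigcup_k G k) [tuple of behead t] by rewrite -GT.
  move=> [j _ Gj] [i _ Fi]; exists (maxn i j) => //; split => /=.
    by move: Fi; exact/subsetPset/ndF/leq_maxl.
  by move: Gj; exact/subsetPset/ndG/leq_maxr.
have [mF Fk] := Foo k; have [mG Gk] := Goo k.
split.
  by rewrite -[X in measurable X]setTI; apply: mg => //; exact: measurableX.
rewrite /lebesgue_tupleS /pushforward -comp_preimage.
rewrite (_ : g \o _ = id) ?preimage_id; last exact/funext.
by rewrite product_measure1E// lte_mul_pinfty// ge0_fin_numE.
Qed.

HB.instance Definition _ := @Measure_isSigmaFinite.Build _ _ _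
  lebesgue_tupleS sigma_finite_lebesgue_tupleS.

End lebesgue_tuple_succ.

Fixpoint lebesgue_tuple (R : realType) (n : nat) :
    {sigma_finite_measure set (n.-tuple (measurableTypeR R)) -> \bar R} :=
  if n is n'.+1 then lebesgue_tupleS (lebesgue_tuple R n') else \d_[tuple].

(* [R[i]] under a type that carries the library's norm topology, so that
   [differentiable] and ['D_v] over it are complex-linear notions. *)
Definition cplx (R : realType) : numClosedFieldType := R[i].

Section complex_space.
Context {R : realType} {d : nat}.
Implicit Types (z : 'rV[cplx R]_d) (G : 'rV[cplx R]_d -> cplx R).

Definition cabs (w : cplx R) : R := Normc.normc w.

(* The library norm of ['rV_d] is the sup norm; this is the Euclidean length. *)
Definition enorm z : R := Num.sqrt (\sum_j cabs (z 0 j) ^+ 2).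

Definition entire G : Prop := forall z, differentiable G z.

Definition cgradient G z : 'rV[cplx R]_d := \row_j 'D_(delta_mx 0 j) G z.

(* (x_0, y_0, x_1, y_1, ...) |-> (x_0 + i y_0, x_1 + i y_1, ...) *)
Definition cvec (x : (d.*2).-tuple (measurableTypeR R)) : 'rV[cplx R]_d :=
  \row_j (nth 0 (x : seq R) j.*2 +i* nth 0 (x : seq R) j.*2.+1)%C.

Definition L1norm_ball (r : R) (F : 'rV[cplx R]_d -> 'rV[cplx R]_d) : \bar R :=
  (\int[lebesgue_tuple R d.*2]_(x in [set x | enorm (cvec x) < r]%R)
     (enorm (F (cvec x)))%:E)%E.

(* As [0^-1 = 0], this vanishes on the zero set of [G], so integrating it over
   a set amounts to integrating over the part of the set where [G] is nonzero. *)
Definition log_gradient G z : 'rV[cplx R]_d := (G z)^-1 *: cgradient G z.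

End complex_space.

(* Main.v *)
(* Write B for the box [-r, r]^(2d), which contains the ball of radius r, and
   E(w) = ln (M' / |w|). Both |G'_j / G| (with G'_j the j-th partial derivative)
   and E(G) can be estimated one complex variable at a time: for f entire in one
   variable, |f| <= M < M' on the disc of radius 12 r, and Q = [-r, r]^2,
     int_Q |f' / f| <= C r E(f(0)),   int_Q E(f) <= C r^2 E(f(0)).
   By Tonelli, the first bound in the variable z_j followed by the second in each
   of the others yields
     int_B |G'_j / G| <= C' r^(2d - 1) E(G(0)),
   and M' = |G(0)| exp (2 alpha (12 r sqrt d)^beta) makes E(G(0)) a multiple of
   r^beta.
     By Taylor expansion and Fatou's lemma the one-variable bounds reduce to
   polynomials. There, each zero a near the origin contributes int_Q 1 / |z - a| <=
   96 r, and there are at most E(f(0)) / ln 2 of them; the quotient by these zeros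
   has a logarithm on a larger disc, whose Taylor coefficients are controlled by
   the Borel-Caratheodory inequality. *)
Require Import Defs.
From HB Require Import structures.
From mathcomp Require Import all_boot all_order all_algebra.
From mathcomp Require Import all_classical all_reals all_analysis.
From mathcomp Require Import measurable_realfun.
From mathcomp Require Import cyclic separable cyclotomic complex.
From mathcomp Require Import ring lra zify.

Set Implicit Arguments.
Unset Strict Implicit.
Unset Printing Implicit Defensive.

Import Order.TTheory GRing.Theory Num.Theory.
Import numFieldNormedType.Exports.
Import Normc.

Local Open Scope classical_set_scope.
Local Open Scope ring_scope.

Local Notation Re := complex.Re.
Local Notation Im := complex.Im.

(** The centre value [f(0)] of a slice can be arbitrarily small, so no bound uniform over the slices
    exists. Bounding by [E(f(0))] is what closes the recursion: as a function of the remaining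
    variables it is again of the form [E(G)], with one more coordinate set to 0. Since [E] is +oo at
    0, the one-variable bounds hold even for slices that vanish at their centre or identically; only
    [G(0) != 0] matters in the end, and the growth hypothesis forces it. Passing to polynomials
    makes the list of zeros finite and replaces circle means by averages over roots of unity. As the
    approximants are bounded only up to an error, a strict gap [M < M'] is kept; this is the reason
    for the factor 2 in the exponent of M'. The radii: zeros with |a| <= 4 r satisfy |z - a| >= 8 r
    on |z| = 12 r; the maximum modulus step halves 12 r to 6 r; the zero-free quotient is studied on
    radius 3 r, its zeros lying beyond 4/3 of that; halving once more leaves 3/2 r, and sqrt 2 <=
    3/2 puts Q inside. *)

Section normc.
Context {R : realType}.
Implicit Types (z w : R[i]).

Lemma normc_ge0 z : 0 <= normc z.
Proof. by case: z => a b; exact: sqrtr_ge0. Qed.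

Lemma normc_eq0 z : (normc z == 0) = (z == 0).
Proof. by apply/eqP/eqP => [/eq0_normc//|->]; rewrite normc0. Qed.

Lemma normc_gt0 z : (0 < normc z) = (z != 0).
Proof. by rewrite lt_def normc_eq0 normc_ge0 andbT. Qed.

Lemma normc_distC z w : normc (z - w) = normc (w - z).
Proof. by rewrite -normcN opprB. Qed.

Lemma le_normcB z w : normc (z - w) <= normc z + normc w.
Proof. by rewrite (le_trans (le_normcD _ _))// normcN. Qed.

Lemma lerB_normc z w : normc z - normc w <= normc (z - w).
Proof. by rewrite lerBlDr (le_trans _ (le_normcD _ _))// subrK. Qed.

Lemma normcX z n : normc (z ^+ n) = normc z ^+ n.
Proof. by elim: n => [|n IH]; rewrite ?expr0 ?normc1// !exprS normcM IH. Qed.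

Lemma normc_real (x : R) : normc (x%:C)%C = `|x|.
Proof. by rewrite /= expr0n addr0 sqrtr_sqr. Qed.

Lemma normci : normc ('i : R[i])%C = 1.
Proof. by rewrite /= expr0n add0r expr1n sqrtr1. Qed.

Lemma normr_Re z : `|Re z| <= normc z.
Proof. by case: z => a b /=; rewrite -sqrtr_sqr ler_wsqrtr// lerDl sqr_ge0. Qed.

Lemma normr_Im z : `|Im z| <= normc z.
Proof. by case: z => a b /=; rewrite -sqrtr_sqr ler_wsqrtr// lerDr sqr_ge0. Qed.

Lemma sqr_normc_def z : normc z ^+ 2 = Re z ^+ 2 + Im z ^+ 2.
Proof. by case: z => a b /=; rewrite sqr_sqrtr// addr_ge0// sqr_ge0. Qed.

Lemma normc_le_ReIm z : normc z <= `|Re z| + `|Im z|.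
Proof.
rewrite -(@ler_pXn2r _ 2)// ?nnegrE ?normc_ge0 ?addr_ge0//.
rewrite sqr_normc_def sqrrD !real_normK ?num_real// -addrA lerD2l lerDr.
by rewrite mulrn_wge0// mulr_ge0.
Qed.

Lemma normc_sum I (r : seq I) (P : pred I) (F : I -> R[i]) :
  normc (\sum_(i <- r | P i) F i) <= \sum_(i <- r | P i) normc (F i).
Proof.
elim/big_ind2: _ => [|x1 x2 y1 y2 h1 h2|i _]; rewrite ?normc0//.
by rewrite (le_trans (le_normcD _ _))// lerD.
Qed.

Lemma normc_prod I (r : seq I) (P : pred I) (F : I -> R[i]) :
  normc (\prod_(i <- r | P i) F i) = \prod_(i <- r | P i) normc (F i).
Proof. by apply: (big_morph _ (@normcM R)); exact: normc1. Qed.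

Lemma normc_natr n : normc (n%:R : R[i]) = n%:R.
Proof. by rewrite -(rmorph_nat (real_complex R)) normc_real normr_nat. Qed.

Lemma normCE z : `|z| = ((normc z)%:C)%C. Proof. by []. Qed.

End normc.

Lemma normc_unity {R : realType} (w : R[i]) n : (0 < n)%N -> w ^+ n = 1 -> normc w = 1.
Proof.
move=> n0 wn; have : normc w ^+ n = 1 by rewrite -normcX wn normc1.
by move/eqP; rewrite pexpr_eq1 ?normc_ge0// => /eqP.
Qed.

(** * Cauchy's theorem on rectangles *)

Section complex_paths.
Context {R : realType}.
Notation mu := (@lebesgue_measure R).
Implicit Types (g h : R -> R[i]).

(** Paths are handled through real and imaginary parts, so that integrability, the derivative rules
    and the fundamental theorem are those of real analysis. *)
Definition ccont g :=
  continuous (fun s => Re (g s) : R) /\ continuous (fun s => Im (g s) : R).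

Definition cder g (dg : R -> R[i]) := forall s : R,
  is_derive s 1 (fun s => Re (g s) : R) (Re (dg s)) /\
  is_derive s 1 (fun s => Im (g s) : R) (Im (dg s)).

Lemma cReD (z w : R[i]) : Re (z + w) = Re z + Re w. Proof. by case: z; case: w. Qed.
Lemma cImD (z w : R[i]) : Im (z + w) = Im z + Im w. Proof. by case: z; case: w. Qed.
Lemma cReN (z : R[i]) : Re (- z) = - Re z. Proof. by case: z. Qed.
Lemma cImN (z : R[i]) : Im (- z) = - Im z. Proof. by case: z. Qed.
Lemma cReM (z w : R[i]) : Re (z * w) = Re z * Re w - Im z * Im w.
Proof. by case: z; case: w. Qed.
Lemma cImM (z w : R[i]) : Im (z * w) = Re z * Im w + Im z * Re w.
Proof. by case: z; case: w. Qed.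
Lemma cReV (z : R[i]) : Re z^-1 = Re z / (Re z ^+ 2 + Im z ^+ 2).
Proof. by case: z. Qed.
Lemma cImV (z : R[i]) : Im z^-1 = - (Im z / (Re z ^+ 2 + Im z ^+ 2)).
Proof. by case: z. Qed.

Definition ReImE := (cReD, cImD, cReN, cImN, cReM, cImM, cReV, cImV).

Lemma sqr_ReIm_gt0 (z : R[i]) : z != 0 -> 0 < Re z ^+ 2 + Im z ^+ 2.
Proof. by move=> z0; rewrite -sqr_normc_def exprn_gt0// normc_gt0. Qed.

Lemma ccont_cst c : ccont (fun=> c).
Proof. by split => s; exact: cvg_cst. Qed.

Lemma ccontD g h : ccont g -> ccont h -> ccont (fun s => g s + h s).
Proof.
move=> [g1 g2] [h1 h2]; split => s; rewrite /continuous_at.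
- under eq_fun do rewrite cReD; rewrite cReD; exact: cvgD (g1 s) (h1 s).
- under eq_fun do rewrite cImD; rewrite cImD; exact: cvgD (g2 s) (h2 s).
Qed.

Lemma ccontM g h : ccont g -> ccont h -> ccont (fun s => g s * h s).
Proof.
move=> [g1 g2] [h1 h2]; split => s; rewrite /continuous_at.
- under eq_fun do rewrite cReM; rewrite cReM.
  by apply: cvgB; apply: cvgM; [exact: g1|exact: h1|exact: g2|exact: h2].
- under eq_fun do rewrite cImM; rewrite cImM.
  by apply: cvgD; apply: cvgM; [exact: g1|exact: h2|exact: g2|exact: h1].
Qed.

Lemma ccontN g : ccont g -> ccont (fun s => - g s).
Proof.
move=> cg; rewrite (_ : (fun s => - g s) = (fun s => (-1) * g s)).
  exact/ccontM/cg/ccont_cst.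
by apply/funext => s; rewrite mulN1r.
Qed.

Lemma ccontB g h : ccont g -> ccont h -> ccont (fun s => g s - h s).
Proof. by move=> cg ch; apply: ccontD => //; exact: ccontN. Qed.

Lemma ccontV g : (forall s, g s != 0) -> ccont g -> ccont (fun s => (g s)^-1).
Proof.
move=> g0 [g1 g2].
have c2 s : (fun s => (Re (g s) ^+ 2 + Im (g s) ^+ 2 : R)^-1) x @[x --> s] -->
    (Re (g s) ^+ 2 + Im (g s) ^+ 2)^-1.
  apply: cvgV; first by rewrite gt_eqF// sqr_ReIm_gt0.
  by rewrite !expr2; apply: cvgD; under eq_fun do rewrite expr2;
    apply: cvgM; [exact: g1|exact: g1|exact: g2|exact: g2].
split => s; rewrite /continuous_at.
- under eq_fun do rewrite cReV; rewrite cReV.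
  by apply: cvgM; [exact: g1|exact: c2].
- under eq_fun do rewrite cImV; rewrite cImV.
  by apply: cvgN; apply: cvgM; [exact: g2|exact: c2].
Qed.

Lemma ccontX g n : ccont g -> ccont (fun s => g s ^+ n).
Proof.
move=> cg; elim: n => [|n IH].
  by under eq_fun do rewrite expr0; exact: ccont_cst.
by under eq_fun do rewrite exprS; exact: ccontM.
Qed.

Lemma ccont_sum I (r : seq I) (F : I -> R -> R[i]) :
  (forall i, ccont (F i)) -> ccont (fun s => \sum_(i <- r) F i s).
Proof.
move=> cF; elim: r => [|i r IH].
  by under eq_fun do rewrite big_nil; exact: ccont_cst.
by under eq_fun do rewrite big_cons; exact: ccontD.
Qed.

Lemma ccont_horiz (y : R) : ccont (fun s => (s +i* y)%C).
Proof. by split => s; [exact: cvg_id|exact: cvg_cst]. Qed.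

Lemma ccont_vert (x : R) : ccont (fun s => (x +i* s)%C).
Proof. by split => s; [exact: cvg_cst|exact: cvg_id]. Qed.

Lemma cder_cst c : cder (fun=> c) (fun=> 0).
Proof. by split; exact: is_derive_cst. Qed.

Lemma cder_horiz (y : R) : cder (fun s => (s +i* y)%C) (fun=> 1).
Proof. by split => /=; [exact: is_derive_id|exact: is_derive_cst]. Qed.

Lemma cder_vert (x : R) : cder (fun s => (x +i* s)%C) (fun=> 'i%C).
Proof. by split => /=; [exact: is_derive_cst|exact: is_derive_id]. Qed.

Lemma cderD g h dg dh : cder g dg -> cder h dh ->
  cder (fun s => g s + h s) (fun s => dg s + dh s).
Proof.
move=> Hg Hh s; have [g1 g2] := Hg s; have [h1 h2] := Hh s; split.
- by under eq_fun do rewrite cReD; rewrite cReD; exact: is_deriveD.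
- by under eq_fun do rewrite cImD; rewrite cImD; exact: is_deriveD.
Qed.

Lemma cderM g h dg dh : cder g dg -> cder h dh ->
  cder (fun s => g s * h s) (fun s => dg s * h s + g s * dh s).
Proof.
move=> Hg Hh s; have [g1 g2] := Hg s; have [h1 h2] := Hh s; split.
- under eq_fun do rewrite cReM.
  apply: (is_derive_eq (is_deriveB (is_deriveM g1 h1) (is_deriveM g2 h2))).
  by rewrite !ReImE /GRing.scale/=; ring.
- under eq_fun do rewrite cImM.
  apply: (is_derive_eq (is_deriveD (is_deriveM g1 h2) (is_deriveM g2 h1))).
  by rewrite !ReImE /GRing.scale/=; ring.
Qed.

Lemma cderX g dg n : cder g dg ->
  cder (fun s => g s ^+ n.+1) (fun s => n.+1%:R * g s ^+ n * dg s).
Proof.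
move=> Hg; elim: n => [|n IH].
  have -> : (fun s => g s ^+ 1) = g by apply/funext => s; rewrite expr1.
  by under eq_fun do rewrite expr0 mulr1 mul1r.
have := cderM Hg IH; under eq_fun do rewrite -exprS.
congr cder; apply/funext => s; rewrite exprS -[n.+2%:R]natr1.
by ring.
Qed.

Lemma cderV g dg : (forall s, g s != 0) -> cder g dg ->
  cder (fun s => (g s)^-1) (fun s => - dg s / g s ^+ 2).
Proof.
move=> g0 Hg s; have [g1 g2] := Hg s; have N0 := sqr_ReIm_gt0 (g0 s).
have HN := is_deriveD (is_deriveX 2 g1) (is_deriveX 2 g2).
have HV := is_deriveV _ HN; rewrite /= gt_eqF// in HV; have {}HV := HV isT.
have NE : ((fun s => Re (g s)) ^+ 2 + (fun s => Im (g s)) ^+ 2) s =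
  Re (g s) ^+ 2 + Im (g s) ^+ 2 by [].
have N1 : Re (g s) ^+ 2 + Im (g s) ^+ 2 != 0 by rewrite gt_eqF.
(* The squared modulus of [g s ^+ 2] in the shape that [ReImE] produces for the denominator of the
   target derivative. *)
have N2 : (Re (g s) * Re (g s) - Im (g s) * Im (g s)) ^+ 2 +
  (Re (g s) * Im (g s) + Im (g s) * Re (g s)) ^+ 2 != 0.
  rewrite (_ : _ + _ = (Re (g s) ^+ 2 + Im (g s) ^+ 2) ^+ 2); last by ring.
  by rewrite expf_neq0.
rewrite NE in HV; split.
- under eq_fun do rewrite cReV.
  apply: (is_derive_eq (is_deriveM g1 HV)).
  rewrite NE [g s ^+ 2]expr2 !ReImE /GRing.scale/=; move: N1 N2.
  move: (Re (g s)) (Im (g s)) (Re (dg s)) (Im (dg s)) => a b c d N1 N2.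
  by field; rewrite -!expr2 N1 N2.
- under eq_fun do rewrite cImV.
  apply: (is_derive_eq (is_deriveN (is_deriveM g2 HV))).
  rewrite NE [g s ^+ 2]expr2 !ReImE /GRing.scale/=; move: N1 N2.
  move: (Re (g s)) (Im (g s)) (Re (dg s)) (Im (dg s)) => a b c d N1 N2.
  by field; rewrite -!expr2 N1 N2.
Qed.

Definition cint (a b : R) g : R[i] :=
  ((\int[mu]_(s in `[a, b]) Re (g s)) +i* (\int[mu]_(s in `[a, b]) Im (g s)))%C.

Lemma continuous_segment_integrable (a b : R) (f : R -> R) : continuous f ->
  mu.-integrable `[a, b] (EFin \o f).
Proof.
move=> cf; apply: continuous_compact_integrable; first exact: segment_compact.
exact: continuous_subspaceT.
Qed.

Lemma eq_cint a b g h : (forall s, a <= s <= b -> g s = h s) ->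
  cint a b g = cint a b h.
Proof.
move=> gh; congr (_ +i* _)%C; apply: eq_Rintegral => s; rewrite inE/= in_itv/= => sab;
  by rewrite gh.
Qed.

Lemma cintD a b g h : ccont g -> ccont h ->
  cint a b (fun s => g s + h s) = cint a b g + cint a b h.
Proof.
move=> [g1 g2] [h1 h2]; rewrite /cint.
under eq_Rintegral do rewrite cReD.
under [X in (_ +i* X)%C]eq_Rintegral do rewrite cImD.
by rewrite !RintegralD//; exact: continuous_segment_integrable.
Qed.

Lemma cintZ a b c g : ccont g -> cint a b (fun s => c * g s) = c * cint a b g.
Proof.
move=> [g1 g2]; case: c => p q; rewrite /cint.
have I1 := @continuous_segment_integrable a b _ g1.
have I2 := @continuous_segment_integrable a b _ g2.
have cZ k (f : R -> R) : continuous f -> continuous (fun s => k * f s).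
  by move=> cf s; apply: cvgM; [exact: cvg_cst|exact: cf].
under eq_Rintegral do rewrite cReM/=.
under [X in (_ +i* X)%C]eq_Rintegral do rewrite cImM/=.
rewrite RintegralB ?RintegralD//; try exact/continuous_segment_integrable/cZ.
by rewrite !RintegralZl.
Qed.

Lemma cint_itvD a b c g : a <= b -> b <= c -> ccont g ->
  cint a c g = cint a b g + cint b c g.
Proof.
move=> ab bc [g1 g2].
suff H (f : R -> R) : continuous f -> \int[mu]_(s in `[a, c]) f s =
    \int[mu]_(s in `[a, b]) f s + \int[mu]_(s in `[b, c]) f s.
  by rewrite /cint (H _ g1) (H _ g2).
move=> cf; have := @Rintegral_itvB _ f (BLeft a) (BRight c) b.
rewrite !bnd_simp => /(_ (@continuous_segment_integrable a c _ cf) ab bc) E.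
rewrite -(@Rintegral_itv_obnd_cbnd _ b (BRight c)) -?E ?subrKC//.
apply: integrableS (@continuous_segment_integrable b c _ cf) => //.
by apply: subset_itvr; rewrite bnd_simp.
Qed.

Lemma normc_cint a b g K : a <= b -> ccont g ->
  (forall s, a <= s <= b -> normc (g s) <= K) ->
  normc (cint a b g) <= 2 * K * (b - a).
Proof.
move=> ab [g1 g2] gK.
suff H (f : R -> R) : continuous f -> (forall s, a <= s <= b -> `|f s| <= K) ->
    `|\int[mu]_(s in `[a, b]) f s| <= K * (b - a).
  rewrite (le_trans (normc_le_ReIm _))//= -mulrA mulr_natl mulr2n lerD// H//.
    by move=> s /gK; apply: le_trans; exact: normr_Re.
  by move=> s /gK; apply: le_trans; exact: normr_Im.
move=> cf fK; have If := @continuous_segment_integrable a b _ cf.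
apply: le_trans (le_normr_Rintegral _ If) _ => //.
have Ic (k : R) : mu.-integrable `[a, b] (EFin \o cst k).
  by apply: continuous_segment_integrable => s; exact: cvg_cst.
have -> : K * (b - a) = \int[mu]_(s in `[a, b]) K.
  rewrite Rintegral_cst//= lebesgue_measure_itv/= lte_fin.
  by move: ab; rewrite le_eqVlt => /predU1P[->|->//]; rewrite ltxx subrr.
apply: le_Rintegral => //.
- by apply: continuous_segment_integrable => s; apply: cvg_norm; exact: cf.
- exact: Ic.
Qed.

Lemma Rintegral_derive (a b : R) (F f : R -> R) : a <= b -> continuous f ->
  (forall s : R, is_derive s 1 F (f s)) ->
  \int[mu]_(s in `[a, b]) f s = F b - F a.
Proof.
move=> ab cf Ff; move: ab; rewrite le_eqVlt => /orP[/eqP->|ab].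
  by rewrite set_itv1 Rintegral_set1 subrr.
rewrite /Rintegral (@continuous_FTC2 _ f F)//.
- exact: continuous_subspaceT.
- have cF : continuous F.
    move=> s; apply: differentiable_continuous; apply/derivable1_diffP.
    exact: (@ex_derive _ _ _ _ _ _ _ (Ff s)).
  split => [s _||].
  + exact: (@ex_derive _ _ _ _ _ _ _ (Ff s)).
  + exact/cvg_at_right_filter/cF.
  + exact/cvg_at_left_filter/cF.
- by move=> s _; rewrite derive1E; exact: (@derive_val _ _ _ _ _ _ _ (Ff s)).
Qed.

Lemma cint_FTC a b g dg : a <= b -> ccont dg -> cder g dg ->
  cint a b dg = g b - g a.
Proof.
move=> ab [c1 c2] Hg; rewrite /cint.
rewrite (Rintegral_derive ab c1 (fun s => (Hg s).1)).
rewrite (Rintegral_derive ab c2 (fun s => (Hg s).2)).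
by case: (g a); case: (g b).
Qed.

End complex_paths.

Section rectangles.
Context {R : realType}.
Implicit Types (f g : R[i] -> R[i]).

Definition horiz f (y : R) := fun s : R => f (s +i* y)%C.
Definition vert f (x : R) := fun s : R => f (x +i* s)%C.

(** The counterclockwise boundary integral: bottom, right, top and left sides, with [dz = 'i ds] on
    the vertical ones. *)
Definition rect f x0 x1 y0 y1 : R[i] :=
  cint x0 x1 (horiz f y0) + 'i%C * cint y0 y1 (vert f x1)
  - cint x0 x1 (horiz f y1) - 'i%C * cint y0 y1 (vert f x0).

(** Only the four lines carrying the sides are concerned, which admits kernels such as [(w - z)^-1]
    that are singular inside the rectangle. *)
Definition edge_cont f x0 x1 y0 y1 :=
  [/\ ccont (horiz f y0), ccont (vert f x1), ccont (horiz f y1) & ccont (vert f x0)].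

Definition line_cont f :=
  (forall y, ccont (horiz f y)) /\ (forall x, ccont (vert f x)).

Lemma line_edge_cont f x0 x1 y0 y1 : line_cont f -> edge_cont f x0 x1 y0 y1.
Proof. by case=> ? ?; split. Qed.

Lemma rectDx f x0 xm x1 y0 y1 : line_cont f -> x0 <= xm -> xm <= x1 ->
  rect f x0 x1 y0 y1 = rect f x0 xm y0 y1 + rect f xm x1 y0 y1.
Proof.
move=> [hf vf] a b; rewrite /rect (cint_itvD a b (hf y0)) (cint_itvD a b (hf y1)).
by ring.
Qed.

Lemma rectDy f x0 x1 y0 ym y1 : line_cont f -> y0 <= ym -> ym <= y1 ->
  rect f x0 x1 y0 y1 = rect f x0 x1 y0 ym + rect f x0 x1 ym y1.
Proof.
move=> [hf vf] a b; rewrite /rect (cint_itvD a b (vf x0)) (cint_itvD a b (vf x1)).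
by ring.
Qed.

Lemma rectD f g x0 x1 y0 y1 : edge_cont f x0 x1 y0 y1 -> edge_cont g x0 x1 y0 y1 ->
  rect (fun z => f z + g z) x0 x1 y0 y1 = rect f x0 x1 y0 y1 + rect g x0 x1 y0 y1.
Proof.
case=> f1 f2 f3 f4 [g1 g2 g3 g4]; rewrite /rect.
have h y : ccont (horiz f y) -> ccont (horiz g y) ->
    cint x0 x1 (horiz (fun z => f z + g z) y) =
    cint x0 x1 (horiz f y) + cint x0 x1 (horiz g y) by exact: cintD.
have v x : ccont (vert f x) -> ccont (vert g x) ->
    cint y0 y1 (vert (fun z => f z + g z) x) =
    cint y0 y1 (vert f x) + cint y0 y1 (vert g x) by exact: cintD.
by rewrite !h// !v//; ring.
Qed.

Lemma rectZ c f x0 x1 y0 y1 : edge_cont f x0 x1 y0 y1 ->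
  rect (fun z => c * f z) x0 x1 y0 y1 = c * rect f x0 x1 y0 y1.
Proof.
case=> f1 f2 f3 f4; rewrite /rect.
have h y : ccont (horiz f y) ->
    cint x0 x1 (horiz (fun z => c * f z) y) = c * cint x0 x1 (horiz f y).
  exact: cintZ.
have v x : ccont (vert f x) ->
    cint y0 y1 (vert (fun z => c * f z) x) = c * cint y0 y1 (vert f x).
  exact: cintZ.
by rewrite !h// !v//; ring.
Qed.

Lemma edge_contM f g x0 x1 y0 y1 : edge_cont f x0 x1 y0 y1 -> edge_cont g x0 x1 y0 y1 ->
  edge_cont (fun z => f z * g z) x0 x1 y0 y1.
Proof. by case=> f1 f2 f3 f4 [g1 g2 g3 g4]; split; apply: ccontM. Qed.

Lemma edge_cont_cst c x0 x1 y0 y1 : edge_cont (fun=> c) x0 x1 y0 y1.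
Proof. by split; exact: ccont_cst. Qed.

Lemma rect_sum I (r : seq I) (F : I -> R[i] -> R[i]) x0 x1 y0 y1 :
  (forall i, edge_cont (F i) x0 x1 y0 y1) ->
  rect (fun z => \sum_(i <- r) F i z) x0 x1 y0 y1 =
  \sum_(i <- r) rect (F i) x0 x1 y0 y1.
Proof.
move=> cF; elim: r => [|i r IH].
  rewrite big_nil; under eq_fun do rewrite big_nil.
  rewrite -[RHS](mul0r (rect (fun=> 0) x0 x1 y0 y1)) -rectZ; last exact: edge_cont_cst.
  by under [in RHS]eq_fun do rewrite mul0r.
rewrite big_cons -IH -rectD//; first by under eq_fun do rewrite big_cons.
split; apply: ccont_sum => j; by case: (cF j).
Qed.

Lemma eq_rect f g x0 x1 y0 y1 :
  (forall s, x0 <= s <= x1 -> horiz f y0 s = horiz g y0 s) ->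
  (forall s, y0 <= s <= y1 -> vert f x1 s = vert g x1 s) ->
  (forall s, x0 <= s <= x1 -> horiz f y1 s = horiz g y1 s) ->
  (forall s, y0 <= s <= y1 -> vert f x0 s = vert g x0 s) ->
  rect f x0 x1 y0 y1 = rect g x0 x1 y0 y1.
Proof.
move=> h0 v1 h1 v0; rewrite /rect (eq_cint h0) (eq_cint h1).
by rewrite (eq_cint v0) (eq_cint v1).
Qed.

Lemma normc_rect f x0 x1 y0 y1 K : x0 <= x1 -> y0 <= y1 -> edge_cont f x0 x1 y0 y1 ->
  (forall s, x0 <= s <= x1 -> normc (horiz f y0 s) <= K) ->
  (forall s, y0 <= s <= y1 -> normc (vert f x1 s) <= K) ->
  (forall s, x0 <= s <= x1 -> normc (horiz f y1 s) <= K) ->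
  (forall s, y0 <= s <= y1 -> normc (vert f x0 s) <= K) ->
  normc (rect f x0 x1 y0 y1) <= 4 * K * ((x1 - x0) + (y1 - y0)).
Proof.
move=> x01 y01 [c1 c2 c3 c4] k1 k2 k3 k4.
rewrite /rect (le_trans (le_normcB _ _))//.
rewrite (le_trans (lerD (le_normcB _ _) (lexx _)))//.
rewrite (le_trans (lerD (lerD (le_normcD _ _) (lexx _)) (lexx _)))//.
rewrite !normcM !normci !mul1r.
have := normc_cint x01 c1 k1; have := normc_cint y01 c2 k2.
have := normc_cint x01 c3 k3; have := normc_cint y01 c4 k4.
by lra.
Qed.

Lemma cder_eq (g dg dg' : R -> R[i]) : cder g dg -> (forall s, dg s = dg' s) -> cder g dg'.
Proof. by move=> Hg E; rewrite (_ : dg' = dg)//; apply/funext => s; rewrite E. Qed.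

(** The four increments of [F] telescope around the corners. [F] has to be a primitive along the
    four lines only, so it may be singular inside. *)
Lemma rect_primitive f (F : R[i] -> R[i]) x0 x1 y0 y1 : x0 <= x1 -> y0 <= y1 ->
  edge_cont f x0 x1 y0 y1 ->
  cder (horiz F y0) (horiz f y0) -> cder (horiz F y1) (horiz f y1) ->
  cder (vert F x0) (fun s => 'i%C * vert f x0 s) ->
  cder (vert F x1) (fun s => 'i%C * vert f x1 s) ->
  rect f x0 x1 y0 y1 = 0.
Proof.
move=> x01 y01 [c1 c2 c3 c4] h0 h1 v0 v1; rewrite /rect.
rewrite (cint_FTC x01 c1 h0) (cint_FTC x01 c3 h1) -!cintZ//.
rewrite (cint_FTC y01 (ccontM (ccont_cst _) c2) v1).
rewrite (cint_FTC y01 (ccontM (ccont_cst _) c4) v0).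
by rewrite /horiz /vert; ring.
Qed.

Lemma rect_affine (a b : R[i]) x0 x1 y0 y1 : x0 <= x1 -> y0 <= y1 ->
  rect (fun z => a + b * z) x0 x1 y0 y1 = 0.
Proof.
move=> x01 y01; apply: (@rect_primitive _ (fun z => a * z + b / 2 * z ^+ 2)) => //.
- by split; apply: ccontD; do ?apply: ccontM; do ?exact: ccont_cst;
    [exact: ccont_horiz|exact: ccont_vert|exact: ccont_horiz|exact: ccont_vert].
- apply: (cder_eq (cderD (cderM (cder_cst a) (cder_horiz y0))
    (cderM (cder_cst (b / 2)) (cderX 1 (cder_horiz y0))))) => s.
  by rewrite /horiz; field.
- apply: (cder_eq (cderD (cderM (cder_cst a) (cder_horiz y1))
    (cderM (cder_cst (b / 2)) (cderX 1 (cder_horiz y1))))) => s.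
  by rewrite /horiz; field.
- apply: (cder_eq (cderD (cderM (cder_cst a) (cder_vert x0))
    (cderM (cder_cst (b / 2)) (cderX 1 (cder_vert x0))))) => s.
  by rewrite /vert; field.
- apply: (cder_eq (cderD (cderM (cder_cst a) (cder_vert x1))
    (cderM (cder_cst (b / 2)) (cderX 1 (cder_vert x1))))) => s.
  by rewrite /vert; field.
Qed.

End rectangles.

Section goursat.
Context {R : realType}.
Implicit Types (f g : R[i] -> R[i]).

Lemma nested_intervals (a b : nat -> R) :
  (forall n, a n <= a n.+1) -> (forall n, b n.+1 <= b n) -> (forall n, a n <= b n) ->
  exists c, forall n, a n <= c <= b n.
Proof.
move=> ha hb hab.
have nda m n : (m <= n)%N -> a m <= a n.
  by move=> /subnK <-; elim: (n - m)%N => //= k IH; exact: le_trans IH (ha _).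
have ndb m n : (m <= n)%N -> b n <= b m.
  by move=> /subnK <-; elim: (n - m)%N => //= k IH; exact: le_trans (hb _) IH.
have ub n : ubound (range a) (b n).
  move=> _ [m _ <-]; rewrite (le_trans (nda m (maxn m n) (leq_maxl _ _)))//.
  by rewrite (le_trans (hab _))// ndb// leq_maxr.
exists (sup (range a)) => n; apply/andP; split.
- by apply: ub_le_sup; [exists (b 0%N); exact: ub|exists n].
- by apply: ge_sup; [exists (a 0%N); exists 0%N|exact: ub].
Qed.

(** Compactness by bisection: a bad rectangle has a bad quarter, and the nested bad quarters shrink
    to a point at which the local hypothesis is contradicted. *)
Lemma rect_subdivision (good : R -> R -> R -> R -> Prop) :
  (forall x0 xm x1 y0 ym y1, x0 <= xm -> xm <= x1 -> y0 <= ym -> ym <= y1 ->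
    xm - x0 = x1 - xm -> ym - y0 = y1 - ym ->
    good x0 xm y0 ym -> good xm x1 y0 ym -> good x0 xm ym y1 -> good xm x1 ym y1 ->
    good x0 x1 y0 y1) ->
  forall x0 x1 y0 y1, x0 <= x1 -> y0 <= y1 ->
  (forall x y, x0 <= x <= x1 -> y0 <= y <= y1 -> exists2 e, 0 < e &
    forall a b c d, a <= x <= b -> c <= y <= d ->
      (b - a) + (d - c) < e -> good a b c d) ->
  good x0 x1 y0 y1.
Proof.
move=> quad x0 x1 y0 y1 x01 y01 loc; apply: contrapT => bad0.
pose mid (s t : R) := (s + t) / 2.
pose lo := fun q : R * R => (q.1, mid q.1 q.2).
pose hi := fun q : R * R => (mid q.1 q.2, q.2).
pose bad (q : (R * R) * (R * R)) := `[< ~ good q.1.1 q.1.2 q.2.1 q.2.2 >].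
pose step (q : (R * R) * (R * R)) :=
  if bad (lo q.1, lo q.2) then (lo q.1, lo q.2) else
  if bad (hi q.1, lo q.2) then (hi q.1, lo q.2) else
  if bad (lo q.1, hi q.2) then (lo q.1, hi q.2) else (hi q.1, hi q.2).
pose q n := iter n step ((x0, x1), (y0, y1)).
have qS n : q n.+1 = step (q n) by [].
have step1 p : ((step p).1 = lo p.1) \/ ((step p).1 = hi p.1).
  by rewrite /step; do ![case: ifP => _; [by auto|]]; right.
have step2 p : ((step p).2 = lo p.2) \/ ((step p).2 = hi p.2).
  by rewrite /step; do ![case: ifP => _; [by auto|]]; right.
have qle n : (q n).1.1 <= (q n).1.2 /\ (q n).2.1 <= (q n).2.2.
  elim: n => [//|n [IH1 IH2]]; rewrite qS.
  by case: (step1 (q n)) => ->; case: (step2 (q n)) => ->; rewrite /lo/hi/mid/=; lra.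
have qbad n : ~ good (q n).1.1 (q n).1.2 (q n).2.1 (q n).2.2.
  elim: n => [//|n IH]; rewrite qS /step.
  have [h1 h2] := qle n.
  case: ifP => [/asboolP//|/asboolP/contrapT b1].
  case: ifP => [/asboolP//|/asboolP/contrapT b2].
  case: ifP => [/asboolP//|/asboolP/contrapT b3] b4.
  apply: IH; apply: (quad _ _ _ _ _ _ _ _ _ _ _ _ b1 b2 b3 b4);
    rewrite /lo /hi /mid/=; lra.
have size1 n : (q n).1.2 - (q n).1.1 = (x1 - x0) / 2 ^+ n.
  elim: n => [|n IH]; first by rewrite expr0 divr1.
  rewrite qS exprSr invfM mulrA -IH.
  by case: (step1 (q n)) => ->; rewrite /lo/hi/mid/=; field.
have size2 n : (q n).2.2 - (q n).2.1 = (y1 - y0) / 2 ^+ n.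
  elim: n => [|n IH]; first by rewrite expr0 divr1.
  rewrite qS exprSr invfM mulrA -IH.
  by case: (step2 (q n)) => ->; rewrite /lo/hi/mid/=; field.
have [x xq] : exists x, forall n, (q n).1.1 <= x <= (q n).1.2.
  apply: nested_intervals => n; rewrite ?qS; try by have [] := qle n.
    by have [h1 h2] := qle n; case: (step1 (q n)) => ->; rewrite /lo/hi/mid/=; lra.
  by have [h1 h2] := qle n; case: (step1 (q n)) => ->; rewrite /lo/hi/mid/=; lra.
have [y yq] : exists y, forall n, (q n).2.1 <= y <= (q n).2.2.
  apply: nested_intervals => n; rewrite ?qS; try by have [] := qle n.
    by have [h1 h2] := qle n; case: (step2 (q n)) => ->; rewrite /lo/hi/mid/=; lra.
  by have [h1 h2] := qle n; case: (step2 (q n)) => ->; rewrite /lo/hi/mid/=; lra.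
have [e e0 he] := loc x y (xq 0%N) (yq 0%N).
pose S := (x1 - x0) + (y1 - y0).
have S0 : 0 <= S by rewrite addr_ge0// subr_ge0.
have [n Sn] : exists n, S / 2 ^+ n < e.
  exists (Num.truncn (S / e)).+1; rewrite ltr_pdivrMr ?exprn_gt0// mulrC -ltr_pdivrMr//.
  have := truncnS_gt (S / e); move/lt_le_trans; apply.
  by rewrite -natrX ler_nat ltnW// ltn_expl.
by apply: (qbad n); apply: (he _ _ _ _ (xq n) (yq n)); rewrite size1 size2 -mulrDl.
Qed.

Definition cderiv f (z D : R[i]) := forall e : R, 0 < e -> exists2 d : R, 0 < d &
  forall w, normc (w - z) < d -> normc (f w - f z - D * (w - z)) <= e * normc (w - z).

(** The bound [e * S ^+ 2], with [S] the half-perimeter, passes from the quarters to the whole,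
    since [S] halves and there are four of them. Near a point of differentiability it holds because
    the affine part of [f] integrates to 0, leaving an error of order [e * S] on sides of total
    length of order [S]. *)
Theorem goursat f x0 x1 y0 y1 : x0 <= x1 -> y0 <= y1 -> line_cont f ->
  (forall x y, x0 <= x <= x1 -> y0 <= y <= y1 -> exists D, cderiv f (x +i* y)%C D) ->
  rect f x0 x1 y0 y1 = 0.
Proof.
move=> x01 y01 cf df.
suff H e : 0 < e -> normc (rect f x0 x1 y0 y1) <= e * ((x1 - x0) + (y1 - y0)) ^+ 2.
  apply: eq0_normc; apply/eqP; rewrite eq_le normc_ge0 andbT.
  apply/ler_addgt0Pl => e e0; rewrite addr0.
  set S := x1 - x0 + (y1 - y0) in H.
  have S1 : 0 < S ^+ 2 + 1 by rewrite ltr_wpDl// sqr_ge0.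
  (* The added 1 keeps the denominator positive when the rectangle degenerates to a point. *)
  have := H (e / (S ^+ 2 + 1)) (divr_gt0 e0 S1); move/le_trans; apply.
  by rewrite -mulrA ler_piMr ?(ltW e0)// mulrC ler_pdivrMr// mul1r lerDl.
move=> e0; apply: (@rect_subdivision (fun x0 x1 y0 y1 =>
  normc (rect f x0 x1 y0 y1) <= e * ((x1 - x0) + (y1 - y0)) ^+ 2)) => //.
  move=> {df x01 y01}x0 xm {}x1 {}y0 ym {}y1 xm0 xm1 ym0 ym1 Ex Ey b1 b2 b3 b4.
  rewrite (rectDx _ _ cf xm0 xm1) (rectDy x0 _ cf ym0 ym1).
  rewrite (rectDy xm _ cf ym0 ym1).
  rewrite (le_trans (le_normcD _ _))//.
  rewrite (le_trans (lerD (le_normcD _ _) (le_normcD _ _)))//.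
  apply: le_trans (lerD (lerD b1 b3) (lerD b2 b4)) _.
  have -> : x1 = 2 * xm - x0 by lra.
  have -> : y1 = 2 * ym - y0 by lra.
  by rewrite le_eqVlt; apply/orP; left; apply/eqP; ring.
(* The quarter cancels the factor 4 of [normc_rect]. *)
move=> x y xx yy; have [D /(_ (e / 4))[|d d0 hd]] := df x y xx yy.
  by rewrite divr_gt0.
exists d => // a b c k xab yck sd.
set z := (x +i* y)%C in hd; set S := (b - a) + (k - c) in sd *.
have [ab ck] : a <= b /\ c <= k by lra.
pose err w := f w - f z - D * (w - z).
have aff_cont : line_cont (fun w => (f z - D * z) + D * w).
  split => t; apply: ccontD (ccont_cst _) (ccontM (ccont_cst _) _).
    exact: ccont_horiz.
  exact: ccont_vert.
have cerr : line_cont err.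
  have -> : err = (fun w => f w - ((f z - D * z) + D * w)).
    by apply/funext => w; rewrite /err; ring.
  by split => t; apply: ccontB; [exact: cf.1|exact: aff_cont.1|exact: cf.2|exact: aff_cont.2].
have -> : rect f a b c k = rect err a b c k.
  have -> : f = (fun w => err w + ((f z - D * z) + D * w)).
    by apply/funext => w; rewrite /err; ring.
  rewrite rectD; try exact: line_edge_cont.
  by rewrite rect_affine// addr0.
have small s t : a <= s <= b -> c <= t <= k -> normc (err (s +i* t)%C) <= e / 4 * S.
  move=> sab tck; have wz : normc ((s +i* t)%C - z) <= S.
    rewrite (le_trans (normc_le_ReIm _))//= /S.
    by apply: lerD; rewrite ler_norml; lra.
  rewrite (le_trans (hd _ (le_lt_trans wz sd)))//.
  by rewrite ler_wpM2l// divr_ge0// ltW.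
rewrite (le_trans (@normc_rect _ _ _ _ _ _ (e / 4 * S) ab ck (line_edge_cont _ _ _ _ cerr) _ _ _ _))//;
  try by move=> s hs; apply: small => //; lra.
by rewrite le_eqVlt; apply/orP; left; apply/eqP; rewrite /S; field.
Qed.

(* The exceptional point is confined to a square of side [2 t], whose boundary
   integral is [O(t)]. *)
Theorem goursat_except f z0 x0 x1 y0 y1 :
  x0 < Re z0 < x1 -> y0 < Im z0 < y1 -> line_cont f ->
  (forall z, z != z0 -> exists D, cderiv f z D) ->
  (exists2 d : R, 0 < d & exists K : R, forall z, normc (z - z0) < d -> normc (f z) <= K) ->
  rect f x0 x1 y0 y1 = 0.
Proof.
case: z0 => p q /= hp hq cf df [d d0 [K hK]].
apply: eq0_normc; apply/eqP; rewrite eq_le normc_ge0 andbT.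
apply/ler_addgt0Pl => e e0; rewrite addr0.
have K0 : 0 <= K.
  by rewrite (le_trans (normc_ge0 (f (p +i* q)%C)))// hK// subrr normc0.
pose m := Num.min (Num.min (p - x0) (x1 - p)) (Num.min (q - y0) (y1 - q)).
have m0 : 0 < m by rewrite /m !lt_min; lra.
(* [m] keeps the small square inside the rectangle, [d / 4] keeps it where [f] is bounded by [K],
   and the last entry makes [16 * K * t], the bound of its boundary integral, at most [e]. *)
pose t := Num.min m (Num.min (d / 4) (e / (16 * K + 16))).
have K1 : 0 < 16 * K + 16 by lra.
have t0 : 0 < t by rewrite /t lt_min m0/= lt_min !divr_gt0.
have tm : t <= m by rewrite /t ge_min lexx.
have td : t <= d / 4 by rewrite /t !ge_min lexx !orbT.
have te : t <= e / (16 * K + 16) by rewrite /t !ge_min lexx !orbT.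
have [[mx0 mx1] [my0 my1]] : ((m <= p - x0) /\ (m <= x1 - p)) /\ ((m <= q - y0) /\ (m <= y1 - q)).
  by rewrite /m !ge_min !lexx !orbT.
clearbody t m.
have G a b c k : a <= b -> c <= k -> ~~ ((a <= p <= b) && (c <= q <= k)) ->
    rect f a b c k = 0.
  move=> ab ck hpq; apply: goursat => // x y hx hy; apply: df.
  by apply: contraNN hpq => /eqP[<- <-]; rewrite hx hy.
have [] : [/\ x0 <= p - t, p - t <= p + t, p + t <= x1 & p - t <= x1] by split; lra.
move=> hx1 hx2 hx3 hx4.
have [] : [/\ y0 <= q - t, q - t <= q + t, q + t <= y1 & q - t <= y1] by split; lra.
move=> hy1 hy2 hy3 hy4; have xy01 : y0 <= y1 by lra.
rewrite (rectDx _ _ cf hx1 hx4) (rectDx _ _ cf hx2 hx3).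
rewrite (G x0 (p - t) y0 y1 hx1) ?(G (p + t) x1 y0 y1 hx3)//; try lra.
rewrite add0r addr0 (rectDy _ _ cf hy1 hy4) (rectDy _ _ cf hy2 hy3).
rewrite (G _ _ y0 (q - t) hx2 hy1) ?(G _ _ (q + t) y1 hx2 hy3)//; try lra.
rewrite add0r addr0.
have small a b : p - t <= a <= p + t -> q - t <= b <= q + t -> normc (f (a +i* b)%C) <= K.
  move=> ha hb; apply: hK; rewrite (le_lt_trans (normc_le_ReIm _))//=.
  rewrite (@le_lt_trans _ _ (t + t))//; last lra.
  by apply: lerD; rewrite ler_norml; lra.
apply: (@le_trans _ _ (4 * K * (((p + t) - (p - t)) + ((q + t) - (q - t))))).
  by apply: normc_rect; try lra; try exact: line_edge_cont;
    move=> s hs; apply: small; lra.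
move: te; rewrite ler_pdivlMr// => te.
by apply: le_trans te; nra.
Qed.

End goursat.

Section cderiv_theory.
Context {R : realType}.
Implicit Types (f g : R[i] -> R[i]) (z w : R[i]).

Definition ccont_at f z := forall e : R, 0 < e -> exists2 d : R, 0 < d &
  forall w, normc (w - z) < d -> normc (f w - f z) <= e.

Lemma cderiv_lip f z D : cderiv f z D -> exists2 d : R, 0 < d &
  forall w, normc (w - z) < d -> normc (f w - f z) <= (normc D + 1) * normc (w - z).
Proof.
move=> /(_ 1 ltr01)[d d0 hd]; exists d => // w wz; have := hd w wz.
rewrite mul1r mulrDl mul1r => h.
rewrite -(subrK (D * (w - z)) (f w - f z)) (le_trans (le_normcD _ _))//.
by rewrite normcM addrC lerD2l.
Qed.

Lemma cderiv_ccont f z D : cderiv f z D -> ccont_at f z.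
Proof.
move=> /cderiv_lip[d d0 hd] e e0; have D0 : 0 < normc D + 1.
  by rewrite ltr_wpDl// normc_ge0.
exists (Num.min d (e / (normc D + 1))); first by rewrite lt_min d0 divr_gt0.
move=> w; rewrite lt_min => /andP[w1 w2]; rewrite (le_trans (hd w w1))//.
by rewrite mulrC -ler_pdivlMr// ltW.
Qed.

Lemma line_contP f : (forall z, ccont_at f z) -> line_cont f.
Proof.
move=> cf; suff H (u v : R[i]) : normc u <= 1 -> ccont (fun s : R => f (v + (s%:C)%C * u)).
  split => t.
  - have -> : horiz f t = (fun s : R => f ((0 +i* t)%C + (s%:C)%C * 1)).
      apply/funext => s; rewrite /horiz; congr f; apply/eqP.
      by rewrite eq_complex /=; apply/andP; split; apply/eqP; ring.
    by apply: H; rewrite normc1.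
  - have -> : vert f t = (fun s : R => f ((t +i* 0)%C + (s%:C)%C * 'i%C)).
      apply/funext => s; rewrite /vert; congr f; apply/eqP.
      by rewrite eq_complex /=; apply/andP; split; apply/eqP; ring.
    by apply: H; rewrite normci.
move=> u1; have K (s e : R) : 0 < e -> exists2 d : R, 0 < d & forall t, `|s - t| < d ->
    normc (f (v + (s%:C)%C * u) - f (v + (t%:C)%C * u)) < e.
  move=> e0; have [//|d d0 hd] := cf (v + (s%:C)%C * u) (e / 2).
    by rewrite divr_gt0.
  exists d => // t st; rewrite normc_distC (@le_lt_trans _ _ (e / 2))//; last first.
    by rewrite ltr_pdivrMr// ltr_pMr// ltr1n.
  apply: hd; rewrite (_ : _ - _ = ((t - s)%:C)%C * u); last first.
    by rewrite rmorphB; ring.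
  rewrite normcM normc_real distrC (le_lt_trans _ st)//.
  by rewrite ler_piMr.
split => s; apply/cvgrPdist_lt => e e0; have [d d0 hd] := K s e e0;
  near=> t; (have st : `|s - t| < d by near: t; exact: cvgr_dist_lt);
  rewrite (le_lt_trans _ (hd t st))//.
- by rewrite -cReN -cReD normr_Re.
- by rewrite -cImN -cImD normr_Im.
Unshelve. all: by end_near. Qed.

Lemma cderiv_local f g z D : cderiv f z D ->
  (exists2 d : R, 0 < d & forall w, normc (w - z) < d -> f w = g w) -> cderiv g z D.
Proof.
move=> Df [d d0 fg] e e0; have [d' d'0 hd'] := Df e e0.
exists (Num.min d d'); first by rewrite lt_min d0.
move=> w; rewrite lt_min => /andP[w1 w2]; rewrite -!fg ?hd'// subrr normc0//.
Qed.

Lemma cderivD f g z D E : cderiv f z D -> cderiv g z E ->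
  cderiv (fun w => f w + g w) z (D + E).
Proof.
move=> Df Dg e e0; have e2 : 0 < e / 2 by rewrite divr_gt0.
have [d1 d10 h1] := Df _ e2; have [d2 d20 h2] := Dg _ e2.
exists (Num.min d1 d2); first by rewrite lt_min d10.
move=> w; rewrite lt_min => /andP[w1 w2].
rewrite (_ : _ - _ - _ = (f w - f z - D * (w - z)) + (g w - g z - E * (w - z))); last by ring.
rewrite (le_trans (le_normcD _ _))//.
by have := lerD (h1 w w1) (h2 w w2); rewrite -mulrDl -splitr.
Qed.

Lemma cderiv_cst c z : cderiv (fun=> c) z 0.
Proof.
move=> e e0; exists 1 => // w _; rewrite subrr mul0r subrr normc0.
by rewrite mulr_ge0 ?normc_ge0// ltW.
Qed.

Lemma cderivM f g z D E : cderiv f z D -> cderiv g z E ->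
  cderiv (fun w => f w * g w) z (D * g z + f z * E).
Proof.
move=> Df Dg e e0; have e3 : 0 < e / 3 by rewrite divr_gt0.
have ng : 0 < normc (g z) + 1 by rewrite ltr_wpDl// normc_ge0.
have nf : 0 < normc (f z) + 1 by rewrite ltr_wpDl// normc_ge0.
have nD : 0 < normc D + 1 by rewrite ltr_wpDl// normc_ge0.
have nE : 0 < normc E + 1 by rewrite ltr_wpDl// normc_ge0.
have [d1 d10 h1] := Df _ (divr_gt0 e3 ng); have [d2 d20 h2] := Dg _ (divr_gt0 e3 nf).
have [d3 d30 h3] := cderiv_lip Df; have [d4 d40 h4] := cderiv_lip Dg.
(* The product of the two increments is quadratic in [w - z]; this radius makes it at most a third
   of the allowed error. *)
pose d5 := e / 3 / ((normc D + 1) * (normc E + 1)).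
have d50 : 0 < d5 by rewrite divr_gt0// mulr_gt0.
exists (Num.min (Num.min d1 d2) (Num.min (Num.min d3 d4) d5)).
  by rewrite !lt_min d10 d20 d30 d40 d50.
move=> w; rewrite !lt_min => /andP[/andP[w1 w2] /andP[/andP[w3 w4] w5]].
rewrite (_ : _ - _ - _ = (f w - f z - D * (w - z)) * g z +
  f z * (g w - g z - E * (w - z)) + (f w - f z) * (g w - g z)); last by ring.
rewrite (le_trans (le_normcD _ _))// (le_trans (lerD (le_normcD _ _) (lexx _)))//.
rewrite !normcM; set h := normc (w - z) in w1 w2 w3 w4 w5 *.
have h0 : 0 <= h by exact: normc_ge0.
have -> : e * h = e / 3 * h + e / 3 * h + e / 3 * h by field.
apply: lerD; first apply: lerD.
- apply: le_trans (ler_pM (normc_ge0 _) (normc_ge0 _) (h1 w w1) (_ : _ <= normc (g z) + 1)) _.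
    by rewrite lerDl.
  by rewrite -/h mulrAC divfK ?gt_eqF.
- rewrite mulrC; apply: le_trans (ler_pM (normc_ge0 _) (normc_ge0 _) (h2 w w2) (_ : _ <= normc (f z) + 1)) _.
    by rewrite lerDl.
  by rewrite -/h mulrAC divfK ?gt_eqF.
- apply: le_trans (ler_pM (normc_ge0 _) (normc_ge0 _) (h3 w w3) (h4 w w4)) _.
  rewrite -/h mulrACA mulrA.
  by rewrite ler_wpM2r// mulrC -ler_pdivlMr ?mulr_gt0// ltW.
Qed.

Lemma cderiv_inv z0 z : z != z0 -> cderiv (fun w => (w - z0)^-1) z (- ((z - z0) ^+ 2)^-1).
Proof.
rewrite -subr_eq0 => zz0 e e0; set a := z - z0 in zz0 *.
have a0 : 0 < normc a by rewrite normc_gt0.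
(* The first radius gives [|w - z0| >= |a| / 2]; with it, the second bounds the remainder quotient
   [|w - z| / (|w - z0| |a|^2)] by [e]. *)
exists (Num.min (normc a / 2) (e * normc a ^+ 3 / 2)).
  by rewrite lt_min !divr_gt0// mulr_gt0// exprn_gt0.
move=> w; rewrite lt_min => /andP[w1 w2].
have b1 : normc a / 2 <= normc (w - z0).
  have := le_normcD (w - z0) (z - w); rewrite [w - z0 + _]addrC addrA subrK -/a.
  by rewrite (normc_distC z) => h; lra.
have b0 : w - z0 != 0 by rewrite -normc_gt0 (lt_le_trans _ b1)// divr_gt0.
rewrite (_ : _ - _ - _ = (w - z) * ((w - z) * ((w - z0) * a ^+ 2)^-1)); last first.
  by rewrite /a in zz0 *; field; rewrite zz0 b0.
rewrite normcM mulrC ler_wpM2r ?normc_ge0// normcM normcV ler_pdivrMr; last first.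
  by rewrite normc_gt0 mulf_neq0// expf_neq0.
rewrite (le_trans (ltW w2))// -mulrA ler_wpM2l ?(ltW e0)//.
rewrite normcM normcX [normc (w - z0) * _]mulrC exprSr -mulrA ler_wpM2l ?sqr_ge0//.
Qed.

End cderiv_theory.

(** * Taylor expansion of entire functions *)

Section taylor.
Context {R : realType}.
Implicit Types (f g : R[i] -> R[i]) (z w : R[i]) (rho : R).

(** A square contour stands in for the circle: its sides are parametrized by the coordinates, so the
    rectangle theorems apply to it directly. *)
Definition oint rho f := rect f (- rho) rho (- rho) rho.

(* The four lines that carry the sides of the square. *)
Definition sq_edge rho (w : R[i]) :=
  [\/ Im w = - rho, Re w = rho, Im w = rho | Re w = - rho].

Lemma sq_edge_ge rho w : 0 < rho -> sq_edge rho w -> rho <= normc w.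
Proof.
move=> r0 [] E; [rewrite (le_trans _ (normr_Im w))//|rewrite (le_trans _ (normr_Re w))//
  |rewrite (le_trans _ (normr_Im w))//|rewrite (le_trans _ (normr_Re w))//];
  by rewrite E ?normrN gtr0_norm.
Qed.

Definition oint_cont rho f := edge_cont f (- rho) rho (- rho) rho.

Lemma eq_oint rho f g : (forall w, sq_edge rho w -> f w = g w) -> oint rho f = oint rho g.
Proof.
by move=> fg; apply: eq_rect => s _; apply: fg; [apply: Or41|apply: Or42|apply: Or43|apply: Or44].
Qed.

(** [sq_edge] describes unbounded lines; the condition [normc w <= 2 * rho] restricts the hypothesis
    to a bounded part that contains the sides. *)
Lemma normc_oint rho f K : 0 < rho -> oint_cont rho f ->
  (forall w, sq_edge rho w -> normc w <= 2 * rho -> normc (f w) <= K) ->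
  normc (oint rho f) <= 16 * K * rho.
Proof.
move=> r0 cf fK; rewrite (_ : 16 * K * rho = 4 * K * ((rho - - rho) + (rho - - rho))); last by ring.
have b s t : `|s| <= rho -> `|t| <= rho -> normc (s +i* t)%C <= 2 * rho.
  move=> hs ht; rewrite (le_trans (normc_le_ReIm _))//= mulr_natl mulr2n.
  exact: lerD.
have rr : - rho <= rho by lra.
apply: normc_rect => // s; rewrite -ler_norml => hs; apply: fK.
- exact: Or41.
- by apply: b; rewrite // normrN gtr0_norm.
- exact: Or42.
- by apply: b; rewrite // gtr0_norm.
- exact: Or43.
- by apply: b; rewrite // gtr0_norm.
- exact: Or44.
- by apply: b; rewrite // normrN gtr0_norm.
Qed.

Lemma oint_cont_inv rho z : normc z < rho -> oint_cont rho (fun w => (w - z)^-1).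
Proof.
move=> zr; have [z1 z2] : `|Re z| < rho /\ `|Im z| < rho.
  by split; apply: le_lt_trans zr; [exact: normr_Re|exact: normr_Im].
have rew (w : R[i]) : Re w != Re z \/ Im w != Im z -> w - z != 0.
  by move=> h; rewrite subr_eq0; apply/eqP => E; case: h; rewrite E eqxx.
have [z3 z4] : (Re z != rho) /\ (Re z != - rho).
  by split; apply: contraTneq z1 => ->; rewrite -leNgt ?normrN ler_norm.
have [z5 z6] : (Im z != rho) /\ (Im z != - rho).
  by split; apply: contraTneq z2 => ->; rewrite -leNgt ?normrN ler_norm.
split; apply: ccontV.
- by move=> s; apply: rew; right; rewrite /= eq_sym.
- exact/ccontB/ccont_cst/ccont_horiz.
- by move=> s; apply: rew; left; rewrite /= eq_sym.
- exact/ccontB/ccont_cst/ccont_vert.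
- by move=> s; apply: rew; right; rewrite /= eq_sym.
- exact/ccontB/ccont_cst/ccont_horiz.
- by move=> s; apply: rew; left; rewrite /= eq_sym.
- exact/ccontB/ccont_cst/ccont_vert.
Qed.

Lemma edge_contX f n x0 x1 y0 y1 : edge_cont f x0 x1 y0 y1 ->
  edge_cont (fun z => f z ^+ n) x0 x1 y0 y1.
Proof. by case=> f1 f2 f3 f4; split; apply: ccontX. Qed.

(** The difference quotient [k], completed by the derivative at [z], is continuous everywhere and
    differentiable away from [z], so [goursat_except] makes its integral vanish. The integral of the
    kernel stays unevaluated on the right. *)
Lemma cauchy_formula f rho z : normc z < rho -> (forall w, exists D, cderiv f w D) ->
  oint rho (fun w => f w * (w - z)^-1) = f z * oint rho (fun w => (w - z)^-1).
Proof.
move=> zr df; have [D fD] := df z.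
have r0 : 0 < rho by rewrite (le_lt_trans _ zr)// normc_ge0.
pose k w := if w == z then D else (f w - f z) * (w - z)^-1.
have dk w : w != z -> exists E, cderiv k w E.
  move=> wz; have [E fE] := df w.
  have := cderivM (cderivD fE (cderiv_cst (- f z) w)) (cderiv_inv wz).
  move/(@cderiv_local _ _ k); set E' := (E' in cderiv _ _ E'); move=> H; exists E'.
  apply: H; exists (normc (w - z)); first by rewrite normc_gt0 subr_eq0.
  move=> v; rewrite normc_distC => vw; rewrite /k ifF//; apply: contraTF vw => /eqP ->.
  by rewrite ltxx.
have kz : ccont_at k z.
  move=> e e0; have [d d0 hd] := fD e e0; exists d => // w wz.
  rewrite /k eqxx; case: eqVneq => [_|wz0]; first by rewrite subrr normc0 ltW.
  have wz1 : w - z != 0 by rewrite subr_eq0.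
  rewrite (_ : _ - D = (f w - f z - D * (w - z)) * (w - z)^-1); last by field.
  by rewrite normcM normcV ler_pdivrMr ?normc_gt0// hd.
have ck : line_cont k.
  apply: line_contP => w; have [->//|/dk[E]] := eqVneq w z; exact: cderiv_ccont.
have K0 : oint rho k = 0.
  apply: (@goursat_except _ _ z) => //.
  - by rewrite -ltr_norml (le_lt_trans (normr_Re z)).
  - by rewrite -ltr_norml (le_lt_trans (normr_Im z)).
  - have [//|d d0 hd] := kz 1; exists d => //; exists (normc (k z) + 1) => w /hd h.
    rewrite -(subrK (k z) (k w)) (le_trans (le_normcD _ _))// addrC.
    by rewrite lerD2l.
have ci := oint_cont_inv zr.
have cf : oint_cont rho f.
  by apply/line_edge_cont/line_contP => w; have [E /cderiv_ccont] := df w.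
have : oint rho k = oint rho (fun w => f w * (w - z)^-1 + - f z * (w - z)^-1).
  apply: eq_oint => w /(sq_edge_ge r0) rw; rewrite /k ifF; last first.
    by apply: contraTF zr => /eqP <-; rewrite -leNgt.
  by rewrite mulrDl.
rewrite K0 /oint rectD; last 2 first.
- exact: edge_contM.
- exact/edge_contM/ci/edge_cont_cst.
by rewrite rectZ// mulNr => /eqP; rewrite eq_sym subr_eq0 => /eqP.
Qed.

(** The negative power [w^-1 ^+ m.+1], divided by [- m.+1%:R], is a primitive along the four lines,
    which all avoid 0. *)
Lemma oint_inv_pow rho m : 0 < rho -> oint rho (fun w => w^-1 ^+ m.+2) = 0.
Proof.
move=> r0; have c0 : oint_cont rho (fun w => w^-1).
  have := @oint_cont_inv rho 0; rewrite normc0 => /(_ r0).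
  by rewrite /oint_cont; under eq_fun do rewrite subr0.
have neq (a : R) : a != 0 -> (forall s : R, (s +i* a)%C != 0) /\ (forall s : R, (a +i* s)%C != 0).
  by move=> a0; split => s; rewrite eq_complex/= (negbTE a0) ?andbF.
have [n1 n2] := neq rho (lt0r_neq0 r0).
have [n3 n4] : (forall s : R, (s +i* - rho)%C != 0) /\ (forall s : R, (- rho +i* s)%C != 0).
  by apply: neq; rewrite oppr_eq0 lt0r_neq0.
have m0 : (m.+1%:R : R[i]) != 0 by rewrite pnatr_eq0.
have rr : - rho <= rho by lra.
have alg (w d : R[i]) : w != 0 ->
    - (m.+1%:R)^-1 * (m.+1%:R * w^-1 ^+ m * (- d / w ^+ 2)) = d * w^-1 ^+ m.+2.
  by move=> w0; rewrite !exprS; move: (m.+1%:R) m0 => N N0; field; rewrite w0 N0.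
apply: (@rect_primitive _ _ (fun w => - (m.+1%:R)^-1 * w^-1 ^+ m.+1)) => //.
- exact: edge_contX.
- apply: (cder_eq (cderM (cder_cst _) (cderX m (cderV n3 (cder_horiz (- rho)))))) => s.
  by rewrite mul0r add0r alg// mul1r.
- apply: (cder_eq (cderM (cder_cst _) (cderX m (cderV n1 (cder_horiz rho))))) => s.
  by rewrite mul0r add0r alg// mul1r.
- apply: (cder_eq (cderM (cder_cst _) (cderX m (cderV n4 (cder_vert (- rho)))))) => s.
  by rewrite mul0r add0r alg.
- apply: (cder_eq (cderM (cder_cst _) (cderX m (cderV n2 (cder_vert rho))))) => s.
  by rewrite mul0r add0r alg.
Qed.

(** Up to orientation, each side contributes the integral of [rho / (s ^+ 2 + rho ^+ 2)], whose
    integrand is at least [1 / (2 * rho)] on a segment of length [2 * rho]; hence 1 per side. *)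
Lemma Im_oint_inv rho : 0 < rho -> 4 <= Im (oint rho (fun w => w^-1)).
Proof.
move=> r0; have := @oint_cont_inv rho 0; rewrite normc0 => /(_ r0).
rewrite /oint_cont; under eq_fun do rewrite subr0.
move=> [[_ c1] [c2 _] [_ c3] [c4 _]].
pose q s := rho / (s ^+ 2 + rho ^+ 2).
have J (phi : R -> R) : continuous phi -> (forall s, phi s = q s) ->
    1 <= \int[@lebesgue_measure R]_(s in `[(- rho), rho]) phi s.
  move=> cphi phiq; have Ic (k : R) : (@lebesgue_measure R).-integrable `[(- rho), rho] (EFin \o cst k).
    by apply: continuous_segment_integrable => s; exact: cvg_cst.
  have -> : 1 = \int[@lebesgue_measure R]_(s in `[(- rho), rho]) (cst (2 * rho)^-1) s.
    rewrite Rintegral_cst//= lebesgue_measure_itv/= lte_fin ifT; last by lra.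
    by rewrite /= opprK; field; rewrite gt_eqF.
  apply: le_Rintegral => //; first exact: continuous_segment_integrable.
  move=> s /=; rewrite in_itv/= -ler_norml => hs; rewrite phiq /q.
  have s2 : s ^+ 2 <= rho ^+ 2 by rewrite -[s ^+ 2]real_normK ?num_real// lerXn2r// nnegrE ltW.
  have r2 : 0 < rho ^+ 2 by rewrite exprn_gt0.
  rewrite ler_pdivlMr ?ltr_wpDl ?sqr_ge0// mulrC ler_pdivrMr ?mulr_gt0//.
  by rewrite expr2 in s2 r2 *; nra.
have JN (phi : R -> R) : continuous phi -> (forall s, phi s = - q s) ->
    \int[@lebesgue_measure R]_(s in `[(- rho), rho]) phi s <= - 1.
  move=> cphi phiq; rewrite lerNr -mulN1r -RintegralZl//; last first.
    exact: continuous_segment_integrable.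
  apply: J => s; last by rewrite mulN1r phiq opprK.
  by apply: cvgM; [exact: cvg_cst|exact: cphi].
rewrite /oint /rect !(cReD, cImD, cReN, cImN) cImM [in X in _ - X]cImM /=.
rewrite !mul0r !add0r !mul1r.
have J1 := J _ c1; have J2 := J _ c2; have J3 := JN _ c3; have J4 := JN _ c4.
rewrite (_ : 4 = 1 + 1 - - 1 - - 1); last by ring.
apply: lerB; last apply: J4; last first.
- by move=> s; rewrite /vert /q /= sqrrN mulNr addrC.
apply: lerB; last apply: J3; last first.
- by move=> s; rewrite /horiz /q /=.
apply: lerD; [apply: J1|apply: J2] => s.
- by rewrite /horiz /q /= sqrrN mulNr opprK.
- by rewrite /vert /q /= addrC.
Qed.

Lemma ccont_bounded (a b : R) (g : R -> R[i]) : a <= b -> ccont g ->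
  exists M, forall s, a <= s <= b -> normc (g s) <= M.
Proof.
move=> ab [g1 g2]; pose phi s := `|Re (g s)| + `|Im (g s)|.
have cphi : continuous phi.
  by move=> s; apply: cvgD; apply: cvg_norm; [exact: g1|exact: g2].
have [c _ hc] := EVT_max ab (continuous_subspaceT cphi).
by exists (phi c) => s sab; rewrite (le_trans (normc_le_ReIm _))// hc// in_itv.
Qed.

Lemma sq_edge_bounded rho f : 0 < rho -> line_cont f ->
  exists2 M, 0 < M & forall w, sq_edge rho w -> normc w <= 2 * rho -> normc (f w) <= M.
Proof.
move=> r0 [hf vf]; have rr : - (2 * rho) <= 2 * rho by lra.
have [M1 h1] := ccont_bounded rr (hf (- rho)).
have [M2 h2] := ccont_bounded rr (vf rho).
have [M3 h3] := ccont_bounded rr (hf rho).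
have [M4 h4] := ccont_bounded rr (vf (- rho)).
exists (`|M1| + `|M2| + `|M3| + `|M4| + 1).
  by rewrite ltr_wpDl// !addr_ge0.
move=> [a b] E nw.
have ha : - (2 * rho) <= a <= 2 * rho by rewrite -ler_norml (le_trans (normr_Re (a +i* b)%C)).
have hb : - (2 * rho) <= b <= 2 * rho by rewrite -ler_norml (le_trans (normr_Im (a +i* b)%C)).
have := (ler_norm M1, ler_norm M2, ler_norm M3, ler_norm M4).
have := (normr_ge0 M1, normr_ge0 M2, normr_ge0 M3, normr_ge0 M4).
move=> [[[p1 p2] p3] p4] [[[q1 q2] q3] q4].
case: E => /= E.
- by have := h1 a ha; rewrite /horiz -E; lra.
- by have := h2 b hb; rewrite /vert -E; lra.
- by have := h3 a ha; rewrite /horiz -E; lra.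
- by have := h4 b hb; rewrite /vert -E; lra.
Qed.

(** The geometric series of the Cauchy kernel with an exact remainder. It serves the Taylor
    expansion and, later, the logarithmic derivative of a product. *)
Lemma geometric_inv n w z : w != 0 -> w - z != 0 ->
  (w - z)^-1 = \sum_(m < n) z ^+ m * w^-1 ^+ m.+1 + (z * w^-1) ^+ n * (w - z)^-1.
Proof.
move=> w0 wz; elim: n => [|n IH]; first by rewrite big_ord0 expr0 mul1r add0r.
rewrite {1}IH big_ord_recr/= -addrA; congr (_ + _).
rewrite !exprMn !exprS; move: (z ^+ n) (w^-1 ^+ n) => u v.
by field; rewrite wz w0.
Qed.

Lemma edge_cont_sum n (F : 'I_n -> R[i] -> R[i]) x0 x1 y0 y1 :
  (forall i, edge_cont (F i) x0 x1 y0 y1) ->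
  edge_cont (fun z => \sum_(i < n) F i z) x0 x1 y0 y1.
Proof. by move=> cF; split; apply: ccont_sum => j; case: (cF j). Qed.

(** On the contour [|z / w| <= 1 / 2] and [|w - z| >= rho / 2], so the remainder of [geometric_inv]
    is at most [M * 2^-n * 2 / rho]; [normc_oint] multiplies this by [16 * rho]. *)
Lemma oint_expand rho f z n M : 0 < rho -> normc z <= rho / 2 -> oint_cont rho f ->
  (forall w, sq_edge rho w -> normc w <= 2 * rho -> normc (f w) <= M) ->
  normc (oint rho (fun w => f w * (w - z)^-1)
    - \sum_(m < n) z ^+ m * oint rho (fun w => f w * w^-1 ^+ m.+1)) <= 32 * M / 2 ^+ n.
Proof.
move=> r0 zr cf fM; have zr1 : normc z < rho by rewrite (le_lt_trans zr)// ltr_pdivrMr// ltr_pMr// ltr1n.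
have ci := oint_cont_inv zr1.
have c0 : oint_cont rho (fun w => w^-1).
  have := @oint_cont_inv rho 0; rewrite normc0 => /(_ r0).
  by rewrite /oint_cont; under eq_fun do rewrite subr0.
have M0 : 0 <= M.
  apply: le_trans (normc_ge0 (f (rho +i* 0)%C)) _; apply: fM; first exact: Or42.
  by rewrite -[X in normc X]/((rho%:C)%C) normc_real gtr0_norm// ler_peMl ?ler1n// ltW.
pose er w := f w * ((z * w^-1) ^+ n * (w - z)^-1).
have cer : oint_cont rho er.
  apply: edge_contM => //; apply: edge_contM => //; apply: edge_contX.
  exact/edge_contM/c0/edge_cont_cst.
have cm m : oint_cont rho (fun w => z ^+ m * (f w * w^-1 ^+ m.+1)).
  by apply: edge_contM; [exact: edge_cont_cst|apply: edge_contM => //; exact: edge_contX].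
have nz w : sq_edge rho w -> rho / 2 <= normc (w - z) /\ rho <= normc w.
  move=> /(sq_edge_ge r0) rw; split => //.
  by have := lerB_normc w z; lra.
have -> : oint rho (fun w => f w * (w - z)^-1) =
    oint rho (fun w => \sum_(m < n) z ^+ m * (f w * w^-1 ^+ m.+1) + er w).
  apply: eq_oint => w /nz[h1 h2].
  have w0 : w != 0 by rewrite -normc_gt0 (lt_le_trans r0).
  have wz : w - z != 0 by rewrite -normc_gt0 (lt_le_trans _ h1)// divr_gt0.
  rewrite (geometric_inv n w0 wz) mulrDr mulr_sumr; congr (_ + _).
  by apply: eq_bigr => m _; rewrite mulrCA.
rewrite /oint rectD; last 2 first.
- apply: (@edge_cont_sum n (fun m w => z ^+ m * (f w * w^-1 ^+ m.+1))) => i; exact: cm.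
- exact: cer.
rewrite (@rect_sum _ _ _ (fun (m : 'I_n) w => z ^+ m * (f w * w^-1 ^+ m.+1))); last by move=> i; exact: cm.
under eq_bigr => m _.
  rewrite rectZ; last by apply: edge_contM => //; exact: edge_contX.
  over.
rewrite addrC addrA addNr add0r.
have -> : 32 * M / 2 ^+ n = 16 * (M * ((2 ^+ n)^-1 * (rho / 2)^-1)) * rho.
  by field; rewrite gt_eqF// gt_eqF// exprn_gt0.
apply: normc_oint => // w hw wr; have [h1 h2] := nz w hw.
rewrite /er !normcM normcX normcM !normcV.
apply: ler_pM => //; rewrite ?normc_ge0 ?mulr_ge0 ?exprn_ge0 ?mulr_ge0 ?invr_ge0 ?normc_ge0//.
  exact: fM.
apply: ler_pM => //; rewrite ?exprn_ge0 ?mulr_ge0 ?invr_ge0 ?normc_ge0//.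
  rewrite -exprVn lerXn2r// ?nnegrE ?mulr_ge0 ?invr_ge0 ?normc_ge0//.
  by rewrite ler_pdivrMr ?(lt_le_trans r0 h2)//; lra.
by rewrite lef_pV2// posrE ?divr_gt0// (lt_le_trans _ h1)// divr_gt0.
Qed.

Lemma half_pow_lim (x C : R) : (forall n, x <= C / 2 ^+ n) -> x <= 0.
Proof.
move=> h; apply/ler_addgt0Pl => e e0; rewrite addr0.
have := h (Num.truncn (`|C| / e)).+1; move/le_trans; apply.
rewrite ler_pdivrMr ?exprn_gt0//.
rewrite (le_trans (ler_norm C))// mulrC -ler_pdivrMr// ltW//.
apply: (lt_trans (truncnS_gt _)).
by rewrite -natrX ltr_nat ltn_expl.
Qed.

(** Expanding the kernel for the constant function 1, every power but the first integrates to 0.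
    This takes the place of a deformation of the contour. *)
Lemma oint_inv rho z : 0 < rho -> normc z <= rho / 2 ->
  oint rho (fun w => (w - z)^-1) = oint rho (fun w => w^-1).
Proof.
move=> r0 zr; apply/eqP; rewrite -subr_eq0 -normc_eq0 eq_le normc_ge0 andbT.
apply: (@half_pow_lim _ (32 * 1)) => n.
(* The expansion is taken to order [n.+1], so that its leading term exists and can be split off. *)
apply: (@le_trans _ _ (32 * 1 / 2 ^+ n.+1)); last first.
  by rewrite ler_wpM2l// lef_pV2 ?posrE ?exprn_gt0// ler_weXn2l// ler1n.
have := @oint_expand rho (fun=> 1) z n.+1 1 r0 zr (edge_cont_cst _ _ _ _ _).
move=> /(_ (fun w _ _ => _)); rewrite normc1 lexx => /(_ isT).
under eq_fun do rewrite mul1r.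
rewrite big_ord_recl/= expr0 mul1r big1 ?addr0.
  by under [X in _ - oint _ X]eq_fun do rewrite mul1r expr1.
move=> m _; under eq_fun do rewrite mul1r.
by rewrite oint_inv_pow// mulr0.
Qed.

(* The value of the integral of [1 / w] is not needed: it is non-zero, and the
   expansion divides by it. *)
Theorem taylor f rho : 0 < rho -> (forall w, exists D, cderiv f w D) ->
  exists c : nat -> R[i], exists2 K, 0 < K &
    (forall m, normc (c m) <= K / rho ^+ m) /\
    (forall z n, normc z <= rho / 2 ->
      normc (f z - \sum_(m < n) c m * z ^+ m) <= K / 2 ^+ n).
Proof.
move=> r0 df.
have cf : line_cont f by apply: line_contP => w; have [E /cderiv_ccont] := df w.
have [M M0 fM] := sq_edge_bounded r0 cf.
have k4 := Im_oint_inv r0; set k := oint rho _ in k4.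
have nk : 1 <= normc k.
  by rewrite (le_trans _ (normr_Im k))// (le_trans _ (ler_norm _))//; lra.
have nk0 : 0 < normc k by lra.
have k0 : k != 0 by rewrite -normc_gt0.
pose a m := oint rho (fun w => f w * w^-1 ^+ m.+1).
exists (fun m => a m / k); exists (32 * M); first by lra.
have c0 : oint_cont rho (fun w => w^-1).
  have := @oint_cont_inv rho 0; rewrite normc0 => /(_ r0).
  by rewrite /oint_cont; under eq_fun do rewrite subr0.
split => [m|z n zr].
  rewrite normcM normcV ler_pdivrMr//.
  apply: (@le_trans _ _ (32 * M / rho ^+ m * 1)); last first.
    by rewrite ler_wpM2l// divr_ge0 ?exprn_ge0// ltW//; lra.
  rewrite mulr1.
  apply: (@le_trans _ _ (16 * (M * (rho ^+ m.+1)^-1) * rho)).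
    apply: normc_oint => //.
      by apply: edge_contM; [exact: line_edge_cont|exact: edge_contX].
    move=> w hw wr; rewrite normcM normcX normcV.
    apply: ler_pM; rewrite ?normc_ge0 ?exprn_ge0 ?invr_ge0 ?normc_ge0//; first exact: fM.
    rewrite -exprVn lerXn2r ?nnegrE ?invr_ge0 ?normc_ge0 ?(ltW r0)//.
    have rw := sq_edge_ge r0 hw.
    by rewrite lef_pV2// posrE// (lt_le_trans r0).
  rewrite exprSr invfM (_ : _ * rho = 16 * M / rho ^+ m); last first.
    by field; rewrite !gt_eqF// exprn_gt0.
  by rewrite ler_wpM2r ?invr_ge0 ?exprn_ge0 ?(ltW r0)//; lra.
have := oint_expand n r0 zr (line_edge_cont _ _ _ _ cf) fM.
rewrite cauchy_formula//; last by rewrite (le_lt_trans zr)// ltr_pdivrMr// ltr_pMr// ltr1n.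
rewrite oint_inv// -/k => h.
have -> : f z - \sum_(m < n) a m / k * z ^+ m =
    (f z * k - \sum_(m < n) z ^+ m * a m) / k.
  rewrite mulrBl mulfK// mulr_suml; congr (_ - _); apply: eq_bigr => m _.
  by rewrite mulrAC [z ^+ m * _]mulrC.
by rewrite normcM normcV (le_trans _ h)// ler_pdivrMr// ler_peMr// normc_ge0.
Qed.

End taylor.

Section poly_approx.
Context {R : realType}.
Implicit Types (f g : R[i] -> R[i]) (z w : R[i]).

(** Induction on [m]: the remainder of order [m.+1] is [w] times the previous one plus
    [m%:R * z ^+ m.-1 * (w - z) ^+ 2], and [m^2 + m <= (m + 1)^2]. *)
Lemma exp_taylor2 (t : R) z w m : 0 < t -> normc z <= t -> normc w <= t ->
  normc (w ^+ m - z ^+ m - m%:R * z ^+ m.-1 * (w - z)) <=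
    m%:R ^+ 2 * t ^+ m * (normc (w - z) / t) ^+ 2.
Proof.
move=> t0 zt wt; elim: m => [|m IH].
  by rewrite !expr0 subrr !mul0r subr0 normc0 expr0n/= !mul0r.
have -> : w ^+ m.+1 - z ^+ m.+1 - m.+1%:R * z ^+ m.+1.-1 * (w - z) =
   w * (w ^+ m - z ^+ m - m%:R * z ^+ m.-1 * (w - z)) + m%:R * z ^+ m.-1 * (w - z) ^+ 2.
  by case: m {IH} => [|m]; rewrite /= ?expr0 ?expr1 ?mul0r ?exprS -?natr1; ring.
rewrite (le_trans (le_normcD _ _))// normcM.
apply: (@le_trans _ _ (t * (m%:R ^+ 2 * t ^+ m * (normc (w - z) / t) ^+ 2) +
    m%:R * t ^+ m.+1 * (normc (w - z) / t) ^+ 2)).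
  apply: lerD; first by apply: ler_pM; rewrite ?normc_ge0.
  rewrite !normcM normc_natr !normcX; case: m {IH} => [|m]; first by rewrite !mul0r.
  rewrite (_ : _ * t ^+ m.+2 * _ = m.+1%:R * t ^+ m * normc (w - z) ^+ 2); last first.
    by rewrite !exprS; move: (t ^+ m) (m.+1%:R : R) => u v; field; rewrite gt_eqF.
  by rewrite -expr2 ler_wpM2r ?sqr_ge0// ler_wpM2l//= lerXn2r ?nnegrE ?normc_ge0// ltW.
move: (normc (w - z) / t) => u; rewrite [t * _]mulrA -mulrDl ler_wpM2r ?sqr_ge0// [t ^+ m.+1]exprS.
rewrite (_ : t * (m%:R ^+ 2 * t ^+ m) + m%:R * (t * t ^+ m) = (m%:R ^+ 2 + m%:R) * (t * t ^+ m)); last by ring.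
rewrite ler_wpM2r ?mulr_ge0 ?exprn_ge0 ?(ltW t0)// -natr1.
by have : 0 <= m%:R :> R by []; lra.
Qed.

Lemma sqr_le_exp2 (m : nat) : (m ^ 2 <= 2 * 2 ^ m)%N.
Proof.
suff H k : ((k + 3) ^ 2 <= 2 * 2 ^ (k + 3))%N.
  by case: m => [|[|[|m]]] //; rewrite -[m.+3]addn3.
elim: k => [//|k IH].
have -> : (2 * 2 ^ (k.+1 + 3) = 2 * (2 * 2 ^ (k + 3)))%N by rewrite addSn expnS.
apply: leq_trans (leq_mul (leqnn 2) IH).
by rewrite !expnS !expn0; nia.
Qed.

Lemma geometric_sum_le2 n : \sum_(m < n) (2 ^+ m)^-1 <= 2 :> R.
Proof.
suff -> : \sum_(m < n) (2 ^+ m)^-1 = 2 - 2 / 2 ^+ n :> R.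
  by rewrite gerBl divr_ge0.
elim: n => [|n IH]; first by rewrite big_ord0 expr0 divr1 subrr.
rewrite big_ord_recr/= IH exprS; move: (2 ^+ n : R) (@lt0r_neq0 _ (2 ^+ n : R) (exprn_gt0 n (ltr0n _ 2))) => u u0.
by field.
Qed.

Theorem poly_approx f rho : 0 < rho -> (forall w, exists D, cderiv f w D) ->
  exists p : nat -> {poly R[i]}, exists2 K, 0 < K & [/\
    forall n, (p n).[0] = f 0,
    forall z n, normc z <= rho / 2 -> normc (f z - (p n).[z]) <= K / 2 ^+ n &
    forall z D, normc z <= rho / 8 -> cderiv f z D -> forall e, 0 < e ->
      exists N, forall n, (N <= n)%N -> normc ((p n)^`().[z] - D) <= e].
Proof.
move=> r0 df; have [c [K K0 [cK fc]]] := taylor r0 df.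
pose p n : {poly R[i]} := \poly_(m < n.+1) c m.
have pE n z : (p n).[z] = \sum_(m < n.+1) c m * z ^+ m by exact: horner_poly.
have dpE n z : (p n)^`().[z] = \sum_(m < n.+1) c m * (m%:R * z ^+ m.-1).
  rewrite /p poly_def linear_sum horner_sum; apply: eq_bigr => m _.
  by rewrite /= derivZ derivXn hornerZ hornerMn hornerXn mulr_natl.
have fp z n : normc z <= rho / 2 -> normc (f z - (p n).[z]) <= K / 2 ^+ n.
  move=> zr; rewrite pE (le_trans (fc z n.+1 zr))// ler_wpM2l ?(ltW K0)//.
  by rewrite lef_pV2 ?posrE ?exprn_gt0// ler_weXn2l// ler1n.
have p0 n : (p n).[0] = c 0%N.
  by rewrite pE big_ord_recl/= expr0 mulr1 big1 ?addr0// => i _; rewrite expr0n mulr0.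
exists p; exists K => //; split => //.
(* [(p n).[0]] does not depend on [n], so its vanishing distance to [f 0] makes the two equal. *)
- move=> n; rewrite p0; apply/eqP; rewrite eq_sym -subr_eq0 -normc_eq0 eq_le normc_ge0 andbT.
  apply: (@half_pow_lim _ _ K) => k; rewrite -(p0 k); apply: fp.
  by rewrite normc0 divr_ge0// ltW.
- pose t := rho / 4; have t0 : 0 < t by rewrite divr_gt0.
  (* With [t = rho / 4], the coefficient bound and [exp_taylor2] leave
     [K * m^2 / 4^m <= 2 * K / 2^m], whose sum is at most [4 * K] for every [n]. *)
  pose C := 4 * K / t ^+ 2.
  have C0 : 0 < C by rewrite divr_gt0 ?mulr_gt0// exprn_gt0.
  have quad n z w : normc z <= t -> normc w <= t ->
      normc ((p n).[w] - (p n).[z] - (p n)^`().[z] * (w - z)) <= C * normc (w - z) ^+ 2.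
    move=> zt wt; rewrite !pE dpE.
    have -> : \sum_(m < n.+1) c m * w ^+ m - \sum_(m < n.+1) c m * z ^+ m -
        (\sum_(m < n.+1) c m * (m%:R * z ^+ m.-1)) * (w - z) =
        \sum_(m < n.+1) c m * (w ^+ m - z ^+ m - m%:R * z ^+ m.-1 * (w - z)).
      rewrite mulr_suml -!sumrB; apply: eq_bigr => m _.
      by rewrite !mulrBr !mulrA.
    rewrite (le_trans (normc_sum _ _ _))//.
    apply: (@le_trans _ _ (\sum_(m < n.+1) 2 * K * (normc (w - z) / t) ^+ 2 * (2 ^+ m)^-1)).
      apply: ler_sum => m _; rewrite normcM.
      apply: le_trans (ler_pM (normc_ge0 _) (normc_ge0 _) (cK m) (exp_taylor2 m t0 zt wt)) _.
      rewrite mulrA [in leRHS]mulrAC ler_wpM2r ?sqr_ge0//.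
      have -> : K / rho ^+ m * (m%:R ^+ 2 * t ^+ m) = K * (m%:R ^+ 2 / 4 ^+ m).
        rewrite /t exprMn exprVn; have : rho ^+ m != 0 by rewrite gt_eqF// exprn_gt0.
        have : (4 : R) ^+ m != 0 by rewrite gt_eqF// exprn_gt0.
        move: (rho ^+ m) (4 ^+ m) => u v v0 u0.
        by field; rewrite u0 v0.
      rewrite (_ : 2 * K / 2 ^+ m = K * (2 / 2 ^+ m)); last by rewrite mulrA [K * 2]mulrC.
      rewrite ler_wpM2l ?(ltW K0)// ler_pdivrMr ?exprn_gt0//.
      rewrite (_ : 4 = 2 * 2); last by ring.
      rewrite exprMn mulrA divfK ?gt_eqF ?exprn_gt0//.
      by rewrite -!natrX -natrM ler_nat sqr_le_exp2.
    rewrite -mulr_sumr; apply: le_trans (ler_wpM2l _ (geometric_sum_le2 _)) _.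
      by rewrite mulr_ge0 ?sqr_ge0// mulr_ge0// ltW.
    by rewrite /C le_eqVlt; apply/orP; left; apply/eqP; field; rewrite gt_eqF.
  clearbody C; move=> z D zr fD e e0.
  have e4 : 0 < e / 4 by rewrite divr_gt0.
  have [d d0 hd] := fD _ e4.
  (* The step of the difference quotient: inside the radius of differentiability, short enough for
     [z + x] to stay within [t], and with quadratic error at most [e / 4 * x]. The index [n] is then
     chosen so that the two approximation errors are at most [e / 4 * x] each. *)
  pose x := Num.min (d / 2) (Num.min (rho / 8) (e / 4 / C)).
  have x0 : 0 < x by rewrite /x lt_min divr_gt0//= lt_min !divr_gt0.
  have xd : x < d.
    by apply: (@le_lt_trans _ _ (d / 2)); [rewrite /x ge_min lexx|lra].
  have xr : x <= rho / 8 by rewrite /x !ge_min lexx !orbT.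
  have xe : x <= e / 4 / C by rewrite /x !ge_min lexx !orbT.
  clearbody x; pose w := z + (x%:C)%C.
  have wz : w - z = (x%:C)%C by rewrite /w addrAC subrr add0r.
  have nwz : normc (w - z) = x by rewrite wz normc_real gtr0_norm.
  have zt : normc z <= t by rewrite /t; lra.
  have wt : normc w <= t.
    by rewrite (le_trans (le_normcD _ _))// normc_real gtr0_norm// /t; lra.
  exists (Num.truncn (K / (e / 4 * x))).+1 => n Nn.
  have Kn : K / 2 ^+ n <= e / 4 * x.
    rewrite ler_pdivrMr ?exprn_gt0// mulrC -ler_pdivrMr ?mulr_gt0// ltW//.
    rewrite (lt_le_trans (truncnS_gt _))// -natrX ler_nat (leq_trans Nn)// ltnW//.
    exact: ltn_expl.
  have r1 : normc z <= rho / 2 by lra.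
  have r2 : normc w <= rho / 2 by rewrite /t in wt; lra.
  have h1 := fp z n r1; have h2 := fp w n r2; have h3 := quad n z w zt wt.
  have h4 := hd w; rewrite nwz in h3 h4; have {}h4 := h4 xd.
  rewrite -(ler_pM2r x0) -[in leLHS]nwz -normcM.
  rewrite (_ : _ * (w - z) = (f w - f z - D * (w - z)) - (f w - (p n).[w]) + (f z - (p n).[z])
    - ((p n).[w] - (p n).[z] - (p n)^`().[z] * (w - z))); last by ring.
  rewrite (le_trans (le_normcB _ _))// (le_trans (lerD (le_normcD _ _) (lexx _)))//.
  rewrite (le_trans (lerD (lerD (le_normcB _ _) (lexx _)) (lexx _)))//.
  have : C * x ^+ 2 <= e / 4 * x.
    by rewrite expr2 mulrA ler_wpM2r ?(ltW x0)// mulrC -ler_pdivlMr.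
  by lra.
Qed.

End poly_approx.

(** * Polynomials bounded on a circle *)

Section roots_of_unity.
Context {R : realType}.
Implicit Types (p q : {poly R[i]}) (z w : R[i]).

Lemma prim_root_exists n : (0 < n)%N -> exists w : R[i], n.-primitive_root w.
Proof.
move=> n0; have [rs E] := closed_field_poly_normal ('X^n - 1 : {poly R[i]}).
have := @lead_coefXnsubC R[i] n 1 n0; rewrite polyC1 => lc.
rewrite lc scale1r in E.
have urs : uniq rs.
  by rewrite -separable_prod_XsubC -E separable_Xn_sub_1// pnatr_eq0 -lt0n.
have srs : size rs = n.
  have : size ('X^n - 1 : {poly R[i]}) = n.+1 by rewrite -polyC1 size_XnsubC.
  by rewrite E size_prod_XsubC => -[].
have : has n.-primitive_root rs.
  apply: has_prim_root => //; last by rewrite srs.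
  by apply/allP => z zrs; apply/unity_rootP; move: zrs; rewrite -root_prod_XsubC -E
    rootE !hornerE subr_eq0 => /eqP.
by case/hasP => w _ ww; exists w.
Qed.

Lemma sum_prim_root n w m : n.-primitive_root w ->
  \sum_(k < n) (w ^+ m) ^+ k = if (n %| m)%N then n%:R else 0.
Proof.
move=> wn; case: ifP => [nm|nm].
  have -> : w ^+ m = 1 by apply/eqP; rewrite -(prim_order_dvd wn).
  by under eq_bigr do rewrite expr1n; rewrite sumr_const card_ord.
have w1 : w ^+ m - 1 != 0 by rewrite subr_eq0 -(prim_order_dvd wn) nm.
apply: (mulfI w1); rewrite -subrX1 mulr0 -exprM mulnC exprM (prim_expr_order wn).
by rewrite expr1n subrr.
Qed.

(** The discrete Cauchy formula for a coefficient. The exponent [N - m] acts as [- m], and the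
    formula is exact because [j = m] is the only [j < N] with [N] dividing [j + (N - m)]. *)
Lemma sum_horner_prim_root p N w m (t : R[i]) : N.-primitive_root w ->
  (size p <= N)%N -> (m < N)%N ->
  \sum_(k < N) p.[t * w ^+ k] * (w ^+ k) ^+ (N - m) = N%:R * (p`_m * t ^+ m).
Proof.
move=> wN pN mN.
have step (k : 'I_N) : p.[t * w ^+ k] * (w ^+ k) ^+ (N - m) =
    \sum_(j < N) p`_j * t ^+ j * (w ^+ (j + (N - m))) ^+ k.
  rewrite (horner_coef_wide _ pN) mulr_suml; apply: eq_bigr => j _.
  rewrite exprMn !mulrA -mulrA -!exprM -exprD; congr (_ * _ ^+ _).
  by rewrite mulnDl [in RHS]mulnC [X in (_ + X)%N]mulnC.
under eq_bigr do rewrite step.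
rewrite exchange_big/= (bigD1 (Ordinal mN))//= -mulr_sumr (sum_prim_root _ wN).
rewrite subnKC ?(ltnW mN)// dvdnn big1 ?addr0; first by rewrite mulrC.
move=> j jm; rewrite -mulr_sumr (sum_prim_root _ wN) ifF ?mulr0//.
apply/negbTE; apply: contra jm => /dvdnP[q qE].
apply/eqP/val_inj => /=; have jN := ltn_ord j.
by case: q qE => [|[|q]]; rewrite ?mul0n ?mul1n ?mulSn; lia.
Qed.

Lemma coef_bound p (t M : R) m : 0 <= t ->
  (forall z, normc z = t -> normc p.[z] <= M) -> normc p`_m * t ^+ m <= M.
Proof.
move=> t0 pM; have M0 : 0 <= M.
  by rewrite (le_trans (normc_ge0 p.[(t%:C)%C]))// pM// normc_real ger0_norm.
have [pm|mp] := leqP (size p) m; first by rewrite nth_default// normc0 mul0r.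
pose N := size p; have N0 : (0 < N)%N by exact: leq_ltn_trans mp.
have [w wN] := prim_root_exists N0.
have w1 k : normc (w ^+ k) = 1.
  by rewrite normcX (normc_unity N0 (prim_expr_order wN)) expr1n.
have NR : 0 < N%:R :> R by rewrite ltr0n.
rewrite -(ler_pM2l NR).
have := sum_horner_prim_root (t%:C)%C wN (leqnn _) mp => /(congr1 (@normc R)).
rewrite !normcM normc_natr normcX normc_real ger0_norm// => <-.
rewrite (le_trans (normc_sum _ _ _))//.
rewrite mulr_natl -[X in _ *+ X]card_ord -sumr_const ler_sum// => k _.
rewrite normcM normcX w1 expr1n mulr1 pM//.
by rewrite normcM w1 mulr1 normc_real ger0_norm.
Qed.

(** If [y < x] with [y] positive, Bernoulli's inequality pushes [(x / y) ^+ n] past [C]. Taking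
    powers thus removes a multiplicative constant. *)
Lemma pow_bound (x y C : R) : 0 <= y -> 0 <= x -> (forall n, x ^+ n <= C * y ^+ n) -> x <= y.
Proof.
move=> y0 x0 h; rewrite leNgt; apply/negP => yx.
have C0 : 0 < C by have := h 0%N; rewrite !expr0 mulr1; apply: lt_le_trans.
move: y0; rewrite le_eqVlt => /predU1P[y0|y0].
  by have := h 1%N; rewrite -y0 expr1 expr1 mulr0; rewrite -y0 in yx; lra.
pose u := x / y - 1; have u0 : 0 < u by rewrite subr_gt0 ltr_pdivlMr// mul1r.
have bern n : 1 + n%:R * u <= (x / y) ^+ n.
  elim: n => [|n IH]; first by rewrite mul0r addr0 expr0.
  rewrite exprS; apply: (@le_trans _ _ ((x / y) * (1 + n%:R * u))); last first.
    by rewrite ler_wpM2l// divr_ge0// ltW.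
  have -> : x / y = 1 + u by rewrite /u addrC subrK.
  rewrite -natr1; have : 0 <= n%:R * u * u :> R by rewrite !mulr_ge0// ltW.
  by lra.
pose n := (Num.truncn (C / u)).+1.
have : (x / y) ^+ n <= C.
  by rewrite exprMn exprVn ler_pdivrMr ?exprn_gt0//.
have := bern n; have : C < n%:R * u by rewrite -ltr_pdivrMr// truncnS_gt.
by lra.
Qed.

(* The coefficient bound applied to [p ^+ n] gives [|p z| ^+ n <= 2 * M ^+ n]. *)
Lemma max_modulus p (t M : R) z : 0 < t ->
  (forall z, normc z = t -> normc p.[z] <= M) -> normc z <= t / 2 -> normc p.[z] <= M.
Proof.
move=> t0 pM zt; have M0 : 0 <= M.
  by rewrite (le_trans (normc_ge0 p.[(t%:C)%C]))// pM// normc_real gtr0_norm.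
apply: (@pow_bound _ _ 2) => //; first exact: normc_ge0.
move=> n; rewrite -normcX -horner_exp.
have qM z' : normc z' = t -> normc (p ^+ n).[z'] <= M ^+ n.
  by move=> zt'; rewrite horner_exp normcX lerXn2r// ?nnegrE ?normc_ge0// pM.
rewrite horner_coef (le_trans (normc_sum _ _ _))//.
apply: (@le_trans _ _ (\sum_(m < size (p ^+ n)) M ^+ n * (2 ^+ m)^-1)).
  apply: ler_sum => m _; rewrite normcM normcX.
  apply: (@le_trans _ _ (normc (p ^+ n)`_m * (t / 2) ^+ m)).
    by rewrite ler_wpM2l ?normc_ge0// lerXn2r// nnegrE ?normc_ge0// divr_ge0// ltW.
  rewrite exprMn exprVn mulrA ler_wpM2r ?invr_ge0 ?exprn_ge0//.
  exact: (coef_bound _ (ltW t0) qM).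
by rewrite -mulr_sumr mulrC ler_wpM2r ?exprn_ge0// geometric_sum_le2.
Qed.

(* The average of [L - Re p >= 0] over the [N]-th roots of unity times [t],
   against the weight [1 + Re (u w^-m) >= 0], is [L - |p_m| t^m / 2] when [u] is
   the phase conjugate to [p_m]. *)
Lemma borel_caratheodory p (t L : R) m : 0 < t -> p`_0 = 0 -> (0 < m)%N ->
  (forall z, normc z = t -> Re p.[z] <= L) -> normc p`_m * t ^+ m <= 2 * L.
Proof.
(* [N] is so large that [N - m] is still at least [size p]: the coefficient of index [N - m],
   selected by the conjugate half of the weight, is then 0. *)
move=> t0 p0 m0 pL; pose N := (size p + m).+1.
have N0 : (0 < N)%N by [].
have [w wN] := prim_root_exists N0.
have wN1 := prim_expr_order wN.
have w1 k : normc (w ^+ k) = 1.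
  by rewrite normcX (normc_unity N0 wN1) expr1n.
have wJ k : (w ^+ k)^*%C = (w ^+ k) ^+ N.-1.
  have wk0 : w ^+ k != 0 by rewrite -normc_gt0 w1.
  apply: (mulfI wk0); rewrite -exprS prednK// -exprM mulnC exprM wN1 expr1n.
  by rewrite -sqr_normc normCE w1 expr1n.
have sN : (size p <= N)%N by rewrite /N; lia.
have mN : (m < N)%N by rewrite /N; lia.
pose b := p`_m * ((t%:C)%C) ^+ m.
have nb : normc b = normc p`_m * t ^+ m by rewrite normcM normcX normc_real gtr0_norm.
have [u u1 ub] : exists2 u, normc u = 1 & u * b = ((normc b)%:C)%C.
  have [b0|b0] := eqVneq b 0; first by exists 1; rewrite ?normc1// b0 mulr0 normc0.
  exists (((normc b)%:C)%C / b); last by rewrite divfK.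
  by rewrite normcM normcV normc_real ger0_norm ?normc_ge0// divff// normc_eq0.
pose q k := p.[(t%:C)%C * w ^+ k].
have Sq : \sum_(k < N) q k = 0.
  have := sum_horner_prim_root (t%:C)%C wN sN N0; rewrite p0 mul0r mulr0 => E; rewrite -[RHS]E.
  by apply: eq_bigr => k _; rewrite subn0 -exprM mulnC exprM wN1 expr1n mulr1.
have Sqm : \sum_(k < N) q k * (w ^+ k) ^+ (N - m) = N%:R * b.
  exact: sum_horner_prim_root.
have Sqp : \sum_(k < N) q k * (w ^+ k) ^+ m = 0.
  have Nm : (N - m < N)%N by lia.
  have := sum_horner_prim_root (t%:C)%C wN sN Nm.
  rewrite subKn ?(ltnW mN)// => ->.
  have Np : (size p <= N - m)%N by rewrite /N; lia.
  by rewrite (nth_default _ Np) mul0r mulr0.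
have Sw : \sum_(k < N) (w ^+ k) ^+ (N - m) = 0.
  have := sum_prim_root (N - m) wN; rewrite ifF; last first.
    by apply/negbTE/negP => /dvdn_leq; rewrite subn_gt0 mN => /(_ isT); lia.
  by move=> E; rewrite -[RHS]E; apply: eq_bigr => k _; rewrite -!exprM mulnC.
have wmJ k : ((w ^+ k) ^+ (N - m))^*%C = (w ^+ k) ^+ m.
  rewrite rmorphXn/= wJ -(exprM (w ^+ k)).
  have -> : (N.-1 * (N - m) = (N - m - 1) * N + m)%N.
    by have : (m < N)%N by []; move: (N) => [|n]//=; nia.
  rewrite exprD mulnC exprM -(exprM w k N) [(k * N)%N]mulnC exprM wN1 !expr1n.
  by rewrite mul1r.
have ReS (F : 'I_N -> R[i]) : Re (\sum_(k < N) F k) = \sum_(k < N) Re (F k).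
  by apply: (big_morph _ (@cReD R)).
have main : 0 <= \sum_(k < N) (L - Re (q k)) * (1 + Re (u * (w ^+ k) ^+ (N - m))).
  apply: sumr_ge0 => k _; apply: mulr_ge0.
    by rewrite subr_ge0 pL// normcM w1 mulr1 normc_real gtr0_norm.
  rewrite -lerBlDl sub0r; have : `|Re (u * (w ^+ k) ^+ (N - m))| <= 1.
    by rewrite (le_trans (normr_Re _))// normcM u1 mul1r normcX w1 expr1n.
  by rewrite ler_norml => /andP[].
(* The product of the two real parts is split by [Re a * Re b = (Re (a b) + Re (a b')) / 2] with
   [b'] the conjugate of [b]; the sums over [k] of the resulting terms are [Sqm] and [Sqp]. *)
have E (k : 'I_N) : (L - Re (q k)) * (1 + Re (u * (w ^+ k) ^+ (N - m))) =
    L - Re (q k) + L * Re (u * (w ^+ k) ^+ (N - m))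
    - Re (u * (q k * (w ^+ k) ^+ (N - m))) / 2 - Re (u^*%C * (q k * (w ^+ k) ^+ m)) / 2.
  rewrite -wmJ; move: (q k) ((w ^+ k) ^+ (N - m)) => [a1 a2] [b1 b2]; case: u {u1 ub main} => u1 u2 /=.
  by field.
move: main; under eq_bigr do rewrite E.
rewrite !sumrB !big_split/= !sumrN -!mulr_suml -!mulr_sumr -!ReS -!mulr_sumr.
rewrite Sq Sqm Sqp Sw !mulr0 !mul0r !subr0 addr0 sumr_const card_ord.
rewrite mulrCA ub -mulr_natl -(rmorph_nat (real_complex R)) -rmorphM/=.
move=> h; have : 0 <= N%:R * (L - normc b / 2).
  by move: h; rewrite -(mulr_natl L N); lra.
by rewrite pmulr_rge0 ?ltr0n// -nb; lra.
Qed.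

End roots_of_unity.

(** * Logarithms of products without zeros near the origin *)

Section log_taylor.
Context {R : realType}.
Implicit Types (z w : R[i]).

Lemma cder_sum n (g dg : 'I_n -> R -> R[i]) : (forall i, cder (g i) (dg i)) ->
  cder (fun s => \sum_(i < n) g i s) (fun s => \sum_(i < n) dg i s).
Proof.
elim: n g dg => [|n IH] g dg h.
  have E (k : 'I_0 -> R -> R[i]) : (fun s => \sum_(i < 0) k i s) = fun=> 0.
    by apply/funext => s; rewrite big_ord0.
  by rewrite !E; exact: cder_cst.
have E (k : 'I_n.+1 -> R -> R[i]) : (fun s => \sum_(i < n.+1) k i s) =
    fun s => \sum_(i < n) k (widen_ord (leqnSn n) i) s + k ord_max s.
  by apply/funext => s; rewrite big_ord_recr.
by rewrite !E; exact: (cderD (IH _ _ (fun i => h _)) (h _)).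
Qed.

(* Up to sign, the remainder is the real part of [w ^+ n.+1] times the integral of
   [s ^+ n / (1 - s w)] over [0, 1]; the mean value theorem bounds it. *)
Lemma log_taylor w (q : R) n : normc w <= q -> q < 1 ->
  `|ln (normc (1 - w)) + Re (\sum_(m < n) m.+1%:R^-1 * w ^+ m.+1)| <= q ^+ n.+1 / (1 - q).
Proof.
move=> wq q1; have q0 : 0 <= q by rewrite (le_trans _ wq)// normc_ge0.
pose g s := 1 - (s +i* 0)%C * w.
pose h s := \sum_(m < n) m.+1%:R^-1 * ((s +i* 0)%C * w) ^+ m.+1.
have dsw : cder (fun s => (s +i* 0)%C * w) (fun=> w).
  apply: (cder_eq (cderM (cder_horiz 0) (cder_cst w))) => s.
  by rewrite mul1r mulr0 addr0.
have dg : cder g (fun=> - w).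
  have -> : g = (fun s => 1 + (- 1) * ((s +i* 0)%C * w)).
    by apply/funext => s; rewrite /g mulN1r.
  apply: (cder_eq (cderD (cder_cst 1) (cderM (cder_cst (-1)) dsw))) => s.
  by rewrite mul0r !add0r mulN1r.
have dh : cder h (fun s => \sum_(m < n) ((s +i* 0)%C * w) ^+ m * w).
  apply: cder_sum => m; apply: (cder_eq (cderM (cder_cst _) (cderX m dsw))) => s.
  by rewrite mul0r add0r -mulrA mulKf// pnatr_eq0.
have gs (s : R) : 0 <= s <= 1 -> 1 - q <= normc (g s).
  move=> /andP[s0 s1]; have := lerB_normc 1 ((s +i* 0)%C * w).
  rewrite normc1 normcM -[X in normc X * _]/((s%:C)%C) normc_real ger0_norm//.
  have : s * normc w <= q by rewrite (le_trans _ wq)// ler_piMl// normc_ge0.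
  by rewrite -/(g s); lra.
have gs0 (s : R) : 0 <= s <= 1 -> g s != 0.
  by move=> /gs h1; rewrite -normc_gt0; lra.
(* [ln |g s|] is written as half of [ln (N s)], which avoids differentiating a square root. *)
pose N s := Re (g s) ^+ 2 + Im (g s) ^+ 2.
pose dphi s := - Re (w * (((s +i* 0)%C * w) ^+ n / g s)).
pose phi s := 2^-1 * ln (N s) + Re (h s).
have Dphi (s : R) : 0 <= s <= 1 -> is_derive s 1 phi (dphi s).
  move=> s01; have g0 := gs0 s s01; have N0 : 0 < N s by exact: sqr_ReIm_gt0.
  have [g1 g2] := dg s.
  have DN : is_derive s 1 N (2 * Re (g s) * Re (- w) + 2 * Im (g s) * Im (- w)).
    exact: (is_derive_eq (is_deriveD (is_deriveX 2 g1) (is_deriveX 2 g2))).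
  have Dln := is_derive1_comp (is_derive1_ln N0) DN.
  apply: (is_derive_eq (is_deriveD (is_deriveZ 2^-1 Dln) (dh s).1)).
  have -> : \sum_(m < n) ((s +i* 0)%C * w) ^+ m * w =
      w * (g s)^-1 - w * (((s +i* 0)%C * w) ^+ n / g s).
    have geo : (\sum_(m < n) ((s +i* 0)%C * w) ^+ m) * g s = 1 - ((s +i* 0)%C * w) ^+ n.
      by rewrite /g -[RHS]opprB subrX1; move: (_ * w) => u; ring.
    rewrite -mulr_suml; apply: (mulIf g0); rewrite mulrAC geo.
    by move: (_ ^+ n) => u; field.
  rewrite /dphi [Re (w / g s - _)]cReD [Re (- (w * _))]cReN.
  rewrite -[RHS]add0r addrA; congr (_ + _).
  rewrite /GRing.scale/= [Re (w / g s)]cReM cReV cImV !cReN cImN -/(N s).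
  by field; rewrite gt_eqF.
have cphi : {within `[0, 1], continuous phi}.
  apply: derivable_within_continuous => s; rewrite in_itv/= => s01.
  exact: (@ex_derive _ _ _ _ _ _ _ (Dphi s s01)).
have Dphi' (s : R) : s \in `]0, 1[ -> is_derive s 1 phi (dphi s).
  by rewrite in_itv/= => /andP[s0 s1]; apply: Dphi; rewrite !ltW.
have [c c01] := MVT_segment (@ler01 R) Dphi' cphi.
rewrite in_itv/= in c01; have /andP[c0 c1] := c01.
have -> : phi 0 = 0.
  rewrite /phi /N /g /h mul0r subr0 /= expr1n expr0n addr0 ln1 mulr0 add0r.
  rewrite big1// => m _.
  by rewrite expr0n mulr0.
have -> : phi 1 = ln (normc (1 - w)) + Re (\sum_(m < n) m.+1%:R^-1 * w ^+ m.+1).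
  rewrite /phi /N /g /h (_ : (1 +i* 0)%C = 1)// mul1r -sqr_normc_def lnXn; last first.
    by have := gs 1; rewrite /g (_ : (1 +i* 0)%C = 1)// mul1r lexx ler01 => /(_ isT); lra.
  by rewrite -[ln _ *+ 2]mulr_natl mulKf.
rewrite !subr0 mulr1 => ->; rewrite /dphi normrN (le_trans (normr_Re _))//.
have g1 := gs c c01; have q10 : 0 < 1 - q by lra.
rewrite !normcM normcV normcX normcM mulrA.
apply: ler_pM; rewrite ?mulr_ge0 ?exprn_ge0 ?mulr_ge0 ?invr_ge0 ?normc_ge0//; last first.
  by rewrite lef_pV2 ?posrE//; lra.
rewrite exprS; apply: ler_pM; rewrite ?exprn_ge0 ?mulr_ge0 ?normc_ge0//.
rewrite lerXn2r ?nnegrE ?mulr_ge0 ?normc_ge0// -[X in X * _]/(normc ((c%:C)%C)).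
by rewrite normc_real ger0_norm// (le_trans _ wq)// ler_piMl// normc_ge0.
Qed.

End log_taylor.

Section zero_free.
Context {R : realType}.
Implicit Types (z : R[i]) (s : seq R[i]).

(* [log_poly s n] truncates the power series at [0] of the logarithm of
   [root_prod s]. *)
Definition root_prod s z := \prod_(a <- s) (1 - z / a).
Definition log_coef s m := - (\sum_(a <- s) a^-1 ^+ m) / m%:R.
Definition log_poly s n : {poly R[i]} := \poly_(m < n.+1) log_coef s m.

Lemma horner_log_poly s n z : (log_poly s n).[z] =
  - \sum_(a <- s) \sum_(m < n) m.+1%:R^-1 * (z / a) ^+ m.+1.
Proof.
rewrite horner_poly big_ord_recl/= /log_coef invr0 mulr0 mul0r add0r.
rewrite exchange_big/= -sumrN; apply: eq_bigr => m _.
rewrite !mulNr -mulr_sumr; congr (- _).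
rewrite /bump/= add1n mulrAC mulrC mulr_suml; congr (_ * _).
by apply: eq_bigr => a _; rewrite exprMn mulrC.
Qed.

Lemma ln_prod (I : Type) (r : seq I) (F : I -> R) : (forall i, 0 < F i) ->
  ln (\prod_(i <- r) F i) = \sum_(i <- r) ln (F i).
Proof.
move=> F0; elim: r => [|i r IH]; first by rewrite !big_nil ln1.
by rewrite !big_cons lnM ?IH// posrE// prodr_gt0.
Qed.

Lemma pow34_lim (x C : R) n0 : (forall n, (n0 <= n)%N -> x <= C * (3 / 4) ^+ n) -> x <= 0.
Proof.
move=> h; apply: (@half_pow_lim _ _ `|C|) => n.
(* Three factors 3/4 give 27/64, below 1/2, so the index [3 * n + n0] reduces the claim to
   [half_pow_lim]. *)
have hn : (n0 <= 3 * n + n0)%N by lia.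
apply: le_trans (h _ hn) _; rewrite (le_trans (ler_wpM2r _ (ler_norm C)))//.
rewrite ler_wpM2l// exprD exprM -exprVn.
have h1 : (3 / 4 : R) ^+ n0 <= 1 by rewrite exprn_ile1//; lra.
have h2 : ((3 / 4 : R) ^+ 3) ^+ n <= 2^-1 ^+ n.
  by rewrite lerXn2r ?nnegrE ?exprn_ge0// !exprS expr0; lra.
apply: le_trans (ler_pM _ _ h2 h1) _; rewrite ?mulr1// exprn_ge0//.
Qed.

Variables (s : seq R[i]) (t L : R).
Hypothesis t0 : 0 < t.
Hypothesis hs : forall a : R[i], a \in s -> 4 / 3 * t <= normc a.
Hypothesis HL : forall z, normc z = t -> normc (root_prod s z) <= expR L.

(** The error of [log_taylor] at ratio 3/4, added up over the zeros; the ratio comes from [|z| <= t]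
    and [|a| >= 4 / 3 * t]. *)
Let delta n : R := (size s)%:R * ((3 / 4) ^+ n.+1 / (1 - 3 / 4)).

Lemma root_prod_log z n : normc z <= t ->
  `|ln (normc (root_prod s z)) - Re (log_poly s n).[z]| <= delta n.
Proof.
move=> zt; have za (a : R[i]) : a \in s -> normc (z / a) <= 3 / 4.
  move=> /hs as_; have a0 : 0 < normc a by move: t0 as_; lra.
  by rewrite normcM normcV ler_pdivrMr//; move: t0 zt as_; lra.
(* The value 1 off [s] makes [F] positive everywhere, as [ln_prod] requires. *)
pose F (a : R[i]) := if a \in s then normc (1 - z / a) else 1.
have F0 a : 0 < F a.
  rewrite /F; case: ifP => // /za h.
  by have := lerB_normc 1 (z / a); rewrite normc1; lra.
have -> : normc (root_prod s z) = \prod_(a <- s) F a.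
  by rewrite normc_prod; apply: eq_big_seq => a as_; rewrite /F as_.
rewrite ln_prod// horner_log_poly cReN opprK.
have ReS (r : seq R[i]) (G : R[i] -> R[i]) : Re (\sum_(a <- r) G a) = \sum_(a <- r) Re (G a).
  by apply: (big_morph _ (@cReD R)).
rewrite ReS -big_split/= (le_trans (ler_norm_sum _ _ _))//.
apply: (@le_trans _ _ (\sum_(a <- s) (3 / 4) ^+ n.+1 / (1 - 3 / 4) : R)).
  rewrite !big_seq; apply: ler_sum => a as_; rewrite /F as_.
  by apply: log_taylor; [exact: za|lra].
by rewrite big_const_seq count_predT iter_addr addr0 /delta -[leLHS]mulr_natl.
Qed.

Let delta_lim (x y : R) n0 : (forall n, (n0 <= n)%N -> x <= y + 2 * delta n) -> x <= y.
Proof.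
move=> h; rewrite -subr_le0; apply: (@pow34_lim _ (6 * (size s)%:R) n0) => n /h; rewrite /delta.
have -> : (1 - 3 / 4 : R)^-1 = 4 by field.
by rewrite exprS; move: ((3 / 4) ^+ n) ((size s)%:R : R) => u v; lra.
Qed.

Let delta_ge0 n : 0 <= delta n.
Proof. by rewrite /delta !mulr_ge0 ?invr_ge0 ?exprn_ge0//; lra. Qed.

(** On [|z| = t] the real part of [log_poly s n] is at most [L + delta n], to which
    Borel-Caratheodory applies. The coefficient of index [m] is the same for all [n >= m], so
    [delta n] can tend to 0. *)
Lemma log_coef_bound m : (0 < m)%N -> normc (log_coef s m) * t ^+ m <= 2 * L.
Proof.
move=> m0; apply: (@delta_lim _ _ m) => n mn.
rewrite -mulrDr; have -> : log_coef s m = (log_poly s n)`_m by rewrite coef_poly ltnS mn.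
apply: borel_caratheodory => //.
  (* At index 0 [log_coef] divides by 0, which yields the zero constant term wanted here. *)
  by rewrite coef_poly/= /log_coef invr0 mulr0.
move=> z zt; have zt' : normc z <= t by rewrite zt.
have P0 : 0 < normc (root_prod s z).
  rewrite normc_gt0 prodf_seq_neq0; apply/allP => a as_ /=.
  have := hs as_ => h; have a0 : 0 < normc a by move: t0 as_; lra.
  rewrite -normc_gt0 (lt_le_trans _ (lerB_normc _ _))// normc1 subr_gt0.
  by rewrite normcM normcV ltr_pdivrMr//; lra.
have : ln (normc (root_prod s z)) <= L.
  by rewrite -[leRHS]expRK ler_ln ?posrE ?expR_gt0// HL.
have := root_prod_log n zt'; rewrite ler_norml => /andP[h1 _].
by lra.
Qed.

Let L_ge0 : 0 <= L.
Proof.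
have := @log_coef_bound 1 isT; have : 0 <= normc (log_coef s 1) * t ^+ 1.
  by rewrite mulr_ge0 ?normc_ge0// exprn_ge0// ltW.
by lra.
Qed.

Lemma log_poly_bound z n : normc z <= t / 2 -> normc (log_poly s n).[z] <= 4 * L.
Proof.
move=> zt; have L0 := L_ge0; rewrite horner_poly (le_trans (normc_sum _ _ _))//.
apply: (@le_trans _ _ (\sum_(m < n.+1) 2 * L * (2 ^+ m)^-1)); last first.
  rewrite -mulr_sumr; apply: le_trans (ler_wpM2l _ (geometric_sum_le2 _)) _; lra.
apply: ler_sum => m _; rewrite normcM normcX.
have [->|m0] := posnP m.
  by rewrite /log_coef invr0 mulr0 normc0 mul0r mulr_ge0 ?invr_ge0 ?exprn_ge0//; lra.
apply: (@le_trans _ _ (normc (log_coef s m) * (t / 2) ^+ m)).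
  by rewrite ler_wpM2l ?normc_ge0// lerXn2r// nnegrE ?normc_ge0// divr_ge0// ltW.
rewrite exprMn exprVn mulrA ler_wpM2r ?invr_ge0 ?exprn_ge0//.
exact: log_coef_bound.
Qed.

(** An upper bound becomes a lower one: the real part of the logarithm is at least minus its
    modulus, and the coefficient bounds control the modulus at half the radius. *)
Lemma zero_free_lower z : normc z <= t / 2 -> - (4 * L) <= ln (normc (root_prod s z)).
Proof.
move=> zt; rewrite lerNl; apply: (@delta_lim _ _ 0%N) => n _.
have zt' : normc z <= t by move: t0 zt; lra.
have := root_prod_log n zt'; rewrite ler_norml => /andP[h1 _].
have := log_poly_bound n zt; have := normr_Re (log_poly s n).[z].
rewrite ler_norml => /andP[h2 _] h3; have := delta_ge0 n.
by lra.
Qed.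

Lemma arith_geometric_sum_le4 n : \sum_(m < n) m.+1%:R * (2 ^+ m)^-1 <= 4 :> R.
Proof.
suff -> : \sum_(m < n) m.+1%:R * (2 ^+ m)^-1 = 4 - (2 * n%:R + 4) / 2 ^+ n :> R.
  by rewrite gerBl divr_ge0 ?addr_ge0 ?mulr_ge0// exprn_ge0.
elim: n => [|n IH]; first by rewrite big_ord0 expr0; field.
rewrite big_ord_recr/= IH exprS -natr1.
move: (2 ^+ n : R) (@lt0r_neq0 _ (2 ^+ n : R) (exprn_gt0 n (ltr0n _ 2))) => u u0.
by field.
Qed.

(** The power series of the sum has coefficients [m.+1%:R * log_coef s m.+1], bounded by
    [log_coef_bound]; summing [m.+1 / 2^m] gives at most 4. The remainder of the geometric expansion
    is at most a constant over [2 ^+ n]. *)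
Lemma zero_free_log_deriv z : normc z <= t / 2 ->
  normc (\sum_(a <- s) (z - a)^-1) <= 8 * L / t.
Proof.
move=> zt; rewrite -subr_le0; apply: (@half_pow_lim _ _ ((size s)%:R * (t / 2)^-1)) => n.
have L0 := L_ge0.
have -> : \sum_(a <- s) (z - a)^-1 =
    \sum_(m < n) m.+1%:R * log_coef s m.+1 * z ^+ m + \sum_(a <- s) (z / a) ^+ n * (z - a)^-1.
  have -> : \sum_(m < n) m.+1%:R * log_coef s m.+1 * z ^+ m =
      - \sum_(a <- s) \sum_(m < n) z ^+ m * a^-1 ^+ m.+1.
    rewrite exchange_big/= -sumrN; apply: eq_bigr => m _.
    rewrite /log_coef mulrCA mulfV ?mulr1 ?pnatr_eq0// mulNr; congr (- _).
    by rewrite mulrC mulr_sumr.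
  rewrite -sumrN -big_split/= !big_seq; apply: eq_bigr => a as_.
  have na : 0 < normc a by move: t0 zt (hs as_); lra.
  have a0 : a != 0 by rewrite -normc_gt0.
  have az : a - z != 0.
    by rewrite -normc_gt0 (lt_le_trans _ (lerB_normc _ _))//; move: t0 zt (hs as_); lra.
  rewrite -[z - a]opprB invrN {1}(geometric_inv n a0 az).
  by rewrite mulrN opprD.
rewrite lerBlDr (le_trans (le_normcD _ _))// addrC lerD//.
  rewrite (le_trans (normc_sum _ _ _))//.
  rewrite -mulrA mulr_natl -[in leRHS](count_predT s) -iter_addr_0 -big_const_seq.
  rewrite !big_seq; apply: ler_sum => a as_; have ha := hs as_.
  rewrite normcM normcX normcM !normcV mulrC; apply: ler_pM;
    rewrite ?exprn_ge0 ?mulr_ge0 ?invr_ge0 ?normc_ge0//.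
    have h1 : t / 2 <= normc (z - a).
      by rewrite normc_distC (le_trans _ (lerB_normc _ _))//; move: t0 zt ha; lra.
    by rewrite lef_pV2 ?posrE ?(lt_le_trans _ h1)// divr_gt0.
  rewrite -exprVn lerXn2r ?nnegrE ?mulr_ge0 ?invr_ge0 ?normc_ge0//.
  by rewrite ler_pdivrMr//; move: t0 zt ha; lra.
rewrite (le_trans (normc_sum _ _ _))//.
apply: (@le_trans _ _ (\sum_(m < n) 2 * L / t * (m.+1%:R * (2 ^+ m)^-1))); last first.
  rewrite -mulr_sumr; apply: le_trans (ler_wpM2l _ (arith_geometric_sum_le4 _)) _.
    by rewrite divr_ge0 ?mulr_ge0// ltW.
  by rewrite mulrAC ler_wpM2r ?invr_ge0 ?(ltW t0)//; lra.
apply: ler_sum => m _; rewrite 2!normcM normc_natr normcX.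
rewrite -mulrA [in leRHS]mulrCA ler_wpM2l//.
apply: (@le_trans _ _ (normc (log_coef s m.+1) * (t / 2) ^+ m)).
  by rewrite ler_wpM2l ?normc_ge0// lerXn2r// nnegrE ?normc_ge0// divr_ge0// ltW.
rewrite exprMn exprVn mulrA ler_wpM2r ?invr_ge0 ?exprn_ge0//.
rewrite ler_pdivlMr// -mulrA -exprSr.
exact: log_coef_bound.
Qed.

End zero_free.

(** * Splitting a polynomial into near and far zeros *)

Section near_far.
Context {R : realType}.
Implicit Types (z : R[i]) (p : {poly R[i]}) (s : seq R[i]).

Lemma deriv_prod_XsubC s z : z \notin s ->
  (\prod_(a <- s) ('X - a%:P))^`().[z] =
  (\prod_(a <- s) ('X - a%:P)).[z] * \sum_(a <- s) (z - a)^-1.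
Proof.
elim: s => [|a s IH] zs; first by rewrite !big_nil derivC hornerC mulr0.
move: zs; rewrite inE negb_or => /andP[za zs].
rewrite !big_cons derivM derivXsubC mul1r !hornerE IH//.
have za0 : z - a != 0 by rewrite subr_eq0.
by move: (\prod_(_ <- _) _).[z] (\sum_(_ <- _) _) => u v; field.
Qed.

Lemma ln_le_id (x : R) : 0 < x -> ln x <= x.
Proof.
move=> x0; have := @le_ln1Dx R (x - 1); rewrite addrCA subrr addr0 => h.
by apply: (@le_trans _ _ (x - 1)); [apply: h; lra|lra].
Qed.

(* [ns] lists the zeros in the disc of radius [4 r]. Replacing each factor
   [z - a] of these by the constant [8 r] gives a polynomial [h] without zeros in
   that disc; [h] is still bounded by [M], as [|z - a| >= 8 r] on [|z| = 12 r],
   and [|h 0| >= 2 ^+ size ns * |p 0|]. *)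
Theorem poly_near_far p (r M : R) : 0 < r -> p.[0] != 0 ->
  (forall z, normc z = 12 * r -> normc p.[z] <= M) ->
  exists ns : seq R[i],
    [/\ (size ns)%:R * ln 2 <= ln (M / normc p.[0]),
     0 <= ln (M / normc p.[0]),
     forall a, a \in ns -> normc a <= 4 * r,
     forall z, normc z <= 3 / 2 * r -> p.[z] != 0 ->
       normc (p^`().[z] / p.[z]) <=
         \sum_(a <- ns) (normc (z - a))^-1 + 8 / 3 * ln (M / normc p.[0]) / r &
     forall z, normc z <= 3 / 2 * r -> if p.[z] == 0 then z \in ns else
       ln (M / normc p.[z]) <=
         5 * ln (M / normc p.[0]) + 8 * r * \sum_(a <- ns) (normc (z - a))^-1].
Proof.
move=> r0 p0 pM; have [rs E] := closed_field_poly_normal p.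
pose near_ := [seq a <- rs | normc a <= 4 * r].
pose far := [seq a <- rs | ~~ (normc a <= 4 * r)].
set c := lead_coef p in E.
have split_ (G : R[i] -> R[i]) : \prod_(a <- rs) G a =
    (\prod_(a <- near_) G a) * \prod_(a <- far) G a.
  by rewrite !big_filter (bigID (fun a => normc a <= 4 * r)).
have splitS (G : R[i] -> R[i]) : \sum_(a <- rs) G a =
    (\sum_(a <- near_) G a) + \sum_(a <- far) G a.
  by rewrite !big_filter (bigID (fun a => normc a <= 4 * r)).
have pE z : p.[z] = c * (\prod_(a <- near_) (z - a)) * \prod_(a <- far) (z - a).
  rewrite E hornerZ horner_prod -mulrA -split_; congr (_ * _).
  by apply: eq_bigr => a _; rewrite hornerXsubC.
have p00 : 0 < normc p.[0] by rewrite normc_gt0.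
have near_le a : a \in near_ -> normc a <= 4 * r by rewrite mem_filter => /andP[].
have far_ge (a : R[i]) : a \in far -> 4 * r < normc a.
  by rewrite mem_filter -ltNge => /andP[].
pose k := ((8 * r)%:C)%C ^+ size near_.
have kE : normc k = (8 * r) ^+ size near_.
  by rewrite normcX normc_real gtr0_norm// mulr_gt0.
pose h : {poly R[i]} := (c * k) *: \prod_(a <- far) ('X - a%:P).
have hE z : h.[z] = c * k * \prod_(a <- far) (z - a).
  rewrite hornerZ horner_prod; congr (_ * _).
  by apply: eq_bigr => a _; rewrite hornerXsubC.
have hp z : normc h.[z] * \prod_(a <- near_) normc (z - a) =
    normc p.[z] * (8 * r) ^+ size near_.
  by rewrite hE pE !normcM kE -normc_prod; ring.
have prodk (x : R) : \prod_(a <- near_) x = x ^+ size near_.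
  by rewrite big_const_seq count_predT -Monoid.iteropE.
have hM z : normc z = 12 * r -> normc h.[z] <= M.
  move=> zr; apply: le_trans (pM z zr).
  have : (8 * r) ^+ size near_ <= \prod_(a <- near_) normc (z - a).
    rewrite -prodk !big_seq; apply: ler_prod => a /near_le ha.
    rewrite mulr_ge0 ?(ltW r0)//= (le_trans _ (lerB_normc _ _))// zr.
    by move: ha; lra.
  set P := \prod_(a <- near_) _ => hP.
  have k0 : 0 < (8 * r) ^+ size near_ by rewrite exprn_gt0// mulr_gt0.
  have P0 : 0 < P by exact: lt_le_trans hP.
  by rewrite -(ler_pM2r P0) hp ler_wpM2l ?normc_ge0.
have r12 : 0 < 12 * r by rewrite mulr_gt0.
have hM' z : normc z <= 6 * r -> normc h.[z] <= M.
  by move=> zr; apply: (max_modulus r12 hM); move: zr; lra.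
have h0M : normc h.[0] <= M by apply: hM'; rewrite normc0 mulr_ge0// ltW.
have h0 : 2 ^+ size near_ * normc p.[0] <= normc h.[0].
  have : \prod_(a <- near_) normc (0 - a) <= (4 * r) ^+ size near_.
    rewrite -prodk !big_seq; apply: ler_prod => a /near_le ha.
    by rewrite normc_ge0 sub0r normcN.
  have k0 : 0 < (4 * r) ^+ size near_ by rewrite exprn_gt0// mulr_gt0.
  move=> hP; rewrite -(ler_pM2r k0) mulrAC -exprMn.
  rewrite (_ : 2 * (4 * r) = 8 * r); last by ring.
  by rewrite mulrC -hp ler_wpM2l// normc_ge0.
have h00 : 0 < normc h.[0].
  by apply: lt_le_trans h0; rewrite mulr_gt0// exprn_gt0.
have M0 : 0 < M by exact: lt_le_trans h0M.
set L := ln (M / normc p.[0]); pose Lh := ln (M / normc h.[0]).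
have lnD (x y : R) : 0 < x -> 0 < y -> ln (x / y) = ln x - ln y.
  by move=> x0 y0; rewrite ln_div// posrE.
have Lh0 : 0 <= Lh by rewrite ln_ge0// ler_pdivlMr// mul1r.
have LLh : (size near_)%:R * ln 2 + Lh <= L.
  rewrite /L /Lh !lnD// mulr_natl -lnXn//.
  have : ln (2 ^+ size near_ * normc p.[0]) <= ln (normc h.[0]).
    by rewrite ler_ln ?posrE// mulr_gt0// exprn_gt0.
  by rewrite lnM ?posrE ?exprn_gt0//; lra.
have ln20 : 0 <= ln 2 :> R by rewrite ln_ge0// ler1n.
have sz0 : 0 <= (size near_)%:R * ln 2 :> R by rewrite mulr_ge0.
have L0 : 0 <= L by move: LLh Lh0 sz0; lra.
have a0 a : a \in rs -> a != 0.
  move=> ars; apply: contraNneq p0 => a0.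
  have pa : p.[a] == 0 by rewrite E hornerZ mulf_eq0 -rootE root_prod_XsubC ars orbT.
  by rewrite a0 in pa.
have hroot z : h.[z] = h.[0] * root_prod far z.
  rewrite !hE /root_prod -[RHS]mulrA -big_split/=; congr (_ * _).
  apply: eq_big_seq => a af; have := a0 a; rewrite mem_filter in af.
  by case/andP: af => _ -> /(_ isT) an; field.
(* Radius [3 * r] fits both sides: the far zeros lie beyond [4 / 3 * (3 * r) = 4 * r], and
   [|h| <= M] holds up to [6 * r]. *)
have t0 : 0 < 3 * r by rewrite mulr_gt0.
have hs (a : R[i]) : a \in far -> 4 / 3 * (3 * r) <= normc a.
  by move=> /far_ge; rewrite mulrA divfK// => /ltW.
have HL z : normc z = 3 * r -> normc (root_prod far z) <= expR Lh.
  move=> zr; rewrite /Lh lnK ?posrE ?divr_gt0// ler_pdivlMr// mulrC -normcM -hroot.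
  by apply: hM'; rewrite zr; move: r0; lra.
exists near_; split.
- by move: LLh Lh0; rewrite -/L; lra.
- by [].
- exact: near_le.
- move=> z zr pz.
  have zrs : z \notin rs.
    by apply: contra pz; rewrite E hornerZ mulf_eq0 -root_prod_XsubC rootE => ->; rewrite orbT.
  have -> : p^`().[z] / p.[z] = \sum_(a <- rs) (z - a)^-1.
    apply: (mulIf pz); rewrite divfK// mulrC E derivZ !hornerZ deriv_prod_XsubC//.
    by rewrite mulrA.
  rewrite splitS (le_trans (le_normcD _ _))// lerD//.
    rewrite (le_trans (normc_sum _ _ _))//.
    by apply: ler_sum => a _; rewrite normcV.
  have zr' : normc z <= 3 * r / 2 by move: zr; lra.
  apply: le_trans (zero_free_log_deriv t0 hs HL zr') _.
  rewrite (_ : 8 * Lh / (3 * r) = 8 / 3 * Lh / r); last by field; rewrite gt_eqF.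
  rewrite ler_wpM2r ?invr_ge0 ?(ltW r0)// ler_wpM2l// -/L.
  by move: LLh sz0; lra.
- move=> z zr; case: ifPn => [|pz].
    rewrite E hornerZ mulf_eq0 => /orP[/eqP c0|].
      by move: p0; rewrite pE c0 !mul0r eqxx.
    rewrite -rootE root_prod_XsubC mem_filter => ->; rewrite andbT.
    by move: zr r0; lra.
  have pz0 : 0 < normc p.[z] by rewrite normc_gt0.
  have k0 : 0 < (8 * r) ^+ size near_ by rewrite exprn_gt0// mulr_gt0.
  have zrs : z \notin rs.
    by apply: contra pz; rewrite E hornerZ mulf_eq0 -root_prod_XsubC rootE => ->; rewrite orbT.
  have hz0 : 0 < normc h.[z].
    rewrite lt_def normc_ge0 andbT; apply/eqP => hz; have := hp z; rewrite hz mul0r.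
    by move=> /esym/eqP; rewrite mulf_eq0 !gt_eqF.
  have zr' : normc z <= 3 * r / 2 by move: zr; lra.
  have h1 := zero_free_lower t0 hs HL zr'.
  have rp0 : 0 < normc (root_prod far z).
    by move: hz0; rewrite hroot normcM pmulr_rgt0.
  have h2 : ln (normc h.[z]) = ln (normc h.[0]) + ln (normc (root_prod far z)).
    by rewrite hroot normcM lnM ?posrE.
  (* Passing from [p] to [h] multiplies by [8 * r / (z - a)] for each near zero, and [ln x <= x]
     turns the logarithm of each factor into the integrable kernel [1 / |z - a|]. *)
  have h3 : ln (normc h.[z]) - ln (normc p.[z]) <= 8 * r * \sum_(a <- near_) (normc (z - a))^-1.
    pose F (a : R[i]) := if a \in near_ then 8 * r / normc (z - a) else 1.
    have F0 a : 0 < F a.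
      rewrite /F; case: ifPn => // an; rewrite divr_gt0 ?mulr_gt0// normc_gt0 subr_eq0.
      by apply: contraNneq zrs => ->; move: an; rewrite mem_filter => /andP[].
    have -> : ln (normc h.[z]) - ln (normc p.[z]) = ln (\prod_(a <- near_) F a).
      have -> : \prod_(a <- near_) F a = (8 * r) ^+ size near_ / \prod_(a <- near_) normc (z - a).
        rewrite -prodk -prodf_div.
        by apply: eq_big_seq => a an; rewrite /F an.
      rewrite -lnD//; congr ln; have := hp z.
      set P := \prod_(a <- near_) normc (z - a) => hpz.
      have P0 : P != 0.
        apply/eqP => P0; move: hpz; rewrite P0 mulr0 => /esym/eqP.
        by rewrite mulf_eq0 !gt_eqF.
      apply: (mulIf P0); rewrite divfK// mulrAC hpz mulrAC mulfV ?mul1r//.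
      by rewrite gt_eqF.
    rewrite ln_prod// mulr_sumr !big_seq; apply: ler_sum => a an.
    by rewrite (le_trans (ln_le_id (F0 a)))// /F an.
  (* The 5 is one [Lh] from [ln (M / |h 0|)] and four from [zero_free_lower]. *)
  rewrite lnD//; rewrite h2 in h3; move: h1 h3 LLh sz0 L0 Lh0.
  rewrite /Lh -/L lnD//.
  by lra.
Qed.

End near_far.

(** * Integral bounds in the plane *)

Section integral_ext.
Context d (T : measurableType d) (R : realType) (mu : {measure set T -> \bar R}).
Local Open Scope ereal_scope.

(* The library's [ge0_le_integral] asks both functions to be measurable. *)
Lemma ge0_le_integral_dom (D : set T) (f g : T -> \bar R) :
  (forall x, D x -> 0 <= f x) -> (forall x, D x -> f x <= g x) ->
  \int[mu]_(x in D) f x <= \int[mu]_(x in D) g x.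
Proof.
move=> f0 fg; rewrite !ge0_integralE//; last first.
  by move=> x Dx; exact: le_trans (f0 x Dx) (fg x Dx).
apply: le_ereal_sup => _ [h hf <-]; exists h => // x.
apply: le_trans (hf x) _; rewrite /patch; case: ifPn => // /set_mem; exact: fg.
Qed.

Lemma le_limn_einf (u : nat -> \bar R) (x : \bar R) :
  (forall A : R, A%:E < x -> exists N, forall n, (N <= n)%N -> A%:E <= u n) ->
  x <= limn_einf u.
Proof.
move=> h; rewrite limn_einf_lim (cvg_lim _ (@cvg_einfs_sup _ u))//.
have H (A : R) : A%:E < x -> A%:E <= ereal_sup (range (einfs u)).
  move=> /h[N hN]; apply: (@le_trans _ _ (einfs u N)); last first.
    by apply: ereal_sup_ubound; exists N.
  by apply: le_ereal_inf_tmp => _ [k /= Nk <-]; exact: hN.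
rewrite leNgt; apply/negP; move: H; set y := ereal_sup _.
case: y => [y| |]; case: x {h} => [x| |]//= H.
- rewrite lte_fin => yx; have h : ((x + y) / 2 < x)%R by lra.
  by have := H ((x + y) / 2)%R; rewrite lte_fin lee_fin => /(_ h); lra.
- by move=> _; have := H (y + 1)%R (ltry _); rewrite lee_fin; lra.
- have h : (x - 1 < x)%R by lra.
  by move=> _; have := H (x - 1)%R; rewrite lte_fin leeNy_eq => /(_ h).
- by move=> _; have := H 0%R (ltry _).
Qed.

Lemma limn_einf_le (u : nat -> \bar R) (x : \bar R) :
  (forall n, u n <= x) -> limn_einf u <= x.
Proof.
move=> h; rewrite limn_einf_lim (cvg_lim _ (@cvg_einfs_sup _ u))//.
apply: ge_ereal_sup => _ [n _ <-]; apply: le_trans (h n).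
by apply: ereal_inf_lbound; exists n => //=.
Qed.

(** Fatou's lemma for a target [f] that may be non-measurable. The lower limit is expressed by real
    thresholds [A], so points where [f] is +oo need no separate form. *)
Lemma fatou_bound (D : set T) (f : T -> \bar R) (u : (T -> \bar R)^nat) (K : \bar R) :
  measurable D -> (forall n, measurable_fun D (u n)) ->
  (forall n x, D x -> 0 <= u n x) -> (forall x, D x -> 0 <= f x) ->
  (forall x (A : R), D x -> A%:E < f x -> exists N, forall n, (N <= n)%N -> A%:E <= u n x) ->
  (forall n, \int[mu]_(x in D) u n x <= K) -> \int[mu]_(x in D) f x <= K.
Proof.
move=> mD mu_ u0 f0 fu uK.
apply: (@le_trans _ _ (\int[mu]_(x in D) limn_einf (u^~ x))).
  by apply: ge0_le_integral_dom => // x Dx; apply: le_limn_einf => A; exact: fu.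
by apply: le_trans (fatou mu mD mu_ u0) _; exact: limn_einf_le.
Qed.

End integral_ext.

Section near_integral.
Context {R : realType}.
Notation T := (measurableTypeR R).
Notation leb := (@lebesgue_measure R).

(* Unlike the field inverse, infinite at [0]; this makes the bounds below hold at
   the zeros of the polynomials as well. *)
Definition einv (x : R) : \bar R := if x == 0 then +oo%E else (x^-1)%:E.

Lemma einv_ge0 x : 0 <= x -> (0 <= einv x)%E.
Proof. by move=> x0; rewrite /einv; case: eqVneq => // _; rewrite lee_fin invr_ge0. Qed.

(* [g c1 e x * g c2 e y] dominates [1 / (|w| + e)] for
   [w = (x - c1) + i (y - c2)], and [G] is an explicit function whose derivative
   is at least [g / 2]. *)
Let N (c e x : R) : R := (x - c) ^+ 2 + e ^+ 2.
Let g (c e x : R) : R := N c e x `^ (- 4^-1).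
Let G (c e x : R) : R := (x - c) * N c e x `^ (- 4^-1).

Let N_gt0 (c e x : R) : 0 < e -> 0 < N c e x.
Proof. by move=> e0; rewrite /N ltr_wpDl ?sqr_ge0// exprn_gt0. Qed.

Let derive_N (c e x : R) : is_derive x 1 (N c e) (2 * (x - c)).
Proof.
have d1 : is_derive x 1 (fun x : R => x - c) 1.
  by apply: is_derive_eq; rewrite subr0.
apply: (is_derive_eq (is_deriveD (is_deriveX 2 d1) (is_derive_cst (e ^+ 2) x 1))).
by rewrite /GRing.scale/= addr0 mulr1 expr1.
Qed.

Let derive_g (c e x : R) : 0 < e -> is_derive x 1 (g c e) (- 4^-1 * N c e x `^ (- 4^-1 - 1) * (2 * (x - c))).
Proof.
move=> e0; have := is_derive1_comp (is_derive1_powR (- 4^-1) (N_gt0 c x e0)) (derive_N c e x).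
by [].
Qed.

Let continuous_g (c e : R) : 0 < e -> continuous (g c e).
Proof.
move=> e0 x; apply: differentiable_continuous; apply/derivable1_diffP.
exact: (@ex_derive _ _ _ _ _ _ _ (derive_g c x e0)).
Qed.

Let derive_G (c e x : R) : 0 < e -> is_derive x 1 (G c e)
  (g c e x + (x - c) * (- 4^-1 * N c e x `^ (- 4^-1 - 1) * (2 * (x - c)))).
Proof.
move=> e0; have d1 : is_derive x 1 (fun x : R => x - c) 1.
  by apply: is_derive_eq; rewrite subr0.
apply: (is_derive_eq (is_deriveM d1 (derive_g c x e0))).
by rewrite /GRing.scale/= mulr1 addrC.
Qed.

(** From [g <= 2 G'], the integral is at most twice the increment of [G], and
    [|G| <= N^(1/4) <= (6 * r)^(1/2)] on the interval. The bound does not depend on [e], which can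
    therefore tend to 0. *)
Let g_int (c e r : R) : 0 < e -> e <= r -> `|c| <= 4 * r ->
  \int[leb]_(x in `[(- r)%R, r]) g c e x <= 4 * (6 * r) `^ 2^-1.
Proof.
move=> e0 er cr; have r0 : 0 < r by exact: lt_le_trans er.
pose dG x := g c e x + (x - c) * (- 4^-1 * N c e x `^ (- 4^-1 - 1) * (2 * (x - c))).
have lin : continuous (fun x : R => x - c).
  by move=> x; apply: cvgB; [exact: cvg_id|exact: cvg_cst].
have cN : continuous (fun x : R => N c e x `^ (- 4^-1 - 1)).
  move=> x; apply: differentiable_continuous; apply/derivable1_diffP.
  have := is_derive1_comp (is_derive1_powR (- 4^-1 - 1) (N_gt0 c x e0)) (derive_N c e x).
  by move=> h; exact: (@ex_derive _ _ _ _ _ _ _ h).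
have cdG : continuous dG.
  move=> x; apply: cvgD; first exact: continuous_g.
  apply: cvgM; first exact: lin.
  apply: cvgM; first by apply: cvgM; [exact: cvg_cst|exact: cN].
  by apply: cvgM; [exact: cvg_cst|exact: lin].
have rr : - r <= r by lra.
have gdG x : g c e x <= 2 * dG x.
  have N0 := N_gt0 c x e0; have g0 : 0 <= g c e x by exact: powR_ge0.
  rewrite /dG powRD; last by rewrite (gt_eqF N0) implybT.
  rewrite powR_inv1 ?(ltW N0)// -/(g c e x).
  have uN : (x - c) ^+ 2 / N c e x <= 1.
    by rewrite ler_pdivrMr// mul1r /N lerDl sqr_ge0.
  have -> : 2 * (g c e x + (x - c) * (- 4^-1 * (g c e x / N c e x) * (2 * (x - c)))) =
      2 * g c e x - g c e x * ((x - c) ^+ 2 / N c e x) by field; rewrite gt_eqF.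
  by have := ler_wpM2l g0 uN; rewrite mulr1; lra.
have G_le x : `|x| <= r -> `|G c e x| <= (6 * r) `^ 2^-1.
  move=> xr; have N0 := N_gt0 c x e0.
  have xN : `|x - c| <= N c e x `^ 2^-1.
    rewrite powR12_sqrt ?(ltW N0)// -sqrtr_sqr ler_wsqrtr// /N lerDl sqr_ge0//.
  rewrite /G normrM [X in _ * X]ger0_norm ?powR_ge0//.
  apply: (@le_trans _ _ (N c e x `^ 2^-1 * N c e x `^ (- 4^-1))).
    by rewrite ler_wpM2r ?powR_ge0.
  rewrite -powRD; last by rewrite (gt_eqF N0) implybT.
  rewrite (_ : 2^-1 - 4^-1 = 2%:R * 8^-1 :> R); last by field.
  (* [|x - c| <= 5 * r] and [e <= r] give [26 * r ^+ 2], rounded up to a square. *)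
  have N6 : N c e x <= (6 * r) ^+ 2.
    have h : `|x - c| <= 5 * r by rewrite (le_trans (ler_normB _ _))//; lra.
    have : (x - c) ^+ 2 <= (5 * r) ^+ 2.
      by rewrite -[X in X <= _]real_normK ?num_real// lerXn2r ?nnegrE// mulr_ge0// ltW.
    have : e ^+ 2 <= r ^+ 2 by rewrite lerXn2r ?nnegrE// ltW.
    have : 0 <= r * r by rewrite mulr_ge0// ltW.
    by rewrite /N !expr2; lra.
  apply: (@le_trans _ _ (((6 * r) ^+ 2) `^ (2%:R * 8^-1))).
    apply: ge0_ler_powR => //; rewrite ?nnegrE ?(ltW N0) ?sqr_ge0//.
  rewrite -powR_mulrn ?mulr_ge0 ?(ltW r0)// -powRrM.
  by rewrite (_ : 2%:R * (2%:R * 8^-1) = 2^-1 :> R)//; field.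
apply: (@le_trans _ _ (\int[leb]_(x in `[(- r)%R, r]) (2 * dG x))).
  apply: le_Rintegral => //.
  - exact/continuous_segment_integrable/continuous_g.
  - apply: continuous_segment_integrable => x.
    by apply: cvgM; [exact: cvg_cst|exact: cdG].
rewrite RintegralZl//; last exact: continuous_segment_integrable.
rewrite (Rintegral_derive rr cdG (fun x => derive_G c x e0)).
have := G_le r; have := G_le (- r); rewrite normrN ger0_norm ?(ltW r0)//.
move=> /(_ (lexx _)) + /(_ (lexx _)); rewrite !ler_norml => /andP[h1 h2] /andP[h3 h4].
by lra.
Qed.

Definition planar : {measure set (T * T) -> \bar R} := (leb \x leb)%E.
Definition pt (z : T * T) : R[i] := ((z.1 : R) +i* (z.2 : R))%C.
Definition square (r : R) : set (T * T) := `[(- r)%R, r]%classic `*` `[(- r)%R, r]%classic.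

Lemma measurable_square r : measurable (square r).
Proof. by apply: measurableX. Qed.

Lemma planar_square r : 0 <= r -> planar (square r) = ((2 * r) ^+ 2)%:E.
Proof.
move=> r0; rewrite /planar /square/= product_measure1E//= lebesgue_measure_itv/= lte_fin.
case: ifPn => [_|]; first by rewrite -EFinM opprK; congr EFin; ring.
by rewrite -leNgt => h; rewrite mul0e (_ : r = 0) ?mulr0 ?expr0n//; lra.
Qed.

Let g_pos (c e x : R) : 0 < e -> 0 < g c e x.
Proof. by move=> e0; rewrite powR_gt0// N_gt0. Qed.

(** Half of the singularity goes to each coordinate: both [N] are at most [s ^+ 2], so each [g] is
    at least [s^(-1/2)]. The radial kernel becomes a product that integrates one variable at a
    time. *)
Let inv_le_g (w : R[i]) (c1 c2 x y e : R) : 0 < e ->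
  (normc ((x +i* y)%C - (c1 +i* c2)%C) + e)^-1 <= g c1 e x * g c2 e y.
Proof.
move=> e0; set s := normc _ + e; have n0 : (0 : R) <= normc ((x +i* y)%C - (c1 +i* c2)%C) := normc_ge0 _.
have s0 : 0 < s by rewrite /s; lra.
have half c t : (t - c) ^+ 2 <= normc ((x +i* y)%C - (c1 +i* c2)%C) ^+ 2 -> (s `^ 2^-1)^-1 <= g c e t.
  move=> h; rewrite /g powRN lef_pV2 ?posrE ?powR_gt0 ?N_gt0//.
  have : N c e t <= s ^+ 2.
    by rewrite /N /s sqrrD; have := mulr_ge0 n0 (ltW e0); rewrite mulr2n; move: h; lra.
  move=> hN; apply: (@le_trans _ _ ((s ^+ 2) `^ 4^-1)).
    by apply: ge0_ler_powR => //; rewrite ?nnegrE ?sqr_ge0// ltW// N_gt0.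
  rewrite -powR_mulrn ?(ltW s0)// -powRrM.
  by rewrite (_ : 2%:R * 4^-1 = 2^-1 :> R)//; field.
have -> : s^-1 = (s `^ 2^-1)^-1 * (s `^ 2^-1)^-1.
  rewrite -invfM -powRD; last by rewrite (gt_eqF s0) implybT.
  by rewrite (_ : 2^-1 + 2^-1 = 1 :> R) ?powRr1 ?(ltW s0)//; field.
apply: ler_pM; rewrite ?invr_ge0 ?powR_ge0//; apply: half; rewrite sqr_normc_def/=.
  by rewrite lerDl sqr_ge0.
by rewrite lerDr sqr_ge0.
Qed.

Lemma measurable_normc_sub (a : R[i]) :
  measurable_fun [set: T * T] (fun z : T * T => normc (pt z - a)).
Proof.
case: a => c1 c2 /=.
apply: (@measurableT_comp _ _ _ _ _ _ (@Num.sqrt R)).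
  exact: (continuous_measurable_fun (@sqrt_continuous R)).
apply: measurable_funD; apply: measurable_funX; apply: measurable_funB => //.
Qed.

Lemma measurable_inv_ge0 d (U : measurableType d) (f : U -> R) :
  measurable_fun setT f -> (forall x, 0 <= f x) -> measurable_fun setT (fun x => (f x)^-1).
Proof.
move=> mf f0; under eq_fun do rewrite -powR_inv1//.
exact: (measurableT_comp (measurable_powR (-1)) mf).
Qed.

Lemma measurable_einv d (U : measurableType d) (f : U -> R) :
  measurable_fun setT f -> (forall x, 0 <= f x) ->
  measurable_fun setT (fun x => einv (f x)).
Proof.
move=> mf f0; rewrite /einv; apply: measurable_fun_ifT => //.
- exact: measurable_fun_eqr.
- exact/measurable_EFinP/measurable_inv_ge0.
Qed.

(** The kernel is regularized by [e n], tending to 0, and Fatou's lemma removes it. The constant is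
    the square of the one-dimensional bound, [(4 * sqrt (6 * r))^2 = 96 * r]. *)
Theorem near_integral r (a : R[i]) : 0 < r -> normc a <= 4 * r ->
  (\int[planar]_(z in square r) einv (normc (pt z - a)%R) <= (96 * r)%:E)%E.
Proof.
move=> r0 ar; have mS := measurable_square r.
pose e n : R := r / n.+1%:R.
have e0 n : 0 < e n by rewrite divr_gt0.
have er n : e n <= r by rewrite ler_pdivrMr// ler_peMr ?(ltW r0)// ler1n.
pose u n (z : T * T) := ((normc (pt z - a) + e n)^-1)%:E.
apply: (@fatou_bound _ _ _ planar _ _ u) => //.
- move=> n; apply: measurable_funTS; apply/measurable_EFinP.
  apply: measurable_inv_ge0; last by move=> z; rewrite addr_ge0 ?normc_ge0// ltW.
  by apply: measurable_funD => //; exact: measurable_normc_sub.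
- move=> n z _; rewrite lee_fin invr_ge0 addr_ge0 ?normc_ge0// ltW//.
- by move=> z _; rewrite einv_ge0// normc_ge0.
- move=> z A _; set w := normc _ => hA.
  have w0 : (0 : R) <= w by exact: normc_ge0.
  have [A0|A0] := leP A 0.
    exists 0%N => n _; rewrite lee_fin (le_trans A0)// invr_ge0 addr_ge0// ltW//.
  have wA : w < A^-1.
    move: hA; rewrite /einv; case: eqVneq => [->|wn]; first by rewrite invr_gt0.
    have wp : 0 < w by rewrite lt_def wn.
    by rewrite lte_fin => h; rewrite -[w]invrK ltf_pV2 ?posrE ?invr_gt0.
  have d0 : 0 < A^-1 - w by rewrite subr_gt0.
  exists (Num.truncn (r / (A^-1 - w))) => n Nn; rewrite lee_fin.
  have en : e n <= A^-1 - w.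
    rewrite /e ler_pdivrMr// mulrC -ler_pdivrMr// ltW// (lt_le_trans (truncnS_gt _))//.
    by rewrite ler_nat ltnS.
  rewrite -[leLHS]invrK lef_pV2 ?posrE ?invr_gt0//.
    by rewrite -/w; move: en; lra.
  by rewrite -/w ltr_wpDl.
move=> n; case: a ar @u => c1 c2 ar u.
pose D : set T := `[(- r)%R, r]%classic.
pose F (c x : R) := ((g c (e n) \_ D) x)%:E.
have mD : measurable (D : set T) by exact: measurable_itv.
have mg c : measurable_fun [set: T] (g c (e n) : T -> T).
  exact: (@continuous_measurable_fun R _ (@continuous_g c _ (e0 n))).
have mF c : measurable_fun [set: T] (F c : T -> \bar R).
  apply/measurable_EFinP.
  exact: ((@measurable_restrictT _ _ T T D _ mD).1 (measurable_funTS (mg c))).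
have F0 c x : (0 <= F c x)%E.
  by rewrite lee_fin /patch; case: ifP => // _; rewrite ltW// g_pos.
have IF c : `|c| <= 4 * r -> (\int[leb]_x F c x <= (4 * (6 * r) `^ 2^-1)%:E)%E.
  move=> cr; have ig := @continuous_segment_integrable _ (- r) r _ (@continuous_g c _ (e0 n)).
  have -> : (\int[leb]_x F c x = \int[leb]_(x in D) (g c (e n) x)%:E)%E.
    by rewrite [RHS]integral_mkcond; apply: eq_integral => x _; rewrite /F restrict_EFin.
  rewrite -[leLHS]fineK ?lee_fin; first exact: g_int.
  exact: integrable_fin_num.
apply: (@le_trans _ _ (\int[planar]_z (F c1 z.1 * F c2 z.2))%E).
  rewrite integral_mkcond; apply: ge0_le_integral_dom => z _.
    by rewrite /patch; case: ifP => // _; rewrite lee_fin invr_ge0 addr_ge0 ?normc_ge0// ltW.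
  rewrite {1}/patch; case: ifPn => [/set_mem[z1 z2]|_]; last by rewrite mule_ge0.
  rewrite /F /patch !mem_set// -EFinM lee_fin.
  exact: inv_le_g.
rewrite fubini_tonelli1//; last 2 first.
- apply: emeasurable_funM.
    exact: (measurableT_comp (mF c1) measurable_fst).
  exact: (measurableT_comp (mF c2) measurable_snd).
- by move=> z; rewrite mule_ge0.
rewrite /fubini_F/=.
under eq_integral do rewrite ge0_integralZl//.
have c1r : `|c1| <= 4 * r by rewrite (le_trans (normr_Re (c1 +i* c2)%C)).
have c2r : `|c2| <= 4 * r by rewrite (le_trans (normr_Im (c1 +i* c2)%C)).
rewrite ge0_integralZr//; last by apply: integral_ge0.
apply: (@le_trans _ _ ((4 * (6 * r) `^ 2^-1)%:E * (4 * (6 * r) `^ 2^-1)%:E)%E).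
  by apply: lee_pmul; rewrite ?integral_ge0 ?IF.
rewrite -EFinM lee_fin mulrACA -powRD; last by rewrite gt_eqF ?implybT// mulr_gt0.
rewrite (_ : 2^-1 + 2^-1 = 1 :> R); last by field.
rewrite powRr1; last by rewrite mulr_ge0// ltW.
by lra.
Qed.

End near_integral.

(** * The two integral bounds for entire functions of one variable *)

Section planar_bounds.
Context {R : realType}.
Notation T := (measurableTypeR R).
Implicit Types (f : R[i] -> R[i]) (w : R[i]) (ns : seq R[i]).

(** The value +oo at 0 makes a bound by [elog M' (f 0)] trivially true when the centre is a zero. *)
Definition elog (M : R) w : \bar R := if w == 0 then +oo%E else (ln (M / normc w))%:E.

Lemma einv_le (x : R) : ((x^-1)%:E <= einv x)%E.
Proof. by rewrite /einv; case: eqVneq => [_|//]; rewrite leey. Qed.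

Definition near_sum ns w : \bar R := (\sum_(a <- ns) einv (normc (w - a)%R))%E.

Lemma near_sum_ge0 ns w : (0 <= near_sum ns w)%E.
Proof. by apply: sume_ge0 => a _; rewrite einv_ge0// normc_ge0. Qed.

Lemma near_sum_le ns w : ((\sum_(a <- ns) (normc (w - a))^-1)%:E <= near_sum ns w)%E.
Proof. by rewrite -sumEFin; apply: lee_sum => a _; exact: einv_le. Qed.

Lemma near_sum_mem ns w : w \in ns -> near_sum ns w = +oo%E.
Proof.
move=> wns; rewrite /near_sum (big_rem w)//= /einv subrr normc0 eqxx.
rewrite addye//; apply/eqP => h.
have : (0 <= \sum_(y <- rem w ns) einv (normc (w - y)%R))%E.
  by apply: sume_ge0 => a _; rewrite einv_ge0// normc_ge0.
by rewrite h.
Qed.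

Lemma measurable_near_sum ns : measurable_fun [set: T * T] (fun z => near_sum ns (pt z)).
Proof.
rewrite /near_sum; apply: emeasurable_sum => a.
by apply: measurable_einv => [|z]; [exact: measurable_normc_sub|exact: normc_ge0].
Qed.

Lemma near_sum_integral r ns (k0 k1 : R) : 0 < r -> (forall a, a \in ns -> normc a <= 4 * r) ->
  0 <= k0 -> 0 <= k1 ->
  (\int[planar]_(z in square r) (k0%:E + k1%:E * near_sum ns (pt z)) <=
    (k0 * (4 * r ^+ 2) + k1 * ((size ns)%:R * (96 * r)))%:E)%E.
Proof.
move=> r0 nsr k00 k10; have mS := @measurable_square R r.
have mn : measurable_fun (square r) (fun z : T * T => near_sum ns (pt z)).
  by apply: measurable_funTS; exact: measurable_near_sum.
rewrite ge0_integralD//=; last 2 first.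
- by move=> z _; rewrite mule_ge0 ?lee_fin// near_sum_ge0.
- exact: measurable_funeM.
rewrite integral_cst//= [X in (_ * X)%E](planar_square (ltW r0)) -EFinM EFinD.
apply: leeD; first by rewrite lee_fin exprMn; lra.
rewrite ge0_integralZl//; last by move=> z _; exact: near_sum_ge0.
rewrite EFinM lee_wpmul2l ?lee_fin// /near_sum ge0_integral_sum//; last 2 first.
- move=> a; apply: measurable_funTS; apply: measurable_einv => [|z]; [exact: measurable_normc_sub|exact: normc_ge0].
- by move=> a z _; rewrite einv_ge0// normc_ge0.
apply: (@le_trans _ _ (\sum_(a <- ns) (96 * r)%:E)%E).
  by rewrite !big_seq; apply: lee_sum => a /nsr; exact: near_integral.
by rewrite sumEFin lee_fin big_const_seq count_predT iter_addr addr0 -[leLHS]mulr_natl.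
Qed.

Lemma square_normc r (z : T * T) : 0 < r -> square r z -> normc (pt z) <= 3 / 2 * r.
Proof.
move=> r0 [h1 h2]; rewrite /= in_itv/= -ler_norml in h1; rewrite /= in_itv/= -ler_norml in h2.
have r32 : 0 <= 3 / 2 * r by rewrite mulr_ge0 ?ltW.
rewrite -ler_sqr ?nnegrE ?normc_ge0// sqr_normc_def /pt/=.
have sq (x : R) : `|x| <= r -> x ^+ 2 <= r ^+ 2.
  by move=> xr; rewrite -[X in X <= _]real_normK ?num_real// lerXn2r ?nnegrE// ltW.
have := sq _ h1; have := sq _ h2; rewrite exprMn; have := sqr_ge0 r.
by move: (r ^+ 2) => u; lra.
Qed.

Section entire.
Variables (f : R[i] -> R[i]) (r M M' : R).
Hypothesis r0 : 0 < r.
Hypothesis df : forall w, exists D, cderiv f w D.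
Hypothesis fM : forall z, normc z <= 12 * r -> normc (f z) <= M.
Hypothesis MM' : M < M'.

Let approx : f 0 != 0 -> exists p : nat -> {poly R[i]}, exists ns : nat -> seq R[i],
  [/\ forall n a, a \in ns n -> normc a <= 4 * r,
      0 <= ln (M' / normc (f 0)),
      forall n, (size (ns n))%:R * ln 2 <= ln (M' / normc (f 0)),
      forall z e, normc z <= 3 / 2 * r -> 0 < e ->
        exists N, forall n, (N <= n)%N -> normc (f z - (p n).[z]) <= e &
      [/\ forall z D, normc z <= 3 / 2 * r -> cderiv f z D -> forall e, 0 < e ->
        exists N, forall n, (N <= n)%N -> normc ((p n)^`().[z] - D) <= e,
       forall n z, normc z <= 3 / 2 * r -> (p n).[z] != 0 ->
       normc ((p n)^`().[z] / (p n).[z]) <=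
         \sum_(a <- ns n) (normc (z - a))^-1 + 8 / 3 * ln (M' / normc (f 0)) / r &
       forall n z, normc z <= 3 / 2 * r -> if (p n).[z] == 0 then z \in ns n else
       ln (M' / normc (p n).[z]) <=
         5 * ln (M' / normc (f 0)) + 8 * r * \sum_(a <- ns n) (normc (z - a))^-1]].
Proof.
(* The approximation is uniform on half of [24 * r], the circle of radius [12 * r] included, and
   derivatives converge on an eighth of it, [3 * r], beyond the [3 / 2 * r] needed. *)
move=> f0; have r24 : 0 < 24 * r by rewrite mulr_gt0.
have [p [K K0 [p0 fp dfp]]] := poly_approx r24 df.
have d0 : 0 < M' - M by rewrite subr_gt0.
have small e : 0 < e -> exists n0, forall n, (n0 <= n)%N -> K / 2 ^+ n <= e.
  move=> e0; exists (Num.truncn (K / e)).+1 => n n0n.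
  rewrite ler_pdivrMr ?exprn_gt0// mulrC -ler_pdivrMr// ltW//.
  rewrite (lt_le_trans (truncnS_gt _))// -natrX ler_nat (leq_trans n0n)// ltnW//.
  exact: ltn_expl.
have [n0 hn0] := small _ d0.
(* The first indices are dropped: from [n0] on the error is at most [M' - M], so every [q n] is
   bounded by [M'] on the circle. *)
pose q n := p (n + n0)%N.
have qM n z : normc z = 12 * r -> normc (q n).[z] <= M'.
  move=> zr; have z1 : normc z <= 12 * r by rewrite zr.
  have z2 : normc z <= 24 * r / 2 by move: z1; lra.
  have := fp z (n + n0)%N z2; have := hn0 (n + n0)%N (leq_addl _ _); have := fM z1.
  move=> h1 h2 h3; rewrite -(subKr (f z) (q n).[z]).
  by rewrite (le_trans (le_normcB _ _))//; move: h1 h2 h3; rewrite /q; lra.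
have q0 n : (q n).[0] = f 0 by exact: p0.
have H n : exists s : seq R[i], [/\ (size s)%:R * ln 2 <= ln (M' / normc (f 0)),
     0 <= ln (M' / normc (f 0)),
     forall a, a \in s -> normc a <= 4 * r,
     forall z, normc z <= 3 / 2 * r -> (q n).[z] != 0 ->
       normc ((q n)^`().[z] / (q n).[z]) <=
         \sum_(a <- s) (normc (z - a))^-1 + 8 / 3 * ln (M' / normc (f 0)) / r &
     forall z, normc z <= 3 / 2 * r -> if (q n).[z] == 0 then z \in s else
       ln (M' / normc (q n).[z]) <=
         5 * ln (M' / normc (f 0)) + 8 * r * \sum_(a <- s) (normc (z - a))^-1].
  by rewrite -(q0 n); apply: poly_near_far => //; rewrite ?q0//; exact: qM.
have [ns hns] := choice H; exists q, ns; split.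
- by move=> n; case: (hns n).
- by case: (hns 0%N).
- by move=> n; case: (hns n).
- move=> z e zr /small[N hN]; exists N => n Nn.
  have z2 : normc z <= 24 * r / 2 by move: zr r0; lra.
  by apply: le_trans (fp z _ z2) _; apply: hN; rewrite (leq_trans Nn)// leq_addr.
- split.
  + move=> z D zr zD e e0.
    have z3 : normc z <= 24 * r / 8 by move: zr r0; lra.
    have [N hN] := dfp z D z3 zD e e0; exists N => n Nn.
    by apply: hN; rewrite (leq_trans Nn)// leq_addr.
  + by move=> n; case: (hns n).
  + by move=> n; case: (hns n).
Qed.

Let M'0 : 0 < M'.
Proof.
apply: le_lt_trans MM'; apply: le_trans (normc_ge0 (f 0)) _.
by apply: fM; rewrite normc0 mulr_ge0// ltW.
Qed.

Let ln20 : 0 < ln 2 :> R.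
Proof. by rewrite ln_gt0// ltr1n. Qed.

Lemma elog_ge0 w : normc w <= M' -> (0 <= elog M' w)%E.
Proof.
move=> wM; rewrite /elog; case: eqVneq => // w0.
by rewrite lee_fin ln_ge0// ler_pdivlMr ?mul1r// normc_gt0.
Qed.

(** The constant term contributes [8 / 3 * 4 = 32 / 3 <= 11] times [r]; each of the at most
    [L / ln 2] near zeros contributes [96 * r]. *)
Theorem log_deriv_integral (D : R[i] -> R[i]) : (forall z, cderiv f z (D z)) ->
  (\int[planar]_(z in square r) (normc (D (pt z) / f (pt z))%R)%:E <=
    ((11 + 96 / ln 2) * r)%:E * elog M' (f 0%R))%E.
Proof.
move=> dD; have c0 : 0 < 11 + 96 / ln 2 :> R by rewrite addr_gt0// divr_gt0.
rewrite /elog; case: eqVneq => [_|f0]; first by rewrite gt0_muley ?leey// lte_fin mulr_gt0.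
have [p [ns [nsr L0 sL pf [dpf hA hB]]]] := approx f0; set L := ln _ in L0 sL hA hB *.
have k0 : 0 <= 8 / 3 * L / r by rewrite divr_ge0 ?mulr_ge0// ltW.
apply: (@fatou_bound _ _ _ planar _ _
  (fun n z => (8 / 3 * L / r)%:E + 1%:E * near_sum (ns n) (pt z))%E).
- exact: measurable_square.
- move=> n; apply: measurable_funTS; apply: emeasurable_funD => //.
  by apply: measurable_funeM; exact: measurable_near_sum.
- by move=> n z _; rewrite adde_ge0 ?lee_fin// mule_ge0 ?lee_fin// near_sum_ge0.
- by move=> z _; rewrite lee_fin normc_ge0.
- move=> z A /(square_normc r0); set w := pt z => wr; rewrite lte_fin => hA'.
  have [A0|A0] := ltP A 0.
    exists 0%N => n _; apply: (@le_trans _ _ 0%E); first by rewrite lee_fin ltW.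
    by rewrite adde_ge0 ?lee_fin// mule_ge0 ?lee_fin// near_sum_ge0.
  have fw : f w != 0.
    by apply/eqP => fw; move: hA'; rewrite fw invr0 mulr0 normc0; rewrite ltNge A0.
  set x := normc (D w); set y := normc (f w).
  have y0 : (0 : R) < y by rewrite normc_gt0.
  have xy : A * y < x by move: hA'; rewrite normcM normcV ltr_pdivlMr.
  (* The second entry ensures [A * (y + e) <= x - e], so the quotient for [p n] stays at least [A];
     the first keeps [(p n).[w]] away from 0. *)
  pose e := Num.min (y / 2) ((x - A * y) / (1 + A)).
  have e0 : 0 < e by rewrite /e lt_min !divr_gt0// ?subr_gt0//; lra.
  have ey : e <= y / 2 by rewrite /e ge_min lexx.
  have eA : e * (1 + A) <= x - A * y.
    by rewrite -ler_pdivlMr; [rewrite /e ge_min lexx orbT|lra].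
  have [N1 h1] := pf w e wr e0; have [N2 h2] := dpf w (D w) wr (dD w) e e0.
  exists (maxn N1 N2) => n; rewrite geq_max => /andP[n1 n2].
  have {}h1 := h1 n n1; have {}h2 := h2 n n2.
  have py : normc (p n).[w] <= y + e.
    rewrite -(subKr (f w) (p n).[w]) (le_trans (le_normcB _ _))// lerD2l//.
  have py' : y - e <= normc (p n).[w].
    have := lerB_normc (f w) (f w - (p n).[w]); rewrite subKr => h.
    by apply: le_trans h; rewrite lerD2l lerN2.
  have p0 : 0 < normc (p n).[w] by apply: lt_le_trans py'; move: y0 ey e0; lra.
  have pn0 : (p n).[w] != 0 by rewrite -normc_gt0.
  have px : x - e <= normc (p n)^`().[w].
    have := lerB_normc (D w) (D w - (p n)^`().[w]); rewrite subKr => h.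
    by apply: le_trans h; rewrite lerD2l lerN2 normc_distC.
  apply: (@le_trans _ _ (normc ((p n)^`().[w] / (p n).[w]))%:E).
    rewrite lee_fin normcM normcV ler_pdivlMr//.
    apply: (@le_trans _ _ (A * (y + e))); first by rewrite ler_wpM2l.
    by apply: le_trans px; move: eA; lra.
  have := hA n w wr pn0; rewrite -lee_fin => /le_trans; apply.
  by rewrite addrC EFinD mul1e leeD2l// near_sum_le.
- move=> n; apply: le_trans (near_sum_integral r0 (nsr n) k0 ler01) _.
  rewrite -EFinM lee_fin mul1r.
  have : (size (ns n))%:R <= L / ln 2 by rewrite ler_pdivlMr.
  move=> /(ler_wpM2r (ltW r0)) h.
  have -> : 8 / 3 * L / r * (4 * r ^+ 2) = 32 / 3 * (L * r) by field; rewrite gt_eqF.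
  have -> : (11 + 96 / ln 2) * r * L = 11 * (L * r) + 96 * (L / ln 2 * r).
    by field; rewrite gt_eqF.
  have : 0 <= L * r by rewrite mulr_ge0// ltW.
  by move: h; lra.
Qed.

Theorem elog_integral :
  (\int[planar]_(z in square r) elog M' (f (pt z)) <=
    ((20 + 8 * (96 / ln 2)) * r ^+ 2)%:E * elog M' (f 0%R))%E.
Proof.
have c0 : 0 < 20 + 8 * (96 / ln 2) :> R by rewrite addr_gt0// mulr_gt0// divr_gt0.
have r2 : 0 < r ^+ 2 by rewrite exprn_gt0.
rewrite [elog M' (f 0)]/elog; case: eqVneq => [_|f0].
  by rewrite gt0_muley ?leey// lte_fin mulr_gt0.
have [p [ns [nsr L0 sL pf [dpf hA hB]]]] := approx f0; set L := ln _ in L0 sL hA hB *.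
have k0 : 0 <= 5 * L by rewrite mulr_ge0.
have k1 : 0 <= 8 * r by rewrite mulr_ge0// ltW.
apply: (@fatou_bound _ _ _ planar _ _
  (fun n z => (5 * L)%:E + (8 * r)%:E * near_sum (ns n) (pt z))%E).
- exact: measurable_square.
- move=> n; apply: measurable_funTS; apply: emeasurable_funD => //.
  by apply: measurable_funeM; exact: measurable_near_sum.
- by move=> n z _; rewrite adde_ge0 ?lee_fin// mule_ge0 ?lee_fin// near_sum_ge0.
- move=> z /(square_normc r0) zr; rewrite elog_ge0// (le_trans _ (ltW MM'))// fM//.
  by move: zr r0; lra.
- move=> z A /(square_normc r0); set w := pt z => wr hA'.
  (* The modulus at which [ln (M' / B) = A]: the threshold condition becomes [|f w| < B], which also
     covers [f w = 0]. *)
  pose B := M' * expR (- A).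
  have B0 : 0 < B by rewrite mulr_gt0// expR_gt0.
  have fB : normc (f w) < B.
    move: hA'; rewrite /elog; case: eqVneq => [->|fw]; first by rewrite normc0.
    have fw0 : 0 < normc (f w) by rewrite normc_gt0.
    rewrite lte_fin -ltr_expR lnK ?posrE ?divr_gt0// ltr_pdivlMr// => h.
    by rewrite /B expRN ltr_pdivlMr ?expR_gt0// mulrC.
  have d0 : 0 < B - normc (f w) by rewrite subr_gt0.
  have [N h] := pf w _ wr d0; exists N => n Nn; have {}h := h n Nn.
  have pB : normc (p n).[w] <= B.
    by rewrite -(subKr (f w) (p n).[w]) (le_trans (le_normcB _ _))//; move: h; lra.
  have := hB n w wr; case: eqVneq => [_ /near_sum_mem ->|p0 hp].
    by rewrite gt0_muley ?lte_fin ?mulr_gt0// addey// leey.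
  apply: (@le_trans _ _ (ln (M' / normc (p n).[w]))%:E).
    have pw0 : 0 < normc (p n).[w] by rewrite normc_gt0.
    rewrite lee_fin -ler_expR lnK ?posrE ?divr_gt0// ler_pdivlMr//.
    by move: pB; rewrite /B expRN ler_pdivlMr ?expR_gt0// mulrC.
  move: hp; rewrite -lee_fin => /le_trans; apply.
  by rewrite EFinD leeD2l// EFinM lee_wpmul2l ?lee_fin// near_sum_le.
- move=> n; apply: le_trans (near_sum_integral r0 (nsr n) k0 k1) _.
  rewrite -EFinM lee_fin.
  have : (size (ns n))%:R <= L / ln 2 by rewrite ler_pdivlMr.
  move=> /(ler_wpM2r (ltW r2)) h.
  have -> : 5 * L * (4 * r ^+ 2) + 8 * r * ((size (ns n))%:R * (96 * r)) =
    20 * (L * r ^+ 2) + 8 * 96 * ((size (ns n))%:R * r ^+ 2) by ring.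
  have -> : (20 + 8 * (96 / ln 2)) * r ^+ 2 * L = 20 * (L * r ^+ 2) + 8 * 96 * (L / ln 2 * r ^+ 2).
    by field; rewrite gt_eqF.
  by move: h; lra.
Qed.

End entire.
End planar_bounds.

(** * Slicing integrals over tuples *)

Section tuple_integral.
Context {R : realType}.
Notation T := (measurableTypeR R).
Notation leb := (@lebesgue_measure R).
Local Open Scope ereal_scope.

Import HBNNSimple.

Lemma integral_le_measurable d (U : measurableType d) (mu : {measure set U -> \bar R})
    (F : U -> \bar R) (K : \bar R) : (forall x, 0 <= F x) ->
  (forall h : U -> \bar R, measurable_fun setT h -> (forall x, 0 <= h x) ->
    (forall x, h x <= F x) -> \int[mu]_x h x <= K) ->
  \int[mu]_x F x <= K.
Proof.
move=> F0 hK; rewrite ge0_integralTE//; apply: ge_ereal_sup => _ [h hF <-].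
rewrite -integralT_nnsfun; apply: hK => // [|x]; first exact/measurable_EFinP.
by rewrite lee_fin; exact: fun_ge0.
Qed.

Lemma integral_tuple1 n (H : n.+1.-tuple T -> \bar R) : measurable_fun setT H ->
  (forall t, 0 <= H t) ->
  \int[lebesgue_tuple R n.+1]_t H t =
  \int[leb]_a \int[lebesgue_tuple R n]_t H (tuple_cons (a, t)).
Proof.
move=> mH H0.
have -> : \int[lebesgue_tuple R n.+1]_t H t =
    \int[(lebesgue_measure \x lebesgue_tuple R n)%E]_z (H \o @tuple_cons T n) z.
  apply: (ge0_integral_pushforward (@measurable_tuple_cons R n)) => //.
rewrite fubini_tonelli1//; last by move=> z; exact: H0.
exact: (measurableT_comp mH (@measurable_tuple_cons R n)).
Qed.

Lemma integral_tuple2 n (H : n.+1.-tuple T -> \bar R) : measurable_fun setT H ->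
  (forall t, 0 <= H t) ->
  \int[lebesgue_tuple R n.+1]_t H t =
  \int[lebesgue_tuple R n]_t \int[leb]_a H (tuple_cons (a, t)).
Proof.
move=> mH H0.
have -> : \int[lebesgue_tuple R n.+1]_t H t =
    \int[(lebesgue_measure \x lebesgue_tuple R n)%E]_z (H \o @tuple_cons T n) z.
  apply: (ge0_integral_pushforward (@measurable_tuple_cons R n)) => //.
rewrite fubini_tonelli2//; last by move=> z; exact: H0.
exact: (measurableT_comp mH (@measurable_tuple_cons R n)).
Qed.

Lemma measurable_slice1 n (H : n.+1.-tuple T -> \bar R) (a : T) : measurable_fun setT H ->
  measurable_fun setT (fun t : n.-tuple T => H (tuple_cons (a, t))).
Proof.
move=> mH; apply: (measurableT_comp mH).
apply: (measurableT_comp (@measurable_tuple_cons R n)).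
exact: measurable_pair1.
Qed.

Lemma measurable_slice_integral n (H : n.+1.-tuple T -> \bar R) : measurable_fun setT H ->
  (forall t, 0 <= H t) ->
  measurable_fun setT (fun t : n.-tuple T => \int[leb]_a H (tuple_cons (a, t))).
Proof.
move=> mH H0.
apply: (@measurable_fun_fubini_tonelli_G _ _ T (n.-tuple T) R leb (H \o @tuple_cons T n)).
  exact: (measurableT_comp mH (@measurable_tuple_cons R n)).
by move=> z; exact: H0.
Qed.

Lemma integral_tuple_planar n (H : n.+2.-tuple T -> \bar R) : measurable_fun setT H ->
  (forall t, 0 <= H t) ->
  \int[lebesgue_tuple R n.+2]_t H t =
  \int[lebesgue_tuple R n]_t \int[planar]_z H (tuple_cons (z.1, tuple_cons (z.2, t))).
Proof.
move=> mH H0; rewrite integral_tuple2// integral_tuple2//; last 2 first.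
- exact: measurable_slice_integral.
- by move=> t; exact: integral_ge0.
apply: eq_integral => t _; rewrite /planar fubini_tonelli2//.
apply: (measurableT_comp mH).
apply: (measurableT_comp (@measurable_tuple_cons R n.+1)).
apply/measurable_fun_pairP; split; first exact: measurable_fst.
apply: (measurableT_comp (@measurable_tuple_cons R n)).
apply/measurable_fun_pairP; split; first exact: measurable_snd.
exact: measurable_cst.
Qed.

Lemma measurable_slice_planar n (H : n.+2.-tuple T -> \bar R) : measurable_fun setT H ->
  (forall t, 0 <= H t) ->
  measurable_fun setT (fun t : n.-tuple T =>
    \int[planar]_z H (tuple_cons (z.1, tuple_cons (z.2, t)))).
Proof.
move=> mH H0.
have -> : (fun t : n.-tuple T => \int[planar]_z H (tuple_cons (z.1, tuple_cons (z.2, t)))) =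
  (fun t : n.-tuple T => \int[leb]_b \int[leb]_a H (tuple_cons (a, tuple_cons (b, t)))).
  apply/funext => t; rewrite /planar fubini_tonelli2//.
  apply: (measurableT_comp mH).
  apply: (measurableT_comp (@measurable_tuple_cons R n.+1)).
  apply/measurable_fun_pairP; split; first exact: measurable_fst.
  apply: (measurableT_comp (@measurable_tuple_cons R n)).
  apply/measurable_fun_pairP; split; first exact: measurable_snd.
  exact: measurable_cst.
apply: (@measurable_slice_integral n (fun t => \int[leb]_a H (tuple_cons (a, t)))).
  exact: measurable_slice_integral.
by move=> t; exact: integral_ge0.
Qed.

(* [F] need not be measurable: its integral is a lower integral, and Tonelli is
   applied to the simple functions below [F]. *)
Theorem slice_domination (K : R) d j (F H : seq T -> \bar R) : (0 <= K)%R -> (j < d)%N ->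
  (forall s, 0 <= F s) -> (forall s, 0 <= H s) ->
  measurable_fun setT (fun t : d.*2.-tuple T => H t) ->
  (forall s1 s2 : seq T, size s1 = j.*2 -> size s2 = (d - j.+1).*2 ->
    \int[planar]_z F (s1 ++ [:: z.1, z.2 & s2]) <=
    K%:E * \int[planar]_z H (s1 ++ [:: z.1, z.2 & s2])) ->
  \int[lebesgue_tuple R d.*2]_t F t <= K%:E * \int[lebesgue_tuple R d.*2]_t H t.
Proof.
(* For [j = 0] the planar slice comes first and Tonelli applies at once. Otherwise two reals [a],
   [b] are fixed and the induction hypothesis is used for [F [:: a, b & s]]; functions of [seq] make
   this possible without casts between tuple lengths. *)
move=> K0; elim: d j F H => // d IH [|j] F H jd F0 H0 mH FH.
  apply: integral_le_measurable => // h mh h0 hF.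
  pose HT (t : d.*2.+2.-tuple T) := H t.
  have HT0 t : 0 <= HT t by exact: H0.
  rewrite (integral_tuple_planar mh h0) [X in _ * X](integral_tuple_planar (mH : measurable_fun setT HT) HT0).
  have mS := @measurable_slice_planar _ HT mH HT0.
  rewrite -ge0_integralZl//; last by move=> t _; exact: integral_ge0.
  apply: ge0_le_integral_dom => t _; first exact: integral_ge0.
  apply: le_trans (FH [::] t erefl _); last by rewrite size_tuple subn1.
  by apply: ge0_le_integral_dom => z _ //; exact: hF.
pose HT (t : d.*2.+2.-tuple T) := H t.
have HT0 t : 0 <= HT t by exact: H0.
have mHT : measurable_fun setT HT := mH.
pose HT1 a (t : d.*2.+1.-tuple T) := HT (tuple_cons (a, t)).
have HT10 a t : 0 <= HT1 a t by exact: HT0.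
have mHT1 a : measurable_fun setT (HT1 a) by exact: measurable_slice1.
have mI1 : measurable_fun setT (fun a : T => \int[lebesgue_tuple R d.*2.+1]_t HT1 a t).
  apply: (@measurable_fun_fubini_tonelli_F _ _ T _ R (lebesgue_tuple R d.*2.+1)
    (HT \o @tuple_cons T _)) => [|z]; last exact: HT0.
  exact: (measurableT_comp mHT (@measurable_tuple_cons R _)).
have mI2 a : measurable_fun setT (fun b : T => \int[lebesgue_tuple R d.*2]_t HT1 a (tuple_cons (b, t))).
  apply: (@measurable_fun_fubini_tonelli_F _ _ T _ R (lebesgue_tuple R d.*2)
    (HT1 a \o @tuple_cons T _)) => [|z]; last exact: HT10.
  exact: (measurableT_comp (mHT1 a) (@measurable_tuple_cons R _)).
apply: integral_le_measurable => // h mh h0 hF.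
rewrite integral_tuple1// [X in _ * X](integral_tuple1 mHT HT0).
rewrite -ge0_integralZl//; last by move=> t _; exact: integral_ge0.
apply: ge0_le_integral_dom => a _; first exact: integral_ge0.
rewrite integral_tuple1//; last exact: measurable_slice1.
rewrite [X in _ * X](integral_tuple1 (mHT1 a) (HT10 a)).
rewrite -ge0_integralZl//; last by move=> t _; exact: integral_ge0.
apply: ge0_le_integral_dom => b _; first exact: integral_ge0.
apply: (@le_trans _ _ (\int[lebesgue_tuple R d.*2]_t F [:: a, b & t])).
  by apply: ge0_le_integral_dom => t _ //; exact: hF.
apply: (IH j (fun s => F [:: a, b & s]) (fun s => H [:: a, b & s])) => //.
  exact: (measurable_slice1 b (mHT1 a)).
move=> s1 s2 h1 h2; apply: (FH [:: a, b & s1] s2); last by rewrite h2 subSS.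
by rewrite /= h1 doubleS.
Qed.

End tuple_integral.

Section measurable_continuous_tuple.
Context {R : realType} (n : nat).
Notation T := (measurableTypeR R).

Let grid (k : nat) (x : R) : int := Num.floor (k.+1%:R * x).
Let grid_itv k x (z : int) : (z%:~R / k.+1%:R <= x < (z + 1)%:~R / k.+1%:R) = (grid k x == z).
Proof.
have k0 : 0 < k.+1%:R :> R by rewrite ltr0n.
rewrite ler_pdivrMr// ltr_pdivlMr// mulrC /grid; apply/idP/eqP => [/floor_def//|<-].
exact: floor_itv.
Qed.

(* Rounding the coordinates down to the grid of step [1/(k+1)] makes the
   function take countably many values, on measurable cells. *)
Lemma measurable_continuous_tuple (phi : n.-tuple T -> R) :
  (forall t (e : R), 0 < e -> exists2 d : R, 0 < d &
    forall t', (forall i, `|(tnth t' i : R) - tnth t i| < d) -> `|phi t' - phi t| <= e) ->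
  measurable_fun setT phi.
Proof.
move=> cphi; pose v k (m : n.-tuple int) : n.-tuple T :=
  [tuple of [seq (z%:~R / k.+1%:R : T) | z <- m]].
pose gr k (t : n.-tuple T) : n.-tuple int := [tuple of [seq grid k x | x <- t]].
apply: (@measurable_fun_cvg _ _ _ _ (fun k t => phi (v k (gr k t)))) => [k|t _].
  move=> _ Y mY; rewrite setTI.
  pose cell (m : n.-tuple int) : set (n.-tuple T) :=
    \bigcap_(i in [set: 'I_n]) (@tnth _ T ^~ i @^-1`
      [set` `[((tnth m i)%:~R / k.+1%:R : R), (((tnth m i) + 1)%:~R / k.+1%:R : R)[ ]).
  have k0 : 0 < k.+1%:R :> R by rewrite ltr0n.
  have cellE m t : cell m t <-> gr k t = m.
    split => [ct|<- i _]; last by rewrite /= in_itv/= tnth_map grid_itv.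
    apply/eq_from_tnth => i; rewrite tnth_map; apply/eqP; rewrite -grid_itv.
    by have := ct i I; rewrite /= in_itv.
  have mcell m : measurable (cell m).
    apply: fin_bigcap_measurable => // i _; rewrite -[X in measurable X]setTI.
    by apply: measurable_tnth => //; exact: measurable_itv.
  have -> : (fun t => phi (v k (gr k t))) @^-1` Y =
      \bigcup_(m : n.-tuple int) (if pselect (Y (phi (v k m))) then cell m else set0).
    apply/seteqP; split => t /=.
      by move=> Yt; exists (gr k t) => //; case: pselect => //= _; exact/cellE.
    by move=> [m _]; case: pselect => //= Ym /cellE ->.
  apply: countable_bigcupT_measurable => [|m].
    exact: countableP.
  by case: pselect => _ /=; [exact: mcell|exact: measurable0].
apply/cvgrPdist_le => e e0; have [d d0 hd] := cphi t e e0.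
exists (Num.truncn d^-1) => // k /= dk; rewrite distrC; apply: hd => i.
have k0 : 0 < k.+1%:R :> R by rewrite ltr0n.
rewrite !tnth_map; set x : R := tnth t i.
have := grid_itv k x (grid k x); rewrite eqxx => /andP[h1 h2].
rewrite intrD mulrDl mul1r in h2.
rewrite distrC ger0_norm ?subr_ge0//; apply: (@lt_trans _ _ k.+1%:R^-1).
  by rewrite ltrBlDr addrC.
by rewrite invf_plt ?posrE// (lt_le_trans (truncnS_gt _))// ler_nat ltnS.
Qed.

End measurable_continuous_tuple.

(** * Entire functions of several variables: slices and measurability *)

Section entire_bridge.
Context {R : realType} {d : nat}.
Notation T := (measurableTypeR R).
Implicit Types (G : 'rV[cplx R]_d -> cplx R) (z : 'rV[cplx R]_d).

Lemma cplx_gt0 (e : cplx R) : 0 < e -> exists2 e' : R, 0 < e' & e = (e'%:C)%C.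
Proof.
by case: e => a b; rewrite ltcE/= => /andP[/eqP -> a0]; exists a.
Qed.

Lemma entire_cderiv G (z v : 'rV[cplx R]_d) : entire G ->
  cderiv (fun w : R[i] => G (z + (w : cplx R) *: v) : R[i]) 0 ('D_v G z).
Proof.
move=> eG e e0; have : derivable G z v by exact: diff_derivable.
move=> /cvg_ex[/= l hl].
have El : 'D_v G z = l by apply/cvg_lim.
rewrite El; have := (@cvgrPdist_le _ (cplx R : normedModType (cplx R)) _ _ _ _ _).1 hl => /(_ _ ((e%:C)%C : cplx R)).
rewrite ltcR => /(_ e0); rewrite /prop_near1 /nbhs/= /within/=.
move=> /nbhs_normP[d' /= /cplx_gt0[d0 d00 ->] hd].
exists d0 => // w; rewrite subr0 => wd.
have [->|w0] := eqVneq w 0.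
  by rewrite scale0r addr0 subrr mulr0 subrr normc0 mulr0.
have := hd w; rewrite /ball_/= sub0r normrN => /(_ _ w0).
have wd' : normc w < d0 -> `|(w : cplx R)| < (d0%:C)%C by rewrite normCE ltcR.
move=> /(_ (wd' wd)); rewrite normCE lecR => h.
rewrite scale0r addr0 [z + _]addrC.
have -> : G ((w : cplx R) *: v + z) - G z - l * w =
    - (w * (l - w^-1 * (G ((w : cplx R) *: v + z) - G z))).
  by move: (G _) (G _) => x y; field.
by rewrite normcN normcM mulrC ler_wpM2r// normc_ge0.
Qed.

Lemma entire_continuous G z (e : R) : entire G -> 0 < e -> exists2 d0 : R, 0 < d0 &
  forall z', (forall j, cabs (z' 0 j - z 0 j) < d0) -> cabs (G z' - G z) <= e.
Proof.
move=> eG e0; have /differentiable_continuous cG := eG z.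
have := (@cvgrPdist_le _ (cplx R : normedModType (cplx R)) _ _ _ _ _).1 cG => /(_ _ ((e%:C)%C : cplx R)).
rewrite ltcR => /(_ e0).
move=> /nbhs_ballP[d' /= /cplx_gt0[d0 d00 ->] hd].
exists d0 => // z' zz'; have := hd z'; rewrite normCE lecR normc_distC; apply.
split => [|i j]; first by rewrite ltcR.
by rewrite ord1 /ball/= normCE ltcR normc_distC; exact: zz'.
Qed.

Definition masked (m : nat -> bool) (s : seq R) : 'rV[cplx R]_d :=
  \row_j (if m j then 0 else nth 0 s j.*2 +i* nth 0 s j.*2.+1)%C.

Lemma masked_pred0 (x : d.*2.-tuple T) : masked (fun=> false) x = cvec x.
Proof. by []. Qed.

Lemma measurable_normc d0 (U : measurableType d0) (f : U -> R[i]) :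
  measurable_fun setT (fun x => Re (f x) : R) ->
  measurable_fun setT (fun x => Im (f x) : R) ->
  measurable_fun setT (fun x => normc (f x)).
Proof.
move=> m1 m2; have -> : (fun x => normc (f x)) =
    @Num.sqrt R \o (fun x => Re (f x) ^+ 2 + Im (f x) ^+ 2).
  by apply/funext => x /=; case: (f x).
apply: measurableT_comp; first exact: (continuous_measurable_fun (@sqrt_continuous R)).
by apply: measurable_funD; apply: measurable_funX.
Qed.

(** The shift [v] provides for the difference quotients whose limit is the directional
    derivative. *)
Lemma measurable_entire G m (v : 'rV[cplx R]_d) : entire G ->
  measurable_fun setT (fun t : d.*2.-tuple T => Re (G (masked m t + v)) : R) /\
  measurable_fun setT (fun t : d.*2.-tuple T => Im (G (masked m t + v)) : R).
Proof.
move=> eG; suff H (phi : cplx R -> R) : (forall x y, `|phi x - phi y| <= cabs (x - y)) ->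
    measurable_fun setT (fun t : d.*2.-tuple T => phi (G (masked m t + v)) : R).
  by split; apply: H => x y; rewrite /cabs -?cReN -?cReD -?cImN -?cImD;
    [exact: normr_Re|exact: normr_Im].
move=> hphi; apply: measurable_continuous_tuple => t e e0.
have [d0 d00 hd] := entire_continuous (masked m t + v) eG e0.
exists (d0 / 2); first by rewrite divr_gt0.
move=> t' tt'; apply: le_trans (hphi _ _) _; apply: hd => j.
rewrite !mxE opprD addrACA subrr addr0; case: (m j); first by rewrite subrr /cabs normc0.
have jd : (j.*2 < d.*2)%N by rewrite ltn_double.
have jd1 : (j.*2.+1 < d.*2)%N by have := ltn_ord j; lia.
have := tt' (Ordinal jd); have := tt' (Ordinal jd1); rewrite !(tnth_nth 0) => h1 h2.
by apply: le_lt_trans (normc_le_ReIm _) _; move: h1 h2 => /=; lra.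
Qed.

Lemma measurable_deriv_entire G m (v : 'rV[cplx R]_d) : entire G ->
  measurable_fun setT (fun t : d.*2.-tuple T => cabs ('D_v G (masked m t))).
Proof.
move=> eG; pose w n : R := n.+1%:R^-1.
pose q n (t : d.*2.-tuple T) : R[i] := (n.+1%:R%:C)%C *
  (G (masked m t + ((w n)%:C)%C *: v) - G (masked m t + 0)).
have w0 n : 0 < w n by rewrite invr_gt0.
have qlim (t : d.*2.-tuple T) (e : R) : 0 < e -> exists N, forall n, (N <= n)%N ->
    normc ('D_v G (masked m t) - q n t) <= e.
  move=> e0; have [d0 d00 hd] := entire_cderiv (masked m t) v eG e0.
  exists (Num.truncn d0^-1) => n Nn.
  have nw : normc ((w n)%:C)%C = w n by rewrite normc_real gtr0_norm.
  have wd : w n < d0.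
    by rewrite /w invf_plt ?posrE// (lt_le_trans (truncnS_gt _))// ler_nat ltnS.
  have := hd ((w n)%:C)%C; rewrite subr0 nw => /(_ wd); rewrite scale0r => h.
  rewrite -(ler_pM2r (w0 n)); apply: le_trans h; rewrite -[w n in leLHS]nw -normcM.
  rewrite -normcN le_eqVlt; apply/orP; left; apply/eqP; congr normc.
  rewrite /q /w fmorphV /=; have : ((n.+1%:R%:C)%C : R[i]) != 0.
    by rewrite eq_complex/= pnatr_eq0.
  by move: (n.+1%:R%:C)%C (G _) (G _) ('D_v _ _) => c x y D c0; field.
have mre : measurable_fun setT (fun t : d.*2.-tuple T => Re ('D_v G (masked m t)) : R).
  apply: (@measurable_fun_cvg _ _ _ _ (fun n (t : d.*2.-tuple T) => Re (q n t))) => [n|t _].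
    have [m1 _] := measurable_entire m (((w n)%:C)%C *: v) eG.
    have [m2 _] := measurable_entire m 0 eG.
    rewrite [X in measurable_fun _ X](_ : _ = fun t : d.*2.-tuple T => n.+1%:R *
      (Re (G (masked m t + ((w n)%:C)%C *: v)) - Re (G (masked m t + 0)))); last first.
      by apply/funext => t; rewrite /q cReM/= mul0r subr0 cReD cReN.
    by apply: measurable_funM => //; exact: measurable_funB.
  apply/cvgrPdist_le => e e0; have [N hN] := qlim t e e0.
  exists N => // n /= Nn; rewrite -cReN -cReD.
  exact: le_trans (normr_Re _) (hN n Nn).
have mim : measurable_fun setT (fun t : d.*2.-tuple T => Im ('D_v G (masked m t)) : R).
  apply: (@measurable_fun_cvg _ _ _ _ (fun n (t : d.*2.-tuple T) => Im (q n t))) => [n|t _].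
    have [_ m1] := measurable_entire m (((w n)%:C)%C *: v) eG.
    have [_ m2] := measurable_entire m 0 eG.
    rewrite [X in measurable_fun _ X](_ : _ = fun t : d.*2.-tuple T => n.+1%:R *
      (Im (G (masked m t + ((w n)%:C)%C *: v)) - Im (G (masked m t + 0)))); last first.
      by apply/funext => t; rewrite /q cImM/= mul0r addr0 cImD cImN.
    by apply: measurable_funM => //; exact: measurable_funB.
  apply/cvgrPdist_le => e e0; have [N hN] := qlim t e e0.
  exists N => // n /= Nn; rewrite -cImN -cImD.
  exact: le_trans (normr_Im _) (hN n Nn).
exact: measurable_normc mre mim.
Qed.

Lemma measurable_cabs_entire G m : entire G ->
  measurable_fun setT (fun t : d.*2.-tuple T => cabs (G (masked m t))).
Proof.
move=> eG; have [m1 m2] := measurable_entire m 0 eG.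
by apply: measurable_normc; [move: m1|move: m2]; under eq_fun do rewrite addr0.
Qed.

Lemma measurable_elog_entire G m (M : R) : 0 < M -> entire G ->
  measurable_fun setT (fun t : d.*2.-tuple T => elog M (G (masked m t))).
Proof.
move=> M0 eG; rewrite /elog; apply: measurable_fun_ifT => //.
  rewrite [X in measurable_fun _ X](_ : _ = fun t : d.*2.-tuple T => cabs (G (masked m t)) == 0).
    by apply: measurable_fun_eqr => //; exact: measurable_cabs_entire.
  by apply/funext => t; rewrite /cabs normc_eq0.
apply/measurable_EFinP; apply: (measurableT_comp (@measurable_ln R)).
apply: measurable_funM => //; apply: measurable_inv_ge0 => [|t]; last exact: normc_ge0.
exact: measurable_cabs_entire.
Qed.

End entire_bridge.

(** * The bound on a box *)

Section boxes.
Context {R : realType} (r : R).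
Notation T := (measurableTypeR R).
Notation leb := (@lebesgue_measure R).
Hypothesis r0 : 0 < r.

Definition boxed (s : seq R) : bool := all (fun x => `|x| <= r) s.

Definition on_box (F : seq R -> \bar R) (s : seq R) : \bar R :=
  if boxed s then F s else 0%E.

Lemma measurable_boxed n : measurable_fun setT (fun t : n.-tuple T => boxed t).
Proof.
apply: (measurable_fun_bool true).
rewrite [X in measurable X](_ : _ = \bigcap_(i in [set: 'I_n])
    (@tnth _ T ^~ i @^-1` `[(- r)%R, r]%classic)).
  apply: fin_bigcap_measurable => // i _; rewrite -[X in measurable X]setTI.
  by apply: measurable_tnth => //; exact: measurable_itv.
apply/seteqP; split => t /=.
  move=> [_ bt] i _; have : all (fun x : R => `|x| <= r) t by exact: bt.
  by move=> /all_tnthP /(_ i); rewrite /= in_itv/= ler_norml.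
move=> h; split => //; change (all (fun x : R => `|x| <= r) t = true); apply/all_tnthP => i.
by have := h i I; rewrite /= in_itv/= ler_norml.
Qed.

Lemma measurable_on_box n (F : seq R -> \bar R) :
  measurable_fun setT (fun t : n.-tuple T => F t) ->
  measurable_fun setT (fun t : n.-tuple T => on_box F t).
Proof. by move=> mF; apply: measurable_fun_ifT => //; exact: measurable_boxed. Qed.

Lemma integral_on_box_cst n (c : R) : 0 <= c ->
  (\int[lebesgue_tuple R n]_t on_box (fun=> c%:E) t = (c * (2 * r) ^+ n)%:E)%E.
Proof.
move=> c0; elim: n => [|n IH].
  rewrite /= integral_dirac//; last exact: (@measurable_on_box 0).
  by rewrite diracE mem_setT mul1e /on_box/= expr0 mulr1.
have on_box0 s : (0 <= on_box (fun=> c%:E) s)%E by rewrite /on_box; case: ifP.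
rewrite (integral_tuple1 (H := fun t => on_box (fun=> c%:E) t)); last 2 first.
- exact: measurable_on_box.
- by move=> t; exact: on_box0.
have E (a : T) : (\int[lebesgue_tuple R n]_t on_box (fun=> c%:E) (tuple_cons (a, t)) =
    ((cst (c * (2 * r) ^+ n)%:E) \_ (`[(- r)%R, r]%classic : set T)) a)%E.
  rewrite /patch; have -> : (a \in (`[(- r)%R, r]%classic : set T)) = (`|a : R| <= r).
    by rewrite mem_setE in_itv/= ler_norml.
  case: ifPn => ar; last first.
    by rewrite integral0_eq// => t _; rewrite /on_box/= (negbTE ar).
  by rewrite -IH; apply: eq_integral => t _; rewrite /on_box/= ar.
under eq_integral do rewrite E.
rewrite -integral_mkcond integral_cst//= lebesgue_measure_itv/= lte_fin ifT; last by rewrite -subr_gt0 opprK addr_gt0.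
by rewrite -EFinM opprK exprSr; congr EFin; ring.
Qed.

Lemma planar_on_box (F : seq R -> \bar R) s1 s2 :
  (\int[planar]_z on_box F (s1 ++ [:: z.1, z.2 & s2]) =
   if boxed s1 && boxed s2 then \int[planar]_(z in square r) F (s1 ++ [:: z.1, z.2 & s2]) else 0)%E.
Proof.
have bE (z : T * T) : boxed (s1 ++ [:: z.1, z.2 & s2]) =
    [&& boxed s1, boxed s2 & z \in square r].
  rewrite /boxed all_cat/= [in RHS]andbA.
  have -> : (z \in square r) = (`|z.1 : R| <= r) && (`|z.2 : R| <= r).
    by rewrite in_setX !mem_setE !in_itv/= !ler_norml.
  by case: (all _ s1); case: (all _ s2); rewrite /= ?andbF ?andbT.
case: ifPn => [/andP[b1 b2]|nb].
  rewrite [RHS]integral_mkcond; apply: eq_integral => z _.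
  by rewrite /on_box bE b1 b2 /patch/=.
apply: integral0_eq => z _; rewrite /on_box bE ifF//.
by apply/negbTE; apply: contra nb => /and3P[-> ->].
Qed.

Lemma boxed_domination (K : R) d j (F H : seq R -> \bar R) : 0 <= K -> (j < d)%N ->
  (forall s, boxed s -> (0 <= F s)%E) -> (forall s, boxed s -> (0 <= H s)%E) ->
  measurable_fun setT (fun t : d.*2.-tuple T => H t) ->
  (forall s1 s2, size s1 = j.*2 -> size s2 = (d - j.+1).*2 -> boxed s1 -> boxed s2 ->
    (\int[planar]_(z in square r) F (s1 ++ [:: z.1, z.2 & s2]) <=
     K%:E * \int[planar]_(z in square r) H (s1 ++ [:: z.1, z.2 & s2]))%E) ->
  (\int[lebesgue_tuple R d.*2]_t on_box F t <=
   K%:E * \int[lebesgue_tuple R d.*2]_t on_box H t)%E.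
Proof.
move=> K0 jd F0 H0 mH FH; apply: (slice_domination (j := j)) => //.
- by move=> s; rewrite /on_box; case: ifP => // /F0.
- by move=> s; rewrite /on_box; case: ifP => // /H0.
- exact: measurable_on_box.
- move=> s1 s2 h1 h2; rewrite !planar_on_box; case: ifP => [/andP[b1 b2]|_].
    exact: FH.
  by rewrite mule0.
Qed.

End boxes.

Lemma cderiv_shift {R : realType} (f : R[i] -> R[i]) (w0 D : R[i]) :
  cderiv (fun u => f (w0 + u)) 0 D -> cderiv f w0 D.
Proof.
move=> h e e0; have [d0 d00 hd] := h e e0; exists d0 => // w wd.
by have := hd (w - w0); rewrite subr0 addr0 [w0 + _]addrC subrK; exact.
Qed.

Section slices.
Context {R : realType} {d : nat}.
Notation T := (measurableTypeR R).
Variables (G : 'rV[cplx R]_d -> cplx R) (r M M' : R).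
Hypothesis r0 : 0 < r.
Hypothesis eG : entire G.
Hypothesis GM : forall z : 'rV[cplx R]_d, (forall j, cabs (z 0 j) <= 12 * r) -> cabs (G z) <= M.
Hypothesis MM' : M < M'.

(** Exhibits the dependence on the pair in position [j] as a complex line in direction
    [delta_mx 0 j], the form in which one-variable bounds apply. *)
Lemma masked_split (m : nat -> bool) (j : 'I_d) (s1 s2 : seq R) (x y : R) :
  size s1 = j.*2 -> ~~ m j ->
  masked m (s1 ++ [:: x, y & s2]) =
  masked (fun i => m i || (i == j)) (s1 ++ [:: 0, 0 & s2]) + ((x +i* y)%C : cplx R) *: delta_mx 0 j
  :> 'rV[cplx R]_d.
Proof.
move=> h mj; apply/rowP => i; rewrite !mxE eqxx/=.
have -> : ((i : nat) == j) = (i == j) by []; case: (eqVneq i j) => [->|ij].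
  by rewrite (negbTE mj) orbT mulr1 add0r !nth_cat h ltnn subnn ltnNge leqnSn/= subSnn.
rewrite mulr0 addr0 orbF; case: (m i) => //.
have ij' : (i : nat) != j by [].
suff H (k : nat) : k != j.*2 -> k != j.*2.+1 ->
    nth 0 (s1 ++ [:: x, y & s2]) k = nth 0 (s1 ++ [:: 0, 0 & s2]) k :> R.
  by rewrite !H//; move: ij'; clear; move: (nat_of_ord i) (nat_of_ord j) => a b; lia.
move=> k1 k2; rewrite !nth_cat h; case: ltnP => // k3.
have [a ->] : exists a, k = (a.+2 + j.*2)%N by exists (k - j.*2 - 2)%N; lia.
by rewrite addnK.
Qed.

Lemma masked_indep (m : nat -> bool) (j : 'I_d) (s1 s2 : seq R) (x y : R) :
  size s1 = j.*2 -> m j ->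
  masked m (s1 ++ [:: x, y & s2]) = masked m (s1 ++ [:: 0, 0 & s2]) :> 'rV[cplx R]_d.
Proof.
move=> h mj; apply/rowP => i; rewrite !mxE; case: ifPn => // mi.
have ij' : (i : nat) != j by apply: contra mi => /eqP ->.
suff H (k : nat) : k != j.*2 -> k != j.*2.+1 ->
    nth 0 (s1 ++ [:: x, y & s2]) k = nth 0 (s1 ++ [:: 0, 0 & s2]) k :> R.
  by rewrite !H//; move: ij'; clear; move: (nat_of_ord i) (nat_of_ord j) => a b; lia.
move=> k1 k2; rewrite !nth_cat h; case: ltnP => // k3.
have [a ->] : exists a, k = (a.+2 + j.*2)%N by exists (k - j.*2 - 2)%N; lia.
by rewrite addnK.
Qed.

Lemma boxed_nth (s : seq R) k : boxed r s -> `|nth 0 s k| <= r.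
Proof.
move=> /allP h; have [ks|ks] := ltnP k (size s); first by apply: h; exact: mem_nth.
by rewrite nth_default// normr0 ltW.
Qed.

Lemma cabs_masked m s j : boxed r s -> cabs ((masked m s : 'rV[cplx R]_d) 0 j) <= 2 * r.
Proof.
move=> bs; rewrite mxE; case: (m j); first by rewrite /cabs normc0 mulr_ge0// ltW.
apply: le_trans (normc_le_ReIm _) _.
by have := boxed_nth j.*2 bs; have := boxed_nth j.*2.+1 bs => /=; lra.
Qed.

Lemma cabs_masked_G m s : boxed r s -> cabs (G (masked m s)) <= M'.
Proof.
move=> bs; apply: ltW; apply: le_lt_trans MM'; apply: GM => j.
by apply: le_trans (cabs_masked m j bs) _; move: r0; lra.
Qed.

Section one_slice.
Variables (m : nat -> bool) (j : 'I_d) (s1 s2 : seq R).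
Hypotheses (s1j : size s1 = j.*2) (b1 : boxed r s1) (b2 : boxed r s2) (mj : ~~ m j).

Let m' i := m i || (i == j).
Let f (w : R[i]) : R[i] := G (masked m' (s1 ++ [:: 0, 0 & s2]) + (w : cplx R) *: delta_mx 0 j).

Let fE z : f (pt z) = G (masked m (s1 ++ [:: z.1, z.2 & s2])).
Proof. by rewrite (masked_split _ _ _ s1j mj). Qed.

Let f0E z : f 0 = G (masked m' (s1 ++ [:: z.1, z.2 & s2])).
Proof. by rewrite /f scale0r addr0 (masked_indep _ z.1 z.2 s1j)// /m' eqxx orbT. Qed.

Let df w : cderiv f w ('D_(delta_mx 0 j) G
  (masked m' (s1 ++ [:: 0, 0 & s2]) + (w : cplx R) *: delta_mx 0 j)).
Proof.
apply: cderiv_shift.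
have := entire_cderiv (masked m' (s1 ++ [:: 0, 0 & s2]) + (w : cplx R) *: delta_mx 0 j) (delta_mx 0 j) eG.
by rewrite /f; under eq_fun do rewrite -addrA -scalerDl.
Qed.

Let fM w : normc w <= 12 * r -> normc (f w) <= M.
Proof.
move=> wr; apply: GM => i; rewrite !mxE eqxx/= /m'; case: (eqVneq i j) => [->|ij].
  by rewrite eqxx orbT add0r mulr1.
rewrite mulr0 addr0; have := @cabs_masked m' (s1 ++ [:: 0, 0 & s2]) i.
rewrite /boxed all_cat /= normr0 ltW//; move: b1 b2; rewrite /boxed => -> -> /(_ isT).
rewrite mxE /m' => h; apply: le_trans h _.
by move: r0; lra.
Qed.

(** The one-variable bound has [elog M' (f 0)] on the right, which is constant in [z]. Writing it as
    a mean over the square of area [4 * r ^+ 2] keeps the shape needed for the next coordinate and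
    turns the factor [r] into [1 / (4 * r)]. *)
Lemma slice_log_deriv :
  (\int[planar]_(z in square r)
    (cabs ('D_(delta_mx 0 j) G (masked m (s1 ++ [:: z.1, z.2 & s2])) /
           G (masked m (s1 ++ [:: z.1, z.2 & s2])))%R)%:E <=
   ((11 + 96 / ln 2) / (4 * r))%:E *
   \int[planar]_(z in square r) elog M' (G (masked m' (s1 ++ [:: z.1, z.2 & s2]))))%E.
Proof.
under [X in (_ <= _ * X)%E]eq_integral do rewrite -f0E.
rewrite integral_cst/=; last exact: measurable_square.
rewrite [X in (_ * (_ * X))%E](planar_square (ltW r0)) [(elog _ _ * _)%E]muleC muleA -EFinM.
rewrite (_ : _ * (2 * r) ^+ 2 = (11 + 96 / ln 2) * r); last first.
  by move: (11 + _) => k; field; rewrite gt_eqF.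
apply: le_trans (log_deriv_integral r0 (fun w => ex_intro _ _ (df w)) fM MM' df).
by apply: ge0_le_integral_dom => z _; rewrite ?lee_fin ?normc_ge0// fE /pt -(masked_split _ _ _ s1j mj).
Qed.

(** The factor [r ^+ 2] cancels against the area of the square, so this constant is independent of
    [r]. *)
Lemma slice_elog :
  (\int[planar]_(z in square r) elog M' (G (masked m (s1 ++ [:: z.1, z.2 & s2]))) <=
   (5 + 2 * (96 / ln 2))%:E *
   \int[planar]_(z in square r) elog M' (G (masked m' (s1 ++ [:: z.1, z.2 & s2]))))%E.
Proof.
under [X in (_ <= _ * X)%E]eq_integral do rewrite -f0E.
rewrite integral_cst/=; last exact: measurable_square.
rewrite [X in (_ * (_ * X))%E](planar_square (ltW r0)) [(elog _ _ * _)%E]muleC muleA -EFinM.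
rewrite (_ : _ * (2 * r) ^+ 2 = (20 + 8 * (96 / ln 2)) * r ^+ 2); last by move: (96 / _) => k; ring.
have := elog_integral r0 (fun w => ex_intro _ _ (df w)) fM MM'.
by under eq_integral do rewrite fE.
Qed.

End one_slice.

End slices.

Section box_integral.
Context {R : realType} {d : nat}.
Notation T := (measurableTypeR R).
Variables (G : 'rV[cplx R]_d -> cplx R) (r M M' : R).
Hypothesis r0 : 0 < r.
Hypothesis eG : entire G.
Hypothesis GM : forall z : 'rV[cplx R]_d, (forall j, cabs (z 0 j) <= 12 * r) -> cabs (G z) <= M.
Hypothesis MM' : M < M'.

Let M'0 : 0 < M'.
Proof.
apply: le_lt_trans MM'; apply: le_trans (normc_ge0 (G 0)) _; apply: GM => j.
by rewrite mxE /cabs normc0 mulr_ge0// ltW.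
Qed.

Let ln20 : 0 < ln 2 :> R.
Proof. by rewrite ln_gt0// ltr1n. Qed.

Let H m (s : seq R) : \bar R := elog M' (G (masked m s)).

Let H0 m s : boxed r s -> (0 <= H m s)%E.
Proof. by move=> bs; apply/elog_ge0/(cabs_masked_G r0 GM MM'). Qed.

Let mH m : measurable_fun setT (fun t : d.*2.-tuple T => H m t).
Proof. exact: measurable_elog_entire. Qed.

Let k2 : R := 5 + 2 * (96 / ln 2).

Let k2_ge1 : 1 <= k2.
Proof. have : 0 <= 96 / ln 2 :> R by rewrite divr_ge0// ltW.
by rewrite /k2; move: (96 / _) => k; lra. Qed.

(* Coordinate [j] is frozen first, by the bound on the logarithmic derivative;
   the others follow in order, by the bound on [elog]. *)
Let mask (j k : nat) : nat -> bool := fun i => (i < k)%N || (i == j).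

Let chain (j k : nat) : (k <= d)%N ->
  (\int[lebesgue_tuple R d.*2]_t on_box r (H (mask j 0)) t <=
   (k2 ^+ k)%:E * \int[lebesgue_tuple R d.*2]_t on_box r (H (mask j k)) t)%E.
Proof.
elim: k => [_|k IH kd]; first by rewrite expr0 mul1e.
apply: le_trans (IH (ltnW kd)) _; rewrite exprSr EFinM -muleA.
apply: lee_wpmul2l; first by rewrite lee_fin exprn_ge0// (le_trans _ k2_ge1).
have k20 : 0 <= k2 by apply: le_trans k2_ge1.
(* Coordinate [j] is frozen already; its step changes nothing and is absorbed by [1 <= k2]. *)
case: (eqVneq k j) => [kj|kj].
  have -> : mask j k.+1 = mask j k.
    by apply/funext => i; rewrite /mask ltnS [(i <= k)%N]leq_eqVlt kj; case: (i == j); rewrite ?orbT.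
  rewrite -[leLHS]mul1e; apply: lee_wpmul2r; last by rewrite lee_fin.
  by apply: integral_ge0 => t _; rewrite /on_box; case: ifP => // /H0.
apply: (boxed_domination (j := k)) => //; try exact: H0.
move=> s1 s2 h1 _ b1 b2; have mk : ~~ mask j k k by rewrite /mask ltnn.
have := slice_elog r0 eG GM MM' (j := Ordinal kd) h1 b1 b2 mk.
suff -> : (fun i => mask j k i || (i == Ordinal kd)) = mask j k.+1 by [].
by apply/funext => i; rewrite /mask ltnS [(i <= k)%N]leq_eqVlt/=; case: (i == k); rewrite ?orbT ?orbF.
Qed.

Lemma log_deriv_box (j : 'I_d) : G 0 != 0 ->
  (\int[lebesgue_tuple R d.*2]_t on_box r (fun s =>
    (cabs ('D_(delta_mx 0 j) G (masked (fun=> false) s) / G (masked (fun=> false) s))%R)%:E) t <=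
   ((11 + 96 / ln 2) / (4 * r) * (k2 ^+ d * (ln (M' / cabs (G 0)) * (2 * r) ^+ d.*2)))%:E)%E.
Proof.
move=> G0; have K0 : 0 <= (11 + 96 / ln 2) / (4 * r).
  by rewrite divr_ge0 ?addr_ge0 ?divr_ge0 ?mulr_ge0// ltW.
apply: (@le_trans _ _ (((11 + 96 / ln 2) / (4 * r))%:E *
    \int[lebesgue_tuple R d.*2]_t on_box r (H (mask j 0)) t)%E).
  apply: (boxed_domination (j := j)) => //; try exact: H0.
    by move=> s _; rewrite lee_fin normc_ge0.
  by move=> s1 s2 h1 _ b1 b2; exact: (slice_log_deriv r0 eG GM MM' (m := fun=> false)).
rewrite [leRHS]EFinM; apply: lee_wpmul2l; first by rewrite lee_fin.
apply: le_trans (chain j (leqnn d)) _.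
rewrite [leRHS]EFinM; apply: lee_wpmul2l; first by rewrite lee_fin exprn_ge0// (le_trans _ k2_ge1).
(* Once every coordinate is frozen, the integrand is the constant [elog M' (G 0)]. *)
have HE s : H (mask j d) s = (ln (M' / cabs (G 0)))%:E.
  rewrite /H /elog (_ : masked _ _ = 0) ?(negbTE G0)//.
  by apply/rowP => i; rewrite !mxE /mask ltn_ord.
rewrite -(integral_on_box_cst r0).
  by under eq_integral do rewrite /on_box HE.
(* As the value no longer depends on [s], the empty sequence, trivially boxed, yields the sign of
   the logarithm. *)
by have := H0 (mask j d) (s := [::]); rewrite HE lee_fin; exact.
Qed.

End box_integral.

(** * From the box to the Euclidean ball *)

Section euclidean_length.
Context {R : realType} {d : nat}.
Implicit Type v : 'rV[cplx R]_d.

Lemma cabs_le_enorm v j : cabs (v 0 j) <= enorm v.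
Proof.
rewrite -[leLHS](ger0_norm (normc_ge0 _)) -sqrtr_sqr ler_wsqrtr// (bigD1 j)//= lerDl.
by apply: sumr_ge0 => i _; rewrite sqr_ge0.
Qed.

Lemma enorm_le_sum v : enorm v <= \sum_j cabs (v 0 j).
Proof.
have s0 : 0 <= \sum_j cabs (v 0 j) by apply: sumr_ge0 => j _; exact: normc_ge0.
rewrite -[leRHS](ger0_norm s0) -sqrtr_sqr ler_wsqrtr//.
rewrite [leRHS]expr2 big_distrl/=; apply: ler_sum => j _.
rewrite expr2 ler_wpM2l ?normc_ge0// (bigD1 j)//= lerDl.
by apply: sumr_ge0 => i _; exact: normc_ge0.
Qed.

Lemma enorm_le_sup v (c : R) : 0 <= c -> (forall j, cabs (v 0 j) <= c) ->
  enorm v <= c * Num.sqrt d%:R.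
Proof.
move=> c0 vc; rewrite -[c in leRHS](ger0_norm c0) -sqrtr_sqr -sqrtrM ?sqr_ge0// ler_wsqrtr//.
rewrite mulr_natr -[X in _ *+ X]card_ord -sumr_const; apply: ler_sum => j _.
by rewrite lerXn2r ?nnegrE ?normc_ge0.
Qed.

Lemma enorm_boxed (r : R) (x : d.*2.-tuple (measurableTypeR R)) :
  enorm (cvec x) < r -> boxed r x.
Proof.
move=> xr; apply/allP => y /(nthP 0)[k]; rewrite size_tuple => kd <- {y}.
have jd : (k./2 < d)%N by lia.
apply: le_trans (ltW xr); apply: le_trans (cabs_le_enorm _ (Ordinal jd)).
rewrite mxE /=; have [kk|kk] : k = k./2.*2 \/ k = k./2.*2.+1 by lia.
  by rewrite -kk; exact: normr_Re (Complex _ _).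
by rewrite -kk; exact: normr_Im (Complex _ _).
Qed.

End euclidean_length.

(** The ball lies in the box, and the Euclidean length is at most the sum of the moduli of the
    components. *)
Lemma L1norm_ball_le {R : realType} {d : nat} (G : 'rV[cplx R]_d -> cplx R) (r : R) :
  entire G ->
  (L1norm_ball r (log_gradient G) <= \sum_(j < d) \int[lebesgue_tuple R d.*2]_t
     on_box r (fun s => (cabs ('D_(delta_mx 0 j) G (masked (fun=> false) s) /
       G (masked (fun=> false) s))%R)%:E) t)%E.
Proof.
move=> eG; rewrite /L1norm_ball -ge0_integral_sum//; last 2 first.
- move=> j; apply: (measurable_on_box r); apply/measurable_EFinP.
  under eq_fun do rewrite /cabs normcM normcV.
  apply: measurable_funM; first exact: measurable_deriv_entire.
  by apply: measurable_inv_ge0 => [|t]; [exact: measurable_cabs_entire|exact: normc_ge0].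
- by move=> j t _; rewrite /on_box; case: ifP => // _; rewrite lee_fin normc_ge0.
rewrite [leLHS]integral_mkcond; apply: ge0_le_integral_dom => x _; rewrite patchE.
  by case: ifP => // _; rewrite lee_fin sqrtr_ge0.
case: ifPn => [|_]; last first.
  by apply: sume_ge0 => j _; rewrite /on_box; case: ifP => // _; rewrite lee_fin normc_ge0.
rewrite inE/= => /enorm_boxed bx; rewrite /on_box bx sumEFin lee_fin masked_pred0.
apply: le_trans (enorm_le_sum _) _; apply: ler_sum => j _.
by rewrite !mxE mulrC.
Qed.

Theorem theoremB (R : realType) (d : nat) (alpha beta : R) :
  (1 <= d)%N -> 0 < alpha -> 0 < beta ->
  exists2 c : R, 0 < c &
    forall G : 'rV[cplx R]_d -> cplx R,
      entire G ->
      (exists z, G z != 0) ->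
      (forall r : R, 0 < r ->
        (ereal_sup [set (cabs (G z))%:E | z in [set z | (enorm z <= r)%R]]
         <= (cabs (G 0) * expR (alpha * r `^ beta))%:E)%E) ->
      forall r : R, 0 < r ->
        (L1norm_ball r (log_gradient G)
         <= (c * r `^ ((2 * d)%:R + beta - 1))%:E)%E.
Proof.
move=> d1 alpha0 beta0; have ln20 : 0 < ln 2 :> R by rewrite ln_gt0// ltr1n.
pose k1 : R := 11 + 96 / ln 2; pose k2 : R := 5 + 2 * (96 / ln 2).
have k10 : 0 < k1 by rewrite addr_gt0// divr_gt0.
have k20 : 0 < k2 by rewrite addr_gt0// mulr_gt0// divr_gt0.
(* The polydisc of radius [12 * r] lies in the Euclidean ball of radius [q * r], where the growth
   hypothesis is applied. *)
pose q : R := 12 * Num.sqrt d%:R.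
have q0 : 0 < q by rewrite mulr_gt0// sqrtr_gt0 ltr0n.
exists (d%:R * (k1 / 4) * (k2 ^+ d * (2 * alpha * q `^ beta * 2 ^+ d.*2))).
  by rewrite !mulr_gt0 ?ltr0n ?exprn_gt0 ?powR_gt0// divr_gt0.
move=> G eG [z0 Gz0] Gsup r r0.
have Gle z (t : R) : 0 < t -> enorm z <= t -> cabs (G z) <= cabs (G 0) * expR (alpha * t `^ beta).
  move=> t0 zt; rewrite -lee_fin; apply: le_trans (Gsup t t0).
  by apply: ereal_sup_ubound; exists z.
(* If [G 0] vanished, the growth bound on a ball containing [z0] would give [G z0 = 0]. *)
have G0 : G 0 != 0.
  apply: contra Gz0 => /eqP G0; apply/eqP/eq0_normc/eqP; rewrite eq_le normc_ge0 andbT.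
  have t0 : 0 < enorm z0 + 1 by rewrite ltr_wpDl ?sqrtr_ge0.
  by have := Gle z0 _ t0 (ler_wpDr ler01 (lexx _)); rewrite G0 {2}/cabs normc0 mul0r.
have g0 : 0 < cabs (G 0) by rewrite normc_gt0.
pose X : R := (q * r) `^ beta.
have X0 : 0 < X by rewrite powR_gt0// mulr_gt0.
have GM (z : 'rV[cplx R]_d) : (forall j, cabs (z 0 j) <= 12 * r) ->
    cabs (G z) <= cabs (G 0) * expR (alpha * X).
  move=> zr; apply: Gle; first by rewrite mulr_gt0.
  by rewrite mulrAC; apply: enorm_le_sup => //; rewrite mulr_ge0// ltW.
(* Doubling the exponent gives the strict gap, and [ln (M' / |G 0|)] becomes exactly
   [2 * alpha * X]. *)
have MM' : cabs (G 0) * expR (alpha * X) < cabs (G 0) * expR (2 * alpha * X).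
  by rewrite ltr_pM2l// ltr_expR -mulrA ltr_pMl ?mulr_gt0// ltr1n.
apply: le_trans (L1norm_ball_le r eG) _.
apply: le_trans (lee_sum _ (fun j _ => log_deriv_box r0 eG GM MM' j G0)) _.
rewrite sumEFin lee_fin sumr_const card_ord -[leLHS]mulr_natl.
rewrite [_ * expR _ / _]mulrAC divff ?gt_eqF// mul1r expRK.
(* The power of [r] has three sources: [2 * d] from the volume of the box, [beta] from [X], and -1
   from the logarithmic derivative. *)
rewrite powRB ?(gt_eqF r0) ?implybT// powRD ?(gt_eqF r0) ?implybT//.
rewrite powR_mulrn ?(ltW r0)// powRr1 ?(ltW r0)// mul2n exprMn.
rewrite /X powRM ?(ltW q0) ?(ltW r0)// -/k1 -/k2.
rewrite le_eqVlt; apply/orP; left; apply/eqP.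
move: (r ^+ _) (2 ^+ _) (k2 ^+ _) (q `^ _) (r `^ _) (k1) => a b c e f g.
by field; rewrite gt_eqF.
Qed.
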